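(* In ICaTT, invertible cells satisfy the 2-of-6 property: for every context $\Gamma$ of ICaTT, every type $\Gamma\vdash A$ equal to $*$ or an arrow type, terms $x,y,z,w:A$ and composable terms $f:x\to_Ay$, $g:y\to_Az$, $h:z\to_Aw$ in $\Gamma$, if $f*g$ and $g*h$ are invertible in $\Gamma$, then $f$, $g$ and $h$ are invertible in $\Gamma$.
   Context: \textbf{CaTT.} Raw syntax: types $A::=*\mid t\to_A u$; terms $t::=x\mid\mathrm{coh}_{\Gamma,A}[\gamma]$ with $x$ a variable; contexts are finite lists $(x_1:A_1,\dots,x_k:A_k)$ and substitutions finite lists $\langle x_1\mapsto t_1,\dots,x_k\mapsto t_k\rangle$; the empty ones are $\varnothing$ and $\langle\rangle$. Contexts are identified up to renaming of variables. Substitutions act on types and terms by replacing variables, with $\mathrm{coh}_{\Gamma,A}[\delta][\gamma]=\mathrm{coh}_{\Gamma,A}[\delta\circ\gamma]$, where $\langle x_i\mapsto t_i\rangle\circ\gamma=\langle x_i\mapsto t_i[\gamma]\rangle$. Dimensions: $\dim *=-1$, $\dim(t\to_Au)=\dim A+1$, $\dim\varnothing=-1$, $\dim(\Gamma,x:A)=\max(\dim\Gamma,\dim A+1)$; a term of type $A$ has dimension $\dim A+1$. The judgements $\Gamma\vdash$ (context), $\Gamma\vdash A$ (type), $\Gamma\vdash t:A$ (term), $\Delta\vdash\gamma:\Gamma$ (substitution) are generated by the usual structural rules ($\varnothing\vdash$; $\Gamma,x:A\vdash$ if $\Gamma\vdash A$ and $x$ is fresh; $\Gamma\vdash x:A$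 if $(x:A)\in\Gamma$; $\Delta\vdash\langle\rangle:\varnothing$; $\Delta\vdash\langle\gamma,x\mapsto t\rangle:(\Gamma,x:A)$ if $\Delta\vdash\gamma:\Gamma$, $\Gamma\vdash A$ and $\Delta\vdash t:A[\gamma]$) and: $\Gamma\vdash *$ if $\Gamma\vdash$; $\Gamma\vdash u\to_Av$ if $\Gamma\vdash u:A$ and $\Gamma\vdash v:A$ with $A$ equal to $*$ or an arrow type; and the coherence rule below. The source and target of a term of type $u\to_A v$ are $u$ and $v$; the index $A$ is often omitted. Pasting diagrams: $\Gamma\vdash_{\mathrm{ps}}x:A$ is generated by $(x:* )\vdash_{\mathrm{ps}}x:*$; if $\Gamma\vdash_{\mathrm{ps}}f:x\to_Ay$ then $\Gamma\vdash_{\mathrm{ps}}y:A$; if $\Gamma\vdash_{\mathrm{ps}}x:A$ then $(\Gamma,y:A,f:x\to_Ay)\vdash_{\mathrm{ps}}f:x\to_Ay$. $\Gamma$ is a pasting diagram if $\Gamma\vdash_{\mathrm{ps}}x:*$ for some $x$. A source (resp. target) variable of a pasting diagram is one that is not the target (resp. source) of another variable. A term uses a variable if it occurs in the term or its type. A valid type $u\to_Av$ in a pasting diagram $\Gamma$ of dimension $n$ is full if either $u$ and $v$ both use all variables of $\Gamma$, or $\dim u=\dim v=n-1$ and $u$ (resp. $v$) uses all source (resp. target) variables of $\Gamma$ of dimension at most $n-1$. Coherence rule: if $\Gamma$ is a pasting diagram, $A$ a full type in $\Gamma$ and $\Delta\vdash\gamma:\Gamma$, then $\Delta\vdash\mathrm{coh}_{\Gamma,A}[\gamma]:A[\gamma]$.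 Suspension $\Sigma$: $\Sigma\varnothing=(v^-:*,v^+:* )$ with fresh $v^\pm$, $\Sigma(\Gamma,x:A)=(\Sigma\Gamma,x:\Sigma A)$, $\Sigma *=(v^-\to_*v^+)$, $\Sigma(u\to_Av)=(\Sigma u\to_{\Sigma A}\Sigma v)$, $\Sigma x=x$, $\Sigma\mathrm{coh}_{\Gamma,A}[\gamma]=\mathrm{coh}_{\Sigma\Gamma,\Sigma A}[\Sigma\gamma]$, $\Sigma\langle\rangle=\langle v^-\mapsto v^-,v^+\mapsto v^+\rangle$, $\Sigma\langle\gamma,x\mapsto t\rangle=\langle\Sigma\gamma,x\mapsto\Sigma t\rangle$. Disks: $\mathbb D^0=(d_0:* )$, $\mathbb D^{n+1}=\Sigma\mathbb D^n$, with top-dimensional variable of $\mathbb D^n$ denoted $d_n$. A term $t$ of dimension $n$ in $\Gamma$ (with type $*$ or an arrow) corresponds to the unique substitution $\Gamma\vdash\chi_t:\mathbb D^n$ with $d_n[\chi_t]=t$ (other variables go to iterated sources and targets of $t$). Identity and composition: $\mathrm{id}\,x=\mathrm{coh}_{(x:* ),x\to x}[\mathrm{id}]$ in $(x:* )$, and $f*g=\mathrm{coh}_{\Gamma,x\to z}[\mathrm{id}]:x\to z$ in $\Gamma=(x:*,y:*,f:x\to y,z:*,g:y\to z)$; by suspending and substituting, $\mathrm{id}\,x$ and $f*g$ are defined for terms $x:A$, $f:x\to_Ay$, $g:y\to_Az$ of any dimension in any context. \textbf{ICaTT} keeps all rules of CaTT and adds a type constructor $\mathrm{Inv}_A(t)$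 (index often omitted) and term constructors $\mathrm{can}(t,\{e_x\})$, $\mathrm{coind}(t,t_l,t_r,t_{lu},t_{ru},t_{ilu},t_{iru})$, $\mathrm{rec}(t,t_l,t_r,t_{lu},t_{ru},t_{ilu},t_{iru},\gamma)$, $\mathrm{linv}(t)$, $\mathrm{rinv}(t)$, $\mathrm{lunit}(t)$, $\mathrm{runit}(t)$, $\mathrm{ilunit}(t)$, $\mathrm{irunit}(t)$. Suspension commutes with all new constructors. Substitution commutes with all of them except $\mathrm{rec}(\dots,\gamma)[\sigma]=\mathrm{rec}(\dots,\gamma\circ\sigma)$. Judgemental equality $\equiv$ is the congruence generated by the computation rules below; typing is up to $\equiv$. (Inv) If $\Gamma\vdash t:u\to_Av$ then $\Gamma\vdash\mathrm{Inv}(t)$. (Destructors) If $\Gamma\vdash e:\mathrm{Inv}(t)$ with $t:u\to v$, then $\mathrm{linv}(e):v\to u$, $\mathrm{rinv}(e):v\to u$, $\mathrm{lunit}(e):\mathrm{linv}(e)*t\to\mathrm{id}\,v$, $\mathrm{runit}(e):t*\mathrm{rinv}(e)\to\mathrm{id}\,u$, $\mathrm{ilunit}(e):\mathrm{Inv}(\mathrm{lunit}(e))$, $\mathrm{irunit}(e):\mathrm{Inv}(\mathrm{runit}(e))$ in $\Gamma$. (coind) If in $\Gamma$: $t:x\to y$, $t_l,t_r:y\to x$, $t_{lu}:t_l*t\to\mathrm{id}\,y$, $t_{ru}:t*t_r\to\mathrm{id}\,x$, $t_{ilu}:\mathrm{Inv}(t_{lu})$, $t_{iru}:\mathrm{Inv}(t_{ru})$,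 then $\mathrm{coind}(t,t_l,t_r,t_{lu},t_{ru},t_{ilu},t_{iru}):\mathrm{Inv}(t)$. The six $\beta$-rules say that $\mathrm{linv},\mathrm{rinv},\mathrm{lunit},\mathrm{runit},\mathrm{ilunit},\mathrm{irunit}$ of this term are $t_l,t_r,t_{lu},t_{ru},t_{ilu},t_{iru}$ respectively; the $\eta$-rule is $e\equiv\mathrm{coind}(t,\mathrm{linv}(e),\mathrm{rinv}(e),\mathrm{lunit}(e),\mathrm{runit}(e),\mathrm{ilunit}(e),\mathrm{irunit}(e))$ for $e:\mathrm{Inv}(t)$. (can) If $\Delta\vdash t=\mathrm{coh}_{\Gamma,A}[\gamma]:A[\gamma]$ with $\dim A=n$, and $\Delta\vdash e_x:\mathrm{Inv}(x[\gamma])$ for every $(n+1)$-dimensional variable $x$ of $\Gamma$, then $\Delta\vdash\mathrm{can}(t,\{e_x\}):\mathrm{Inv}(t)$. Its $\beta$-rules: $\mathrm{linv},\mathrm{rinv},\mathrm{lunit},\mathrm{runit}$ of $\mathrm{can}(t,\{e_x\})$ are terms $t^{L},t^{R},t^{LU},t^{RU}$ and $\mathrm{ilunit},\mathrm{irunit}$ of it are $\mathrm{can}(t^{LU},\{-\})$, $\mathrm{can}(t^{RU},\{-\})$, as follows. Write $A=u\to v$ and let $\Gamma^{op}$ be the pasting diagram obtained from $\Gamma$ by exchanging source and target of all $(n+1)$-dimensional variables (and reordering). Then $t^L=\mathrm{coh}_{\Gamma^{op},v\to u}[\gamma^L]$, with $\gamma^L$ equal to $\gamma$ on variables of dimension $\le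 n$ and $x\mapsto\mathrm{linv}(e_x)$ on $(n+1)$-dimensional ones; $t^R$ is the same with $\mathrm{rinv}$. $t^{LU}:t^L*t\to\mathrm{id}$ and $t^{RU}:t*t^R\to\mathrm{id}$ are coherence terms: if $\dim\Gamma\le n$, a coherence over $\Gamma$ applied to $\gamma$; if $\dim\Gamma=n+1$, a composite of an associator grouping chains of arguments with their inverses, a cancellation of these using $\mathrm{lunit}(e_x)$ (resp. $\mathrm{runit}(e_x)$), and a unitor; $\{-\}$ is the resulting family of invertibility terms for their top-dimensional arguments, built from $\mathrm{can}$ and $\mathrm{ilunit}(e_x)$ (resp. $\mathrm{irunit}(e_x)$). This is a fixed choice (following the construction of Benjamin and Markakis), stable under substitution and suspension. (rec) Let $\mathbb E^{n+1}=(\mathbb D^{n+1},e_{n+1}:\mathrm{Inv}(d_{n+1}))$; then $\Sigma\mathbb E^{n+1}=\mathbb E^{n+2}$. For $\Gamma\vdash e:\mathrm{Inv}(t)$ with $t$ of dimension $n+1$, $\Gamma\vdash\chi_e:\mathbb E^{n+1}$ is the substitution extending $\chi_t$ by $e_{n+1}\mapsto e$. For $\mathbb E^{n+1}\vdash t:x\to y$ let $\mathbb E^{n+1}_t=(\mathbb E^{n+1},\,h^-:\mathrm{Inv}(\Sigma t)[\chi_{\mathrm{ilunit}(e_{n+1})}],\,h^+:\mathrm{Inv}(\Sigma t)[\chi_{\mathrm{irunit}(e_{n+1})}])$. If in $\mathbb E^{n+1}$: $t:x\to y$, $t_l,t_r:y\to x$, $t_{lu}:t_l*t\to\mathrm{id}\,y$,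 $t_{ru}:t*t_r\to\mathrm{id}\,x$, and in $\mathbb E^{n+1}_t$: $t_{ilu}:\mathrm{Inv}(t_{lu})$, $t_{iru}:\mathrm{Inv}(t_{ru})$, and $\Gamma\vdash\gamma:\mathbb E^{n+1}$, then $\Gamma\vdash\mathrm{rec}(t,t_l,t_r,t_{lu},t_{ru},t_{ilu},t_{iru},\gamma):\mathrm{Inv}(t[\gamma])$. $\beta$-rules: $\mathrm{linv},\mathrm{rinv},\mathrm{lunit},\mathrm{runit}$ of it are $t_l[\gamma],t_r[\gamma],t_{lu}[\gamma],t_{ru}[\gamma]$, and $\mathrm{ilunit},\mathrm{irunit}$ of it are $t_{ilu}[\langle r\rangle\circ\gamma]$, $t_{iru}[\langle r\rangle\circ\gamma]$, where $r=\mathrm{rec}(t,t_l,t_r,t_{lu},t_{ru},t_{ilu},t_{iru},\mathrm{id}_{\mathbb E^{n+1}})$ and $\langle r\rangle=\langle\mathrm{id}_{\mathbb E^{n+1}},h^-\mapsto(\Sigma r)[\chi_{\mathrm{ilunit}(e_{n+1})}],h^+\mapsto(\Sigma r)[\chi_{\mathrm{irunit}(e_{n+1})}]\rangle$. \textbf{Convention.} A term $\Gamma\vdash t:u\to v$ of ICaTT is called invertible in $\Gamma$ if there is a term $\Gamma\vdash e:\mathrm{Inv}(t)$ (an invertibility structure on $t$). *)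

(* Defs.v *)
(* The type theory ICaTT.

   Variables are de Bruijn levels: [Var i] is the i-th entry, counted from the
   left, of the ambient context.  No constructor binds variables in the ambient
   context (a coherence and a recursor only bind variables of a closed context),
   so a context is a list of types, a substitution is the list of its values,
   weakening is the identity on raw syntax, and contexts are automatically
   identified up to renaming. *)
From mathcomp Require Import all_boot.

Set Implicit Arguments.
Unset Strict Implicit.
Unset Printing Implicit Defensive.

(** * Raw syntax *)

(* In [Inv T t] the index [T] is the full type (an arrow type) of [t].
   In [Can t es] the family [es] lists the invertibility terms of the
   top-dimensional variables by increasing level. *)
Inductive ty : Type :=
| Star
| Arr (A : ty) (u v : tm)
| Inv (T : ty) (t : tm)
with tm : Type :=
| Var (i : nat)
| Coh (G : seq ty) (A : ty) (s : seq tm)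
| Can (t : tm) (es : seq tm)
| Coind (t tl tr tlu tru tilu tiru : tm)
| Rec (t tl tr tlu tru tilu tiru : tm) (s : seq tm)
| Linv (e : tm)
| Rinv (e : tm)
| Lunit (e : tm)
| Runit (e : tm)
| Ilunit (e : tm)
| Irunit (e : tm).

Notation ctx := (seq ty).
Notation sub := (seq tm).

Fixpoint subst_tm (s : sub) (t : tm) : tm :=
  match t with
  | Var i => nth (Var i) s i
  | Coh G A d => Coh G A (map (subst_tm s) d)
  | Can t es => Can (subst_tm s t) (map (subst_tm s) es)
  | Coind t tl tr tlu tru tilu tiru =>
      Coind (subst_tm s t) (subst_tm s tl) (subst_tm s tr) (subst_tm s tlu)
            (subst_tm s tru) (subst_tm s tilu) (subst_tm s tiru)
  | Rec t tl tr tlu tru tilu tiru d =>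
      Rec t tl tr tlu tru tilu tiru (map (subst_tm s) d)
  | Linv e => Linv (subst_tm s e)
  | Rinv e => Rinv (subst_tm s e)
  | Lunit e => Lunit (subst_tm s e)
  | Runit e => Runit (subst_tm s e)
  | Ilunit e => Ilunit (subst_tm s e)
  | Irunit e => Irunit (subst_tm s e)
  end.

Fixpoint subst_ty (s : sub) (A : ty) : ty :=
  match A with
  | Star => Star
  | Arr A u v => Arr (subst_ty s A) (subst_tm s u) (subst_tm s v)
  | Inv T t => Inv (subst_ty s T) (subst_tm s t)
  end.

(* [comp_sub d s] is the composite usually written d o s. *)
Definition comp_sub (d s : sub) : sub := map (subst_tm s) d.

Definition id_sub (k : nat) : sub := map Var (iota 0 k).

(* The suspension puts v^- and v^+ at levels 0 and 1. *)
Fixpoint susp_ty (A : ty) : ty :=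
  match A with
  | Star => Arr Star (Var 0) (Var 1)
  | Arr A u v => Arr (susp_ty A) (susp_tm u) (susp_tm v)
  | Inv T t => Inv (susp_ty T) (susp_tm t)
  end
with susp_tm (t : tm) : tm :=
  match t with
  | Var i => Var i.+2
  | Coh G A s =>
      Coh [:: Star, Star & map susp_ty G] (susp_ty A)
          [:: Var 0, Var 1 & map susp_tm s]
  | Can t es => Can (susp_tm t) (map susp_tm es)
  | Coind t tl tr tlu tru tilu tiru =>
      Coind (susp_tm t) (susp_tm tl) (susp_tm tr) (susp_tm tlu)
            (susp_tm tru) (susp_tm tilu) (susp_tm tiru)
  | Rec t tl tr tlu tru tilu tiru s =>
      Rec (susp_tm t) (susp_tm tl) (susp_tm tr) (susp_tm tlu)
          (susp_tm tru) (susp_tm tilu) (susp_tm tiru)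
          [:: Var 0, Var 1 & map susp_tm s]
  | Linv e => Linv (susp_tm e)
  | Rinv e => Rinv (susp_tm e)
  | Lunit e => Lunit (susp_tm e)
  | Runit e => Runit (susp_tm e)
  | Ilunit e => Ilunit (susp_tm e)
  | Irunit e => Irunit (susp_tm e)
  end.

Definition susp_ctx (G : ctx) : ctx := [:: Star, Star & map susp_ty G].

Definition susp_sub (s : sub) : sub := [:: Var 0, Var 1 & map susp_tm s].

(* The data of [Coh] and [Rec] other than their substitution live in another
   context. *)
Fixpoint occurs_tm (i : nat) (t : tm) : bool :=
  match t with
  | Var j => i == j
  | Coh _ _ s => has (occurs_tm i) s
  | Can t es => occurs_tm i t || has (occurs_tm i) es
  | Coind t tl tr tlu tru tilu tiru =>
      [|| occurs_tm i t, occurs_tm i tl, occurs_tm i tr, occurs_tm i tlu,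
          occurs_tm i tru, occurs_tm i tilu | occurs_tm i tiru]
  | Rec _ _ _ _ _ _ _ s => has (occurs_tm i) s
  | Linv e | Rinv e | Lunit e | Runit e | Ilunit e | Irunit e => occurs_tm i e
  end.

Fixpoint occurs_ty (i : nat) (A : ty) : bool :=
  match A with
  | Star => false
  | Arr A u v => [|| occurs_ty i A, occurs_tm i u | occurs_tm i v]
  | Inv T t => occurs_ty i T || occurs_tm i t
  end.

(** * Dimensions and pasting diagrams *)

(* [tdim A] is dim A + 1, the dimension of the terms of type [A].  The value on
   [Inv] is never used: dimensions are only taken of * and of arrow types. *)
Fixpoint tdim (A : ty) : nat :=
  match A with
  | Star => 0
  | Arr A _ _ => (tdim A).+1
  | Inv _ _ => 0
  end.

(* Only used on pasting diagrams, which are never empty, so that the value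
   -1 of the empty context does not matter. *)
Definition ctx_dim (G : ctx) : nat := foldr maxn 0 (map tdim G).

Definition var_ty (G : ctx) (i : nat) : ty := nth Star G i.
Definition var_dim (G : ctx) (i : nat) : nat := tdim (var_ty G i).

Inductive ps_at : ctx -> nat -> ty -> Prop :=
| ps_point : ps_at [:: Star] 0 Star
| ps_down G f A x y : ps_at G f (Arr A x (Var y)) -> ps_at G y A
| ps_extend G x A :
    ps_at G x A ->
    ps_at (G ++ [:: A; Arr A (Var x) (Var (size G))]) (size G).+1
          (Arr A (Var x) (Var (size G))).

Definition is_ps (G : ctx) : Prop := exists x, ps_at G x Star.

Definition is_source_of (i : nat) (A : ty) : bool :=
  if A is Arr _ (Var j) _ then i == j else false.
Definition is_target_of (i : nat) (A : ty) : bool :=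
  if A is Arr _ _ (Var j) then i == j else false.

Definition source_var (G : ctx) (i : nat) : bool := ~~ has (is_target_of i) G.
Definition target_var (G : ctx) (i : nat) : bool := ~~ has (is_source_of i) G.

Definition uses (i : nat) (t : tm) (A : ty) : bool :=
  occurs_tm i t || occurs_ty i A.

Definition full (G : ctx) (T : ty) : bool :=
  if T is Arr A u v then
    let vars := iota 0 (size G) in
    all (fun i => uses i u A && uses i v A) vars
    || [&& (tdim A).+1 == ctx_dim G,
           all (fun i => source_var G i && (var_dim G i < ctx_dim G)
                         ==> uses i u A) vars
         & all (fun i => target_var G i && (var_dim G i < ctx_dim G)
                         ==> uses i v A) vars]
  else false.

(** * Disks, identities and composites *)

Definition disk (n : nat) : ctx := iter n susp_ctx [:: Star].

(* The type of the variable d_n of [disk n]; d_n is [Var n.*2]. *)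
Definition disk_ty (n : nat) : ty := iter n susp_ty Star.

(* The iterated sources and targets of a term of type [A], lowest first. *)
Fixpoint boundary (A : ty) : sub :=
  if A is Arr A u v then boundary A ++ [:: u; v] else [::].

(* The substitution chi_t for [t] of type [A]. *)
Definition chi (A : ty) (t : tm) : sub := rcons (boundary A) t.

(* [op_at t0 A args]: the operation t0, a term in a context of arguments,
   suspended to act on arguments over the type [A].  The first [2 * tdim A]
   variables of the suspended context are the boundary of [A]. *)
Definition op_at (t0 : tm) (A : ty) (args : sub) : tm :=
  subst_tm (boundary A ++ args) (iter (tdim A) susp_tm t0).

Definition hom (i j : nat) : ty := Arr Star (Var i) (Var j).

Definition id0 : tm := Coh [:: Star] (hom 0 0) (id_sub 1).

Definition id_tm (A : ty) (x : tm) : tm := op_at id0 A [:: x].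

(* (x y f z g) *)
Definition ctx2 : ctx := [:: Star; Star; hom 0 1; Star; hom 1 3].

Definition comp0 : tm := Coh ctx2 (hom 0 3) (id_sub 5).

(* f * g, for f : x -> y and g : y -> z over A *)
Definition comp_tm (A : ty) (x y z f g : tm) : tm := op_at comp0 A [:: x; y; f; z; g].

(* The types of left and right cancellators of t : u -> v over A. *)
Definition lcancel_ty (A : ty) (u v t l : tm) : ty :=
  Arr (Arr A v v) (comp_tm A v u v l t) (id_tm A v).
Definition rcancel_ty (A : ty) (u v t r : tm) : ty :=
  Arr (Arr A u u) (comp_tm A u v u t r) (id_tm A u).

(** * The computation of the destructors on [Can] *)

(* Further operations used below: the ternary composite, its whiskering of a
   cell al : p -> p' placed in the middle argument, and the removal of a middle
   identity, a * id * b -> a * b. *)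

(* (x y f z g w h) *)
Definition ctx3 : ctx := ctx2 ++ [:: Star; hom 3 5].

Definition comp3_0 : tm := Coh ctx3 (hom 0 5) (id_sub 7).

Definition comp3 (A : ty) (x y z w f g h : tm) : tm :=
  op_at comp3_0 A [:: x; y; f; z; g; w; h].

(* (x y a z p p' al w b) *)
Definition ctx_whisk : ctx :=
  [:: Star; Star; hom 0 1; Star; hom 1 3; hom 1 3;
      Arr (hom 1 3) (Var 4) (Var 5); Star; hom 3 7].

Definition whisk0 : tm :=
  Coh ctx_whisk
    (Arr (hom 0 7)
       (comp3 Star (Var 0) (Var 1) (Var 3) (Var 7) (Var 2) (Var 4) (Var 8))
       (comp3 Star (Var 0) (Var 1) (Var 3) (Var 7) (Var 2) (Var 5) (Var 8)))
    (id_sub 9).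

Definition whisk (A : ty) (x y z w a p p' al b : tm) : tm :=
  op_at whisk0 A [:: x; y; a; z; p; p'; al; w; b].

Definition unit3_0 : tm :=
  Coh ctx2
    (Arr (hom 0 3)
       (comp3 Star (Var 0) (Var 1) (Var 1) (Var 3)
              (Var 2) (id_tm Star (Var 1)) (Var 4))
       (comp_tm Star (Var 0) (Var 1) (Var 3) (Var 2) (Var 4)))
    (id_sub 5).

Definition unit3 (A : ty) (x y z a b : tm) : tm :=
  op_at unit3_0 A [:: x; y; a; z; b].

(* Let G be a pasting diagram of dimension at most N.  Its list of variables is
   a concatenation of blocks
     x_0, x_1, f_1, ..., x_k, f_k   with f_j : x_(j-1) -> x_j of dimension N,
   where k = 0 whenever x_0 is not the start of a chain of N-dimensional
   variables.  A block is the same thing as a maximal chain of N-dimensional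
   variables when k > 0, and the types of the x_j are all equal and mention only
   variables alone in their block.  [blocks N G] is the list of the lengths k. *)
Fixpoint blocks_rec (N k : nat) (G : ctx) : seq nat :=
  match G with
  | _ :: F :: G' =>
      if tdim F == N then blocks_rec N k.+1 G' else [:: k, 0 & blocks_rec N 0 G']
  | _ => [:: k]
  end.
Definition blocks (N : nat) (G : ctx) : seq nat := blocks_rec N 0 (behead G).

(* The levels of x_j and f_j in a block starting at level p. *)
Definition obj (p j : nat) : nat := p + j.*2.-1.
Definition arr (p j : nat) : nat := p + j.*2.

(* x_0, x_1, f_1, ..., x_k, f_k *)
Definition chain {T : Type} (x f : nat -> T) (k : nat) : seq T :=
  x 0 :: flatten [seq [:: x j; f j] | j <- iota 1 k].

Definition chain_ctx (T : ty) (p k : nat) : ctx :=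
  chain (fun=> T) (fun j => Arr T (Var (obj p j.-1)) (Var (obj p j))) k.

(* Concatenates the lists [F p q k], where k is the length of a block, q its
   starting level, and p its starting level after the size of each block of
   length k has been changed to [sz k]. *)
Fixpoint blockwise {T : Type} (sz : nat -> nat) (F : nat -> nat -> nat -> seq T)
    (p q : nat) (ks : seq nat) : seq T :=
  if ks is k :: ks' then
    F p q k ++ blockwise sz F (p + sz k) (q + k.*2.+1) ks'
  else [::].

Definition block_size (k : nat) : nat := k.*2.+1.

(* The renaming that sends each variable of a block to the variable of index
   [off k] of the resized block. *)
Definition collapse (sz off : nat -> nat) (ks : seq nat) : sub :=
  blockwise sz (fun p _ k => nseq k.*2.+1 (Var (p + off k))) 0 0 ks.

(* The context obtained by replacing each block by [F T p k], where T is the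
   (renamed) type of the x_j. *)
Definition resize (sz : nat -> nat) (F : ty -> nat -> nat -> ctx) (N : nat)
    (G : ctx) : ctx :=
  let ks := blocks N G in
  blockwise sz
    (fun p q k => F (subst_ty (collapse sz (fun=> 0) ks) (var_ty G q)) p k) 0 0 ks.

(* Exchanging source and target of the N-dimensional variables makes a chain
   run backwards, so each block is reordered as x_k, x_(k-1), f_k, ..., x_0, f_1.
   This reordering is involutive: [op_sub N G] is both the renaming of the
   variables of G as variables of its opposite, and conversely. *)
Definition op_perm (N : nat) (G : ctx) : seq nat :=
  blockwise block_size
    (fun _ q k => chain (fun j => obj q (k - j)) (fun j => arr q (k.+1 - j)) k)
    0 0 (blocks N G).

Definition op_sub (N : nat) (G : ctx) : sub := map Var (op_perm N G).

Definition op_var_ty (N : nat) (A : ty) : ty :=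
  if A is Arr B u v then (if tdim A == N then Arr B v u else A) else A.

Definition op_ctx (N : nat) (G : ctx) : ctx :=
  [seq subst_ty (op_sub N G) (op_var_ty N (var_ty G i)) | i <- op_perm N G].

(* The opposite of the coherence over G of type u -> v, applied to the
   substitution that sends each variable i of G to [s_i]. *)
Definition op_coh (G : ctx) (B : ty) (u v : tm) (s : sub) : tm :=
  let N := (tdim B).+1 in
  Coh (op_ctx N G) (subst_ty (op_sub N G) (Arr B v u)) (comp_sub (op_sub N G) s).

(* The member of the family [es] attached to the N-dimensional variable i. *)
Definition inv_at (N : nat) (G : ctx) (es : seq tm) (i : nat) : tm :=
  nth (Var 0) es (count (fun A => tdim A == N) (take i G)).

(* [s], with x |-> D e_x on N-dimensional variables *)
Definition inv_sub (D : tm -> tm) (N : nat) (G : ctx) (s : sub) (es : seq tm) : sub :=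
  [seq if var_dim G i == N then D (inv_at N G es i) else nth (Var i) s i
  | i <- iota 0 (size G)].

(* The grouping a_k * ( ... (a_1 * b_1) ... ) * b_k of a chain of terms
     z_k -a_k-> ... -a_1-> z_0 = z'_0 -b_1-> ... -b_k-> z'_k,
   where the z_j and z'_j are of type T. *)
Fixpoint group (T : ty) (z z' a b : nat -> tm) (k : nat) : tm :=
  match k with
  | 0 => id_tm T (z 0)
  | 1 => comp_tm T (z 1) (z 0) (z' 1) (a 1) (b 1)
  | j.+1 => comp3 T (z k) (z j) (z' j) (z' k) (a k) (group T z z' a b j) (b k)
  end.

(* The cancellation of such a chain, when z_j = z'_j for all j, from cells
   c_j : a_j * b_j -> id z_j.  Only used for k > 0. *)

Definition cancel_step_whisk (T : ty) (z a b : nat -> tm) (j : nat) (r : tm) : tm :=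
  whisk T (z j.+1) (z j) (z j) (z j.+1)
        (a j.+1) (group T z z a b j) (id_tm T (z j)) r (b j.+1).

Definition cancel_step_unit (T : ty) (z a b : nat -> tm) (j : nat) : tm :=
  unit3 T (z j.+1) (z j) (z j.+1) (a j.+1) (b j.+1).

(* group k -> id z_k *)
Fixpoint cancel_chain (T : ty) (z a b c : nat -> tm) (k : nat) : tm :=
  match k with
  | 0 => id_tm (Arr T (z 0) (z 0)) (id_tm T (z 0))
  | 1 => c 1
  | j.+1 =>
      comp3 (Arr T (z k) (z k))
        (group T z z a b k)
        (comp3 T (z k) (z j) (z j) (z k) (a k) (id_tm T (z j)) (b k))
        (comp_tm T (z k) (z j) (z k) (a k) (b k))
        (id_tm T (z k))
        (cancel_step_whisk T z a b j (cancel_chain T z a b c j))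
        (cancel_step_unit T z a b j)
        (c k)
  end.

(* Inv (cancel_chain k), from ic_j : Inv c_j *)
Fixpoint cancel_chain_inv (T : ty) (z a b c ic : nat -> tm) (k : nat) : tm :=
  match k with
  | 0 => Can (cancel_chain T z a b c 0) [::]
  | 1 => ic 1
  | j.+1 =>
      Can (cancel_chain T z a b c k)
        [:: Can (cancel_step_whisk T z a b j (cancel_chain T z a b c j))
                [:: cancel_chain_inv T z a b c ic j];
            Can (cancel_step_unit T z a b j) [::];
            ic k]
  end.

(* From now on [l] selects t^LU (chains f_k^-1, ..., f_1^-1, f_1, ..., f_k) or
   t^RU (chains f_1, ..., f_k, f_k^-1, ..., f_1^-1).  With the notations of
   [group], x_j plays the role of z_(zidx l k j), and f_j and its inverse are
   a_(fidx l k j) and b_(fidx l k j), the inverse being the a when [l] holds. *)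
Definition zidx (l : bool) (k j : nat) : nat := if l then j else k - j.
Definition fidx (l : bool) (k j : nat) : nat := if l then j else k.+1 - j.

(* t^L * t or t * t^R for t = coh_(G, u -> v), where [sa] and [sb] give the
   values of the variables of G in the first and in the second factor. *)
Definition round_trip (l : bool) (G : ctx) (B : ty) (u v : tm) (sa sb : sub) : tm :=
  let t := Coh G (Arr B u v) in
  let t' := op_coh G B u v in
  if l then
    comp_tm (subst_ty sb B) (subst_tm sa v) (subst_tm sb u) (subst_tm sb v)
         (t' sa) (t sb)
  else
    comp_tm (subst_ty sa B) (subst_tm sa u) (subst_tm sa v) (subst_tm sb u)
         (t sa) (t' sb).

(* Each block is doubled, as z_k, z_(k-1), a_k, ..., z_0, a_1, z'_1, b_1, ...,
   z'_k, b_k. *)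
Definition dbl_size (k : nat) : nat := k.*2.*2.+1.
Definition dbl_z (p k j : nat) : tm := Var (obj p (k - j)).
Definition dbl_z' (p k j : nat) : tm := Var (obj p (k + j)).
Definition dbl_a (p k j : nat) : tm := Var (arr p (k.+1 - j)).
Definition dbl_b (p k j : nat) : tm := Var (arr p (k + j)).

Definition dbl_ctx (N : nat) (G : ctx) : ctx :=
  resize dbl_size (fun T p k => chain_ctx T p k.*2) N G.

Definition dbl_sub_a (l : bool) (N : nat) (G : ctx) : sub :=
  blockwise dbl_size
    (fun p _ k => chain (fun j => dbl_z p k (zidx l k j))
                        (fun j => dbl_a p k (fidx l k j)) k) 0 0 (blocks N G).
Definition dbl_sub_b (l : bool) (N : nat) (G : ctx) : sub :=
  blockwise dbl_size
    (fun p _ k => chain (fun j => dbl_z' p k (zidx l k j))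
                        (fun j => dbl_b p k (fidx l k j)) k) 0 0 (blocks N G).

(* Each nontrivial block is replaced by a single arrow (z, z', p : z -> z'). *)
Definition one_size (k : nat) : nat := if k is 0 then 1 else 3.
Definition one_end (k : nat) : nat := if k is 0 then 0 else 1.
Definition one_ctx (N : nat) (G : ctx) : ctx :=
  resize one_size (fun T p k => chain_ctx T p (one_end k)) N G.

(* The composite over [one_ctx], with boundary the copies of [w]. *)
Definition one_coh (N : nat) (G : ctx) (B : ty) (w : tm) (s : sub) : tm :=
  let s0 := collapse one_size (fun=> 0) (blocks N G) in
  let s1 := collapse one_size one_end (blocks N G) in
  Coh (one_ctx N G) (Arr (subst_ty s0 B) (subst_tm s0 w) (subst_tm s1 w)) s.

(* Each nontrivial block is replaced by a cell of dimension N + 1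
   (z, z', p : z -> z', p' : z -> z', al : p -> p'). *)
Definition cell_size (k : nat) : nat := if k is 0 then 1 else 5.
Definition cell_block (T : ty) (p k : nat) : ctx :=
  if k is 0 then [:: T] else
  let H := Arr T (Var p) (Var p.+1) in
  [:: T; T; H; H; Arr H (Var p.+2) (Var p.+3)].

(* Each block is replaced by the single variable z: the common boundary. *)
Definition bd_size (k : nat) : nat := 1.

(* The types of the three factors of t^LU or t^RU when G is of dimension N = n + 1:
   t^L * t -> (chains grouped) -> (groups replaced by identities) -> id. *)
Definition associator_ty (l : bool) (G : ctx) (B : ty) (u v : tm) : ty :=
  let N := (tdim B).+1 in
  let w := if l then v else u in
  let sa := dbl_sub_a l N G in
  let sb := dbl_sub_b l N G in
  let s0 := collapse dbl_size (fun=> 0) (blocks N G) in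
  let grouping :=
    blockwise dbl_size
      (fun p q k => if k is 0 then [:: Var p] else
         [:: dbl_z p k k; dbl_z' p k k;
             group (subst_ty s0 (var_ty G q)) (dbl_z p k) (dbl_z' p k)
               (dbl_a p k) (dbl_b p k) k])
      0 0 (blocks N G) in
  Arr (Arr (subst_ty sa B) (subst_tm sa w) (subst_tm sb w))
      (round_trip l G B u v sa sb)
      (one_coh N G B w grouping).

Definition cancellator_ty (l : bool) (G : ctx) (B : ty) (u v : tm) : ty :=
  let N := (tdim B).+1 in
  let w := if l then v else u in
  let s0 := collapse cell_size (fun=> 0) (blocks N G) in
  let s1 := collapse cell_size one_end (blocks N G) in
  let side i :=
    blockwise cell_size
      (fun p _ k => if k is 0 then [:: Var p] else [:: Var p; Var p.+1; Var (p + i)])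
      0 0 (blocks N G) in
  Arr (Arr (subst_ty s0 B) (subst_tm s0 w) (subst_tm s1 w))
      (one_coh N G B w (side 2)) (one_coh N G B w (side 3)).

Definition unitor_ty (l : bool) (G : ctx) (B : ty) (u v : tm) : ty :=
  let N := (tdim B).+1 in
  let w := if l then v else u in
  let s0 := collapse bd_size (fun=> 0) (blocks N G) in
  let B0 := subst_ty s0 B in
  let w0 := subst_tm s0 w in
  let ids :=
    blockwise bd_size
      (fun p q k => if k is 0 then [:: Var p] else
         [:: Var p; Var p; id_tm (subst_ty s0 (var_ty G q)) (Var p)])
      0 0 (blocks N G) in
  Arr (Arr B0 w0 w0) (one_coh N G B w ids) (id_tm B0 w0).

(* The terms z_j, a_j, b_j, c_j and ic_j of [group] and [cancel_chain] for the
   block of length k starting at level q. *)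
Section Block.
Context (l : bool) (N : nat) (G : ctx) (s : sub) (es : seq tm) (q k : nat).

Definition blk_ty : ty := subst_ty s (var_ty G q).
Definition blk_e (j : nat) : tm := inv_at N G es (arr q (fidx l k j)).
Definition blk_z (j : nat) : tm := nth (Var 0) s (obj q (zidx l k j)).
Definition blk_f (j : nat) : tm := nth (Var 0) s (arr q (fidx l k j)).
Definition blk_a (j : nat) : tm := if l then Linv (blk_e j) else blk_f j.
Definition blk_b (j : nat) : tm := if l then blk_f j else Rinv (blk_e j).
Definition blk_c (j : nat) : tm := if l then Lunit (blk_e j) else Runit (blk_e j).
Definition blk_ic (j : nat) : tm := if l then Ilunit (blk_e j) else Irunit (blk_e j).

Definition blk_group : tm := group blk_ty blk_z blk_z blk_a blk_b k.
Definition blk_cancel : tm := cancel_chain blk_ty blk_z blk_a blk_b blk_c k.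
Definition blk_cancel_inv : tm :=
  cancel_chain_inv blk_ty blk_z blk_a blk_b blk_c blk_ic k.

Definition blk_dbl : sub :=
  chain (fun i => if i <= k then blk_z (k - i) else blk_z (i - k))
        (fun i => if i <= k then blk_a (k.+1 - i) else blk_b (i - k)) k.*2.
Definition blk_cell : sub :=
  if k is 0 then [:: blk_z 0] else
  [:: blk_z k; blk_z k; blk_group; id_tm blk_ty (blk_z k); blk_cancel].
End Block.

Definition associator (l : bool) (G : ctx) (B : ty) (u v : tm) (s es : seq tm) : tm :=
  let N := (tdim B).+1 in
  Coh (dbl_ctx N G) (associator_ty l G B u v)
      (blockwise dbl_size (fun _ => blk_dbl l N G s es) 0 0 (blocks N G)).

Definition cancellator (l : bool) (G : ctx) (B : ty) (u v : tm) (s es : seq tm) : tm :=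
  let N := (tdim B).+1 in
  Coh (resize cell_size cell_block N G) (cancellator_ty l G B u v)
      (blockwise cell_size (fun _ => blk_cell l N G s es) 0 0 (blocks N G)).

(* The substitution to the common boundary of t^L * t, resp. of t * t^R. *)
Definition bd_sub (l : bool) (N : nat) (G : ctx) (s : sub) : sub :=
  blockwise bd_size (fun _ q k => [:: blk_z l s q k k]) 0 0 (blocks N G).

Definition unitor (l : bool) (G : ctx) (B : ty) (u v : tm) (s : sub) : tm :=
  let N := (tdim B).+1 in
  Coh (resize bd_size (fun T _ _ => [:: T]) N G) (unitor_ty l G B u v)
      (bd_sub l N G s).

Definition cancellator_family (l : bool) (G : ctx) (B : ty) (s es : seq tm) : seq tm :=
  let N := (tdim B).+1 in
  blockwise block_size
    (fun _ q k => if k is 0 then [::] else [:: blk_cancel_inv l N G s es q k])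
    0 0 (blocks N G).

(* t^L and t^R, for t = coh_(G, u -> v)[s] *)
Definition can_inv (l : bool) (G : ctx) (B : ty) (u v : tm) (s es : seq tm) : tm :=
  op_coh G B u v (inv_sub (if l then Linv else Rinv) (tdim B).+1 G s es).

(* t^LU and t^RU; the first case is dim G <= n. *)
Definition can_unit (l : bool) (G : ctx) (B : ty) (u v : tm) (s es : seq tm) : tm :=
  let t := Coh G (Arr B u v) s in
  let t' := can_inv l G B u v s es in
  let w := if l then v else u in
  if ctx_dim G <= tdim B then
    let i := id_sub (size G) in
    Coh G (Arr (Arr B w w) (round_trip l G B u v i i) (id_tm B w)) s
  else
    let B' := subst_ty s B in
    let u' := subst_tm s u in
    let v' := subst_tm s v in
    let w' := subst_tm s w in
    let r := bd_sub l (tdim B).+1 G s in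
    comp3 (Arr B' w' w')
      (if l then comp_tm B' v' u' v' t' t else comp_tm B' u' v' u' t t')
      (if cancellator_ty l G B u v is Arr _ c d then
         subst_tm (blockwise cell_size (fun _ => blk_cell l (tdim B).+1 G s es)
                     0 0 (blocks (tdim B).+1 G)) c else Var 0)
      (if unitor_ty l G B u v is Arr _ c d then subst_tm r c else Var 0)
      (id_tm B' w')
      (associator l G B u v s es) (cancellator l G B u v s es) (unitor l G B u v s).

(* The invertibility of t^LU and t^RU *)
Definition can_iunit (l : bool) (G : ctx) (B : ty) (u v : tm) (s es : seq tm) : tm :=
  Can (can_unit l G B u v s es)
    (if ctx_dim G <= tdim B then [::] else
     [:: Can (associator l G B u v s es) [::];
         Can (cancellator l G B u v s es) (cancellator_family l G B s es);
         Can (unitor l G B u v s) [::]]).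

(** * The contexts of the recursor *)

(* E^n; its last variable e_n is [Var n.*2.+1]. *)
Definition inv_ctx (n : nat) : ctx :=
  rcons (disk n) (Inv (disk_ty n) (Var n.*2)).

(* The substitution chi_e, for e : Inv(t) and t of type T. *)
Definition chi_inv (T : ty) (t e : tm) : sub := rcons (chi T t) e.

(* In E^(n+1): the substitutions to E^(n+2) classifying ilunit(e_(n+1)) and
   irunit(e_(n+1)). *)
Definition chi_ilunit (n : nat) : sub :=
  let A := disk_ty n in
  let u := Var n.*2 in
  let v := Var n.*2.+1 in
  let d := Var n.+1.*2 in
  let e := Var n.+1.*2.+1 in
  chi_inv (lcancel_ty A u v d (Linv e)) (Lunit e) (Ilunit e).
Definition chi_irunit (n : nat) : sub :=
  let A := disk_ty n in
  let u := Var n.*2 in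
  let v := Var n.*2.+1 in
  let d := Var n.+1.*2 in
  let e := Var n.+1.*2.+1 in
  chi_inv (rcancel_ty A u v d (Rinv e)) (Runit e) (Irunit e).

(* E^(n+1)_t, for t of type T in E^(n+1) *)
Definition rec_ctx (n : nat) (T : ty) (t : tm) : ctx :=
  inv_ctx n.+1 ++
    [:: subst_ty (chi_ilunit n) (Inv (susp_ty T) (susp_tm t));
        subst_ty (chi_irunit n) (Inv (susp_ty T) (susp_tm t))].

(* <r> *)
Definition rec_unfold (n : nat) (r : tm) : sub :=
  id_sub (size (inv_ctx n.+1)) ++
    [:: subst_tm (chi_ilunit n) (susp_tm r); subst_tm (chi_irunit n) (susp_tm r)].

(** * Judgements *)

Definition cell_ty (A : ty) : bool := if A is Inv _ _ then false else true.

(* Judgemental equality is the congruence generated by the computation rules,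
   each rule being applied to a well-typed redex; hence the mutual induction. *)
Inductive ctx_ok : ctx -> Prop :=
| ctx_nil : ctx_ok [::]
| ctx_rcons G A : ctx_ok G -> ty_ok G A -> ctx_ok (rcons G A)

with ty_ok : ctx -> ty -> Prop :=
| ty_star G : ctx_ok G -> ty_ok G Star
| ty_arr G A u v :
    cell_ty A -> tm_ok G u A -> tm_ok G v A -> ty_ok G (Arr A u v)
| ty_inv G A u v t :
    tm_ok G t (Arr A u v) -> ty_ok G (Inv (Arr A u v) t)

with tm_ok : ctx -> tm -> ty -> Prop :=
| ok_conv G t A B : tm_ok G t A -> ty_ok G B -> ty_eq G A B -> tm_ok G t B
| ok_var G i : ctx_ok G -> i < size G -> tm_ok G (Var i) (var_ty G i)
| ok_coh D G A s :
    is_ps G -> ty_ok G A -> full G A -> sub_ok D s G ->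
    tm_ok D (Coh G A s) (subst_ty s A)
| ok_can D G A s es :
    tm_ok D (Coh G A s) (subst_ty s A) ->
    size es = count (fun T => tdim T == tdim A) G ->
    (forall i, i < size G -> var_dim G i = tdim A ->
       tm_ok D (inv_at (tdim A) G es i)
               (Inv (subst_ty s (var_ty G i)) (subst_tm s (Var i)))) ->
    tm_ok D (Can (Coh G A s) es) (Inv (subst_ty s A) (Coh G A s))
| ok_coind G A x y t tl tr tlu tru tilu tiru :
    tm_ok G t (Arr A x y) -> tm_ok G tl (Arr A y x) -> tm_ok G tr (Arr A y x) ->
    tm_ok G tlu (lcancel_ty A x y t tl) -> tm_ok G tru (rcancel_ty A x y t tr) ->
    tm_ok G tilu (Inv (lcancel_ty A x y t tl) tlu) ->
    tm_ok G tiru (Inv (rcancel_ty A x y t tr) tru) ->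
    tm_ok G (Coind t tl tr tlu tru tilu tiru) (Inv (Arr A x y) t)
| ok_rec G n A x y t tl tr tlu tru tilu tiru s :
    let E := inv_ctx n.+1 in
    let E' := rec_ctx n (Arr A x y) t in
    tm_ok E t (Arr A x y) -> tm_ok E tl (Arr A y x) -> tm_ok E tr (Arr A y x) ->
    tm_ok E tlu (lcancel_ty A x y t tl) -> tm_ok E tru (rcancel_ty A x y t tr) ->
    tm_ok E' tilu (Inv (lcancel_ty A x y t tl) tlu) ->
    tm_ok E' tiru (Inv (rcancel_ty A x y t tr) tru) ->
    sub_ok G s E ->
    tm_ok G (Rec t tl tr tlu tru tilu tiru s)
            (Inv (subst_ty s (Arr A x y)) (subst_tm s t))
| ok_linv G A u v t e :
    tm_ok G t (Arr A u v) -> tm_ok G e (Inv (Arr A u v) t) ->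
    tm_ok G (Linv e) (Arr A v u)
| ok_rinv G A u v t e :
    tm_ok G t (Arr A u v) -> tm_ok G e (Inv (Arr A u v) t) ->
    tm_ok G (Rinv e) (Arr A v u)
| ok_lunit G A u v t e :
    tm_ok G t (Arr A u v) -> tm_ok G e (Inv (Arr A u v) t) ->
    tm_ok G (Lunit e) (lcancel_ty A u v t (Linv e))
| ok_runit G A u v t e :
    tm_ok G t (Arr A u v) -> tm_ok G e (Inv (Arr A u v) t) ->
    tm_ok G (Runit e) (rcancel_ty A u v t (Rinv e))
| ok_ilunit G A u v t e :
    tm_ok G t (Arr A u v) -> tm_ok G e (Inv (Arr A u v) t) ->
    tm_ok G (Ilunit e) (Inv (lcancel_ty A u v t (Linv e)) (Lunit e))
| ok_irunit G A u v t e :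
    tm_ok G t (Arr A u v) -> tm_ok G e (Inv (Arr A u v) t) ->
    tm_ok G (Irunit e) (Inv (rcancel_ty A u v t (Rinv e)) (Runit e))

with sub_ok : ctx -> sub -> ctx -> Prop :=
| sub_nil D : ctx_ok D -> sub_ok D [::] [::]
| sub_rcons D s t G A :
    sub_ok D s G -> ty_ok G A -> tm_ok D t (subst_ty s A) ->
    sub_ok D (rcons s t) (rcons G A)

with ty_eq : ctx -> ty -> ty -> Prop :=
| ty_eq_refl G A : ty_eq G A A
| ty_eq_sym G A B : ty_eq G A B -> ty_eq G B A
| ty_eq_trans G A B C : ty_eq G A B -> ty_eq G B C -> ty_eq G A C
| ty_eq_arr G A A' u u' v v' :
    ty_eq G A A' -> tm_eq G u u' -> tm_eq G v v' ->
    ty_eq G (Arr A u v) (Arr A' u' v')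
| ty_eq_inv G T T' t t' :
    ty_eq G T T' -> tm_eq G t t' -> ty_eq G (Inv T t) (Inv T' t')

with tm_eq : ctx -> tm -> tm -> Prop :=
| tm_eq_refl G t : tm_eq G t t
| tm_eq_sym G t u : tm_eq G t u -> tm_eq G u t
| tm_eq_trans G t u v : tm_eq G t u -> tm_eq G u v -> tm_eq G t v
  (* congruence; the types in a pasting diagram contain only variables, so
     there is nothing to compute in the context of a coherence *)
| tm_eq_coh D G A A' s s' :
    ty_eq G A A' -> tms_eq D s s' -> tm_eq D (Coh G A s) (Coh G A' s')
| tm_eq_can G t t' es es' :
    tm_eq G t t' -> tms_eq G es es' -> tm_eq G (Can t es) (Can t' es')
| tm_eq_coind G t t' tl tl' tr tr' tlu tlu' tru tru' tilu tilu' tiru tiru' :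
    tm_eq G t t' -> tm_eq G tl tl' -> tm_eq G tr tr' ->
    tm_eq G tlu tlu' -> tm_eq G tru tru' ->
    tm_eq G tilu tilu' -> tm_eq G tiru tiru' ->
    tm_eq G (Coind t tl tr tlu tru tilu tiru)
            (Coind t' tl' tr' tlu' tru' tilu' tiru')
| tm_eq_rec G n T t t' tl tl' tr tr' tlu tlu' tru tru' tilu tilu' tiru tiru' s s' :
    let E := inv_ctx n.+1 in
    let E' := rec_ctx n T t in
    tm_ok E t T ->
    tm_eq E t t' -> tm_eq E tl tl' -> tm_eq E tr tr' ->
    tm_eq E tlu tlu' -> tm_eq E tru tru' ->
    tm_eq E' tilu tilu' -> tm_eq E' tiru tiru' ->
    tms_eq G s s' ->
    tm_eq G (Rec t tl tr tlu tru tilu tiru s)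
            (Rec t' tl' tr' tlu' tru' tilu' tiru' s')
| tm_eq_linv G e e' : tm_eq G e e' -> tm_eq G (Linv e) (Linv e')
| tm_eq_rinv G e e' : tm_eq G e e' -> tm_eq G (Rinv e) (Rinv e')
| tm_eq_lunit G e e' : tm_eq G e e' -> tm_eq G (Lunit e) (Lunit e')
| tm_eq_runit G e e' : tm_eq G e e' -> tm_eq G (Runit e) (Runit e')
| tm_eq_ilunit G e e' : tm_eq G e e' -> tm_eq G (Ilunit e) (Ilunit e')
| tm_eq_irunit G e e' : tm_eq G e e' -> tm_eq G (Irunit e) (Irunit e')
  (* coind *)
| coind_linv G t tl tr tlu tru tilu tiru T :
    let e := Coind t tl tr tlu tru tilu tiru in
    tm_ok G e T -> tm_eq G (Linv e) tl
| coind_rinv G t tl tr tlu tru tilu tiru T :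
    let e := Coind t tl tr tlu tru tilu tiru in
    tm_ok G e T -> tm_eq G (Rinv e) tr
| coind_lunit G t tl tr tlu tru tilu tiru T :
    let e := Coind t tl tr tlu tru tilu tiru in
    tm_ok G e T -> tm_eq G (Lunit e) tlu
| coind_runit G t tl tr tlu tru tilu tiru T :
    let e := Coind t tl tr tlu tru tilu tiru in
    tm_ok G e T -> tm_eq G (Runit e) tru
| coind_ilunit G t tl tr tlu tru tilu tiru T :
    let e := Coind t tl tr tlu tru tilu tiru in
    tm_ok G e T -> tm_eq G (Ilunit e) tilu
| coind_irunit G t tl tr tlu tru tilu tiru T :
    let e := Coind t tl tr tlu tru tilu tiru in
    tm_ok G e T -> tm_eq G (Irunit e) tiru
| coind_eta G A u v t e :
    tm_ok G t (Arr A u v) -> tm_ok G e (Inv (Arr A u v) t) ->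
    tm_eq G e (Coind t (Linv e) (Rinv e) (Lunit e) (Runit e) (Ilunit e) (Irunit e))
  (* can *)
| can_linv D G B u v s es T :
    let e := Can (Coh G (Arr B u v) s) es in
    tm_ok D e T -> tm_eq D (Linv e) (can_inv true G B u v s es)
| can_rinv D G B u v s es T :
    let e := Can (Coh G (Arr B u v) s) es in
    tm_ok D e T -> tm_eq D (Rinv e) (can_inv false G B u v s es)
| can_lunit D G B u v s es T :
    let e := Can (Coh G (Arr B u v) s) es in
    tm_ok D e T -> tm_eq D (Lunit e) (can_unit true G B u v s es)
| can_runit D G B u v s es T :
    let e := Can (Coh G (Arr B u v) s) es in
    tm_ok D e T -> tm_eq D (Runit e) (can_unit false G B u v s es)
| can_ilunit D G B u v s es T :
    let e := Can (Coh G (Arr B u v) s) es in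
    tm_ok D e T -> tm_eq D (Ilunit e) (can_iunit true G B u v s es)
| can_irunit D G B u v s es T :
    let e := Can (Coh G (Arr B u v) s) es in
    tm_ok D e T -> tm_eq D (Irunit e) (can_iunit false G B u v s es)
  (* rec *)
| rec_linv G t tl tr tlu tru tilu tiru s T :
    let e := Rec t tl tr tlu tru tilu tiru s in
    tm_ok G e T -> tm_eq G (Linv e) (subst_tm s tl)
| rec_rinv G t tl tr tlu tru tilu tiru s T :
    let e := Rec t tl tr tlu tru tilu tiru s in
    tm_ok G e T -> tm_eq G (Rinv e) (subst_tm s tr)
| rec_lunit G t tl tr tlu tru tilu tiru s T :
    let e := Rec t tl tr tlu tru tilu tiru s in
    tm_ok G e T -> tm_eq G (Lunit e) (subst_tm s tlu)
| rec_runit G t tl tr tlu tru tilu tiru s T :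
    let e := Rec t tl tr tlu tru tilu tiru s in
    tm_ok G e T -> tm_eq G (Runit e) (subst_tm s tru)
| rec_ilunit G n t tl tr tlu tru tilu tiru s T :
    let e := Rec t tl tr tlu tru tilu tiru s in
    let r := Rec t tl tr tlu tru tilu tiru (id_sub (size (inv_ctx n.+1))) in
    tm_ok G e T -> sub_ok G s (inv_ctx n.+1) ->
    tm_eq G (Ilunit e) (subst_tm (comp_sub (rec_unfold n r) s) tilu)
| rec_irunit G n t tl tr tlu tru tilu tiru s T :
    let e := Rec t tl tr tlu tru tilu tiru s in
    let r := Rec t tl tr tlu tru tilu tiru (id_sub (size (inv_ctx n.+1))) in
    tm_ok G e T -> sub_ok G s (inv_ctx n.+1) ->
    tm_eq G (Irunit e) (subst_tm (comp_sub (rec_unfold n r) s) tiru)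

with tms_eq : ctx -> seq tm -> seq tm -> Prop :=
| tms_eq_nil G : tms_eq G [::] [::]
| tms_eq_cons G t t' s s' :
    tm_eq G t t' -> tms_eq G s s' -> tms_eq G (t :: s) (t' :: s').

(* t : u -> v over A is invertible in G. *)
Definition invertible (G : ctx) (A : ty) (u v t : tm) : Prop :=
  exists e, tm_ok G e (Inv (Arr A u v) t).

(* Main.v *)
Require Import Defs.
From mathcomp Require Import all_boot zify.

Set Implicit Arguments.
Unset Strict Implicit.
Unset Printing Implicit Defensive.

(** Let a and b be invertibility structures on f * g and g * h.  Up to
    associativity, k = linv(a) * f is a left inverse of g and r = h * rinv(b) is a
    right inverse of g.  Associativity is an invertible cell and so are the
    cancellators of a and b, hence coind makes g invertible.  In the same way
    g * rinv(a) is a right inverse of f and linv(b) * g is a left inverse of h.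

    On the other side the natural candidates are g * linv(a) and rinv(b) * g, and
    (g * linv(a)) * f is g * k up to associativity.  So it has to be shown that the
    left inverse k of g is also a right inverse, which is the chain
      g k ~ (g k) id ~ (g k) (g r) ~ g ((k g) r) ~ g (id r) ~ g r ~ id
    of [left_inverse_is_right]; for h the mirror image shows that r is also a left
    inverse of g.  The second step of the chain runs the cell g r -> id backwards,
    and the composite is only usable if that inverse cell is itself invertible.

    That inverses of invertible cells are invertible ([linv_invertible]) is a
    genuinely coinductive fact, and the only place where rec is needed.  For the
    generic invertible cell t, the cell lunit(e) makes t a right inverse of
    linv(e); that t is also a left inverse of linv(e) is the chain above for g = t,
    k = linv(e) and r = rinv(e), which runs runit(e) backwards.  The recursive
    hypothesis attached to irunit(e) says precisely that this inverse is invertible.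

    All these derivations are conversion-free: types match on the nose.  They need,
    however, that the iterated sources and targets of a valid type are valid
    ([presupposition]), because every composite over A is a suspended coherence
    applied to the boundary of A.  The case of a coherence there rests on the
    substitution lemma ([substitution]), and the substitution lemma on the
    stability of the computation rules of can, which is a computation with the
    explicit inverses and cancellators of a coherence. *)

(** * Raw syntax: scoping, substitution and suspension *)

Fixpoint every (T : Type) (P : T -> Prop) (s : seq T) : Prop :=
  if s is x :: s' then P x /\ every P s' else True.

(** The data of a coherence or of a recursor other than its substitution live in
    another context: substitution and scoping ignore them, so they get no induction
    hypothesis. *)
Definition tm_nested_ind (P : tm -> Prop)
  (Hvar : forall i, P (Var i))
  (Hcoh : forall G A s, every P s -> P (Coh G A s))
  (Hcan : forall t es, P t -> every P es -> P (Can t es))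
  (Hcoind : forall t tl tr tlu tru tilu tiru,
    P t -> P tl -> P tr -> P tlu -> P tru -> P tilu -> P tiru ->
    P (Coind t tl tr tlu tru tilu tiru))
  (Hrec : forall t tl tr tlu tru tilu tiru s,
    every P s -> P (Rec t tl tr tlu tru tilu tiru s))
  (Hlinv : forall e, P e -> P (Linv e)) (Hrinv : forall e, P e -> P (Rinv e))
  (Hlunit : forall e, P e -> P (Lunit e)) (Hrunit : forall e, P e -> P (Runit e))
  (Hilunit : forall e, P e -> P (Ilunit e))
  (Hirunit : forall e, P e -> P (Irunit e)) : forall t, P t :=
  fix F t : P t :=
    let fix Fs (s : seq tm) : every P s :=
      match s with [::] => I | u :: s' => conj (F u) (Fs s') end in
    match t with
    | Var i => Hvar i
    | Coh G A s => Hcoh G A s (Fs s)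
    | Can t es => Hcan t es (F t) (Fs es)
    | Coind t tl tr tlu tru tilu tiru =>
        Hcoind t tl tr tlu tru tilu tiru
          (F t) (F tl) (F tr) (F tlu) (F tru) (F tilu) (F tiru)
    | Rec t tl tr tlu tru tilu tiru s => Hrec t tl tr tlu tru tilu tiru s (Fs s)
    | Linv e => Hlinv e (F e)
    | Rinv e => Hrinv e (F e)
    | Lunit e => Hlunit e (F e)
    | Runit e => Hrunit e (F e)
    | Ilunit e => Hilunit e (F e)
    | Irunit e => Hirunit e (F e)
    end.

Fixpoint scoped_tm (n : nat) (t : tm) : bool :=
  match t with
  | Var i => i < n
  | Coh _ _ s => all (scoped_tm n) s
  | Can t es => scoped_tm n t && all (scoped_tm n) es
  | Coind t tl tr tlu tru tilu tiru =>
      [&& scoped_tm n t, scoped_tm n tl, scoped_tm n tr, scoped_tm n tlu,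
          scoped_tm n tru, scoped_tm n tilu & scoped_tm n tiru]
  | Rec _ _ _ _ _ _ _ s => all (scoped_tm n) s
  | Linv e | Rinv e | Lunit e | Runit e | Ilunit e | Irunit e => scoped_tm n e
  end.

Fixpoint scoped_ty (n : nat) (A : ty) : bool :=
  match A with
  | Star => true
  | Arr A u v => [&& scoped_ty n A, scoped_tm n u & scoped_tm n v]
  | Inv T t => scoped_ty n T && scoped_tm n t
  end.

Lemma eq_map_every (T U : Type) (f g : T -> U) s :
  every (fun x => f x = g x) s -> map f s = map g s.
Proof. by elim: s => //= x s IH [-> /IH ->]. Qed.

Lemma eq_map_scoped (U : Type) (f g : tm -> U) n s :
  every (fun t => scoped_tm n t -> f t = g t) s -> all (scoped_tm n) s ->
  map f s = map g s.
Proof. by elim: s => //= x s IH [H /IH E] /andP[/H -> /E ->]. Qed.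

Lemma all_every (T : Type) (a b : T -> bool) s :
  every (fun x => a x -> b x) s -> all a s -> all b s.
Proof. by elim: s => //= x s IH [H /IH E] /andP[/H -> /E ->]. Qed.

Lemma scoped_tm_leq m n t : m <= n -> scoped_tm m t -> scoped_tm n t.
Proof.
move=> le_mn; elim/tm_nested_ind: t => //=.
- by move=> i lt_im; apply: leq_trans le_mn.
- by move=> _ _ s; apply: all_every.
- by move=> t es IHt IHes /andP[/IHt ->]; apply: all_every.
- by move=> t tl tr tlu tru tilu tiru H1 H2 H3 H4 H5 H6 H7
    /and5P[/H1 -> /H2 -> /H3 -> /H4 -> /and3P[/H5 -> /H6 -> /H7 ->]].
- by move=> t tl tr tlu tru tilu tiru s; apply: all_every.
Qed.

Lemma scoped_ty_leq m n A : m <= n -> scoped_ty m A -> scoped_ty n A.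
Proof.
move=> le_mn; elim: A => //= [A IH u v /and3P[/IH -> su sv] | T IH t /andP[/IH ->]].
  by rewrite !(scoped_tm_leq le_mn).
exact: scoped_tm_leq.
Qed.

Lemma subst_tm_ext n s s' t :
  scoped_tm n t -> (forall i, i < n -> nth (Var i) s i = nth (Var i) s' i) ->
  subst_tm s t = subst_tm s' t.
Proof.
move=> st E; elim/tm_nested_ind: t st => //=.
- by move=> G A d IH sd; rewrite (eq_map_scoped IH sd).
- by move=> t es IHt IH /andP[/IHt -> ses]; rewrite (eq_map_scoped IH ses).
- by move=> t tl tr tlu tru tilu tiru H1 H2 H3 H4 H5 H6 H7
    /and5P[/H1 -> /H2 -> /H3 -> /H4 -> /and3P[/H5 -> /H6 -> /H7 ->]].
- by move=> t tl tr tlu tru tilu tiru d IH sd; rewrite (eq_map_scoped IH sd).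
all: by move=> e IH /IH ->.
Qed.

Lemma subst_ty_ext n s s' A :
  scoped_ty n A -> (forall i, i < n -> nth (Var i) s i = nth (Var i) s' i) ->
  subst_ty s A = subst_ty s' A.
Proof.
move=> + E; elim: A => //= [A IH u v /and3P[/IH -> su sv] | T IH t /andP[/IH -> st]].
  by rewrite (subst_tm_ext su E) (subst_tm_ext sv E).
by rewrite (subst_tm_ext st E).
Qed.

Lemma subst_ty_cat s s' A :
  scoped_ty (size s) A -> subst_ty (s ++ s') A = subst_ty s A.
Proof. by move=> sA; apply: subst_ty_ext sA _ => i lt_i; rewrite nth_cat lt_i. Qed.

Lemma subst_tm_comp s s' t :
  scoped_tm (size s) t -> subst_tm s' (subst_tm s t) = subst_tm (comp_sub s s') t.
Proof.
elim/tm_nested_ind: t => //=.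
- by move=> i lt_i; rewrite (nth_map (Var i)).
- by move=> G A d IH sd; rewrite -map_comp (eq_map_scoped IH sd).
- by move=> t es IHt IH /andP[/IHt -> ses]; rewrite -map_comp (eq_map_scoped IH ses).
- by move=> t tl tr tlu tru tilu tiru H1 H2 H3 H4 H5 H6 H7
    /and5P[/H1 -> /H2 -> /H3 -> /H4 -> /and3P[/H5 -> /H6 -> /H7 ->]].
- by move=> t tl tr tlu tru tilu tiru d IH sd; rewrite -map_comp (eq_map_scoped IH sd).
all: by move=> e IH /IH ->.
Qed.

Lemma subst_ty_comp s s' A :
  scoped_ty (size s) A -> subst_ty s' (subst_ty s A) = subst_ty (comp_sub s s') A.
Proof.
elim: A => //= [A IH u v /and3P[/IH -> su sv] | T IH t /andP[/IH -> st]].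
  by rewrite !subst_tm_comp.
by rewrite subst_tm_comp.
Qed.

Lemma size_comp_sub d s : size (comp_sub d s) = size d.
Proof. exact: size_map. Qed.

Lemma size_id_sub n : size (id_sub n) = n.
Proof. by rewrite size_map size_iota. Qed.

Lemma nth_id_sub n i : nth (Var i) (id_sub n) i = Var i.
Proof.
case: (ltnP i n) => lt_i; last by rewrite nth_default ?size_id_sub.
by rewrite (nth_map 0) ?size_iota // nth_iota.
Qed.

Lemma subst_tm_id n t : subst_tm (id_sub n) t = t.
Proof.
elim/tm_nested_ind: t => /=; first exact: nth_id_sub.
- by move=> G A s IH; rewrite (eq_map_every IH) map_id.
- by move=> t es -> IH; rewrite (eq_map_every IH) map_id.
- by move=> t tl tr tlu tru tilu tiru -> -> -> -> -> -> ->.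
- by move=> t tl tr tlu tru tilu tiru s IH; rewrite (eq_map_every IH) map_id.
all: by move=> e ->.
Qed.

Lemma subst_ty_id n A : subst_ty (id_sub n) A = A.
Proof. by elim: A => //= [A -> u v | T -> t]; rewrite !subst_tm_id. Qed.

Lemma scoped_subst_tm m s t :
  scoped_tm (size s) t -> all (scoped_tm m) s -> scoped_tm m (subst_tm s t).
Proof.
move=> st sm.
have H d : every (fun t => scoped_tm (size s) t -> scoped_tm m (subst_tm s t)) d ->
    all (scoped_tm (size s)) d -> all (scoped_tm m) (map (subst_tm s) d).
  by move=> IH sd; rewrite all_map; apply: all_every sd.
elim/tm_nested_ind: t st => //=.
- by move=> i lt_i; apply: all_nthP.
- by move=> t es IHt IH /andP[/IHt -> ses]; apply: H.
- by move=> t tl tr tlu tru tilu tiru H1 H2 H3 H4 H5 H6 H7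
    /and5P[/H1 -> /H2 -> /H3 -> /H4 -> /and3P[/H5 -> /H6 -> /H7 ->]].
Qed.

Lemma scoped_subst_ty m s A :
  scoped_ty (size s) A -> all (scoped_tm m) s -> scoped_ty m (subst_ty s A).
Proof.
move=> + sm; elim: A => //= [A IH u v /and3P[/IH -> su sv] | T IH t /andP[/IH ->]].
  by rewrite !scoped_subst_tm.
by move=> st; rewrite scoped_subst_tm.
Qed.

Lemma susp_subst_tm s t :
  susp_tm (subst_tm s t) = subst_tm (susp_sub s) (susp_tm t).
Proof.
elim/tm_nested_ind: t => //=.
- move=> i; case: (ltnP i (size s)) => lt_i; first by rewrite (nth_map (Var i)).
  by rewrite !nth_default ?size_map.
- by move=> G A d IH; rewrite -!map_comp (eq_map_every IH).
- by move=> t es -> IH; rewrite -!map_comp (eq_map_every IH).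
- by move=> t tl tr tlu tru tilu tiru -> -> -> -> -> -> ->.
- by move=> t tl tr tlu tru tilu tiru d IH; rewrite -!map_comp (eq_map_every IH).
all: by move=> e ->.
Qed.

Lemma susp_subst_ty s A :
  susp_ty (subst_ty s A) = subst_ty (susp_sub s) (susp_ty A).
Proof. by elim: A => //= [A -> u v | T -> t]; rewrite !susp_subst_tm. Qed.

Lemma scoped_susp_tm n t : scoped_tm n t -> scoped_tm n.+2 (susp_tm t).
Proof.
have H d : every (fun t => scoped_tm n t -> scoped_tm n.+2 (susp_tm t)) d ->
    all (scoped_tm n) d -> all (scoped_tm n.+2) (map susp_tm d).
  by move=> IH sd; rewrite all_map; apply: all_every sd.
elim/tm_nested_ind: t => //=.
- by move=> t es IHt IH /andP[/IHt -> ses]; apply: H.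
- by move=> t tl tr tlu tru tilu tiru H1 H2 H3 H4 H5 H6 H7
    /and5P[/H1 -> /H2 -> /H3 -> /H4 -> /and3P[/H5 -> /H6 -> /H7 ->]].
Qed.

Lemma scoped_susp_ty n A : scoped_ty n A -> scoped_ty n.+2 (susp_ty A).
Proof.
elim: A => //= [A IH u v /and3P[/IH -> su sv] | T IH t /andP[/IH ->]].
  by rewrite !scoped_susp_tm.
exact: scoped_susp_tm.
Qed.

Lemma iter_susp_arr n A u v :
  iter n susp_ty (Arr A u v) =
  Arr (iter n susp_ty A) (iter n susp_tm u) (iter n susp_tm v).
Proof. by elim: n => //= n ->. Qed.

Lemma iter_susp_var n i : iter n susp_tm (Var i) = Var (n.*2 + i).
Proof. by elim: n => //= n ->. Qed.

Lemma id_subS n : id_sub n.+2 = [:: Var 0, Var 1 & map susp_tm (id_sub n)].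
Proof.
rewrite /id_sub /= -map_comp; congr [:: _, _ & _].
by rewrite (iotaDl 2 0) -map_comp.
Qed.

Lemma iter_susp_sub n s :
  iter n susp_sub s = id_sub n.*2 ++ map (iter n susp_tm) s.
Proof.
elim: n => [|n IH]; first by rewrite map_id.
by rewrite iterS IH doubleS id_subS /susp_sub map_cat -!map_comp.
Qed.

Lemma iter_susp_coh n G A s :
  iter n susp_tm (Coh G A s) =
  Coh (iter n susp_ctx G) (iter n susp_ty A) (iter n susp_sub s).
Proof. by elim: n => //= n ->. Qed.

Lemma iter_susp_ctx n G :
  iter n susp_ctx G = iter n susp_ctx [::] ++ map (iter n susp_ty) G.
Proof.
elim: n => /= [|n ->]; first by rewrite map_id.
by rewrite /susp_ctx map_cat -!map_comp.
Qed.

Lemma size_iter_susp_ctx n G : size (iter n susp_ctx G) = n.*2 + size G.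
Proof. by elim: n => //= n; rewrite size_map => ->. Qed.

Lemma iter_susp_subst_tm n s t :
  iter n susp_tm (subst_tm s t) = subst_tm (iter n susp_sub s) (iter n susp_tm t).
Proof. by elim: n => //= n ->; rewrite susp_subst_tm. Qed.

Lemma scoped_iter_susp_tm n k t :
  scoped_tm k t -> scoped_tm (n.*2 + k) (iter n susp_tm t).
Proof.
by move=> st; elim: n => //= n IH; apply: scoped_susp_tm.
Qed.

Lemma scoped_iter_susp_ty n k A :
  scoped_ty k A -> scoped_ty (n.*2 + k) (iter n susp_ty A).
Proof.
by move=> st; elim: n => //= n IH; apply: scoped_susp_ty.
Qed.

Lemma size_boundary A : size (boundary A) = (tdim A).*2.
Proof. by elim: A => //= A IH u v; rewrite size_cat IH addn2. Qed.

Lemma tdim_subst s A : tdim (subst_ty s A) = tdim A.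
Proof. by elim: A => //= A ->. Qed.

Lemma boundary_subst s A : boundary (subst_ty s A) = map (subst_tm s) (boundary A).
Proof. by elim: A => //= A -> u v; rewrite map_cat. Qed.

Lemma op_at_subst s t0 A args :
  scoped_tm (size args) t0 ->
  subst_tm s (op_at t0 A args) = op_at t0 (subst_ty s A) (map (subst_tm s) args).
Proof.
move=> st0; rewrite /op_at subst_tm_comp.
  by rewrite /comp_sub map_cat boundary_subst tdim_subst.
by rewrite size_cat size_boundary; apply: scoped_iter_susp_tm.
Qed.

Lemma scoped_boundary n A : scoped_ty n A -> all (scoped_tm n) (boundary A).
Proof.
by elim: A => //= A IH u v /and3P[sA su sv]; rewrite all_cat IH //= su sv.
Qed.

Lemma scoped_op_at n t0 A args :
  scoped_tm (size args) t0 -> scoped_ty n A -> all (scoped_tm n) args ->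
  scoped_tm n (op_at t0 A args).
Proof.
move=> st0 sA sargs; apply: scoped_subst_tm.
  by rewrite size_cat size_boundary; apply: scoped_iter_susp_tm.
by rewrite all_cat scoped_boundary.
Qed.

Lemma comp_tm_subst s A x y z f g :
  subst_tm s (comp_tm A x y z f g) =
  comp_tm (subst_ty s A) (subst_tm s x) (subst_tm s y) (subst_tm s z)
          (subst_tm s f) (subst_tm s g).
Proof. exact: op_at_subst. Qed.

Lemma id_tm_subst s A x : subst_tm s (id_tm A x) = id_tm (subst_ty s A) (subst_tm s x).
Proof. exact: op_at_subst. Qed.

Lemma comp3_subst s A x y z w f g h :
  subst_tm s (comp3 A x y z w f g h) =
  comp3 (subst_ty s A) (subst_tm s x) (subst_tm s y) (subst_tm s z) (subst_tm s w)
        (subst_tm s f) (subst_tm s g) (subst_tm s h).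
Proof. exact: op_at_subst. Qed.

Lemma lcancel_subst s A u v t l :
  subst_ty s (lcancel_ty A u v t l) =
  lcancel_ty (subst_ty s A) (subst_tm s u) (subst_tm s v) (subst_tm s t) (subst_tm s l).
Proof. by rewrite /= comp_tm_subst id_tm_subst. Qed.

Lemma rcancel_subst s A u v t r :
  subst_ty s (rcancel_ty A u v t r) =
  rcancel_ty (subst_ty s A) (subst_tm s u) (subst_tm s v) (subst_tm s t) (subst_tm s r).
Proof. by rewrite /= comp_tm_subst id_tm_subst. Qed.

Lemma scoped_comp_tm n A x y z f g :
  scoped_ty n A -> all (scoped_tm n) [:: x; y; f; z; g] ->
  scoped_tm n (comp_tm A x y z f g).
Proof. exact: scoped_op_at. Qed.

Lemma scoped_id_tm n A x : scoped_ty n A -> scoped_tm n x -> scoped_tm n (id_tm A x).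
Proof. by move=> sA sx; apply: scoped_op_at; rewrite //= sx. Qed.

(** * Stability of the canonical inverses under substitution *)

Lemma comp_subA d s s' :
  all (scoped_tm (size s)) d ->
  comp_sub (comp_sub d s) s' = comp_sub d (comp_sub s s').
Proof. by elim: d => //= t d IH /andP[/subst_tm_comp -> /IH ->]. Qed.

Lemma eq_chain (T : Type) (x x' f f' : nat -> T) k :
  (forall j, j <= k -> x j = x' j) -> (forall j, 0 < j <= k -> f j = f' j) ->
  chain x f k = chain x' f' k.
Proof.
move=> Ex Ef; rewrite /chain Ex //; congr (_ :: flatten _).
apply/eq_in_map => j; rewrite mem_iota => /andP[j1 jk].
by rewrite Ex ?Ef // j1; lia.
Qed.

Lemma map_chain (T U : Type) (h : T -> U) (x f : nat -> T) k :
  map h (chain x f k) = chain (h \o x) (h \o f) k.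
Proof. by rewrite /chain /= map_flatten -map_comp. Qed.

Lemma all_chain (T : Type) (a : pred T) (x f : nat -> T) k :
  (forall j, j <= k -> a (x j)) -> (forall j, 0 < j <= k -> a (f j)) ->
  all a (chain x f k).
Proof.
move=> Hx Hf; rewrite /chain /= Hx //=.
have: all (fun j => (0 < j) && (j <= k)) (iota 1 k).
  by apply/allP => j; rewrite mem_iota => /andP[-> ?]; lia.
elim: (iota 1 k) => //= j js IH /andP[/andP[j0 jk] /IH ->].
by rewrite Hx ?Hf ?j0.
Qed.

(** P holds along the traversal that [blockwise] performs, so that two lists built
    blockwise can be compared one block at a time with the position of the block
    at hand. *)
Fixpoint on_blocks (P : nat -> nat -> nat -> Prop) (sz : nat -> nat)
    (p q : nat) (ks : seq nat) : Prop :=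
  if ks is k :: ks' then
    P p q k /\ on_blocks P sz (p + sz k) (q + k.*2.+1) ks'
  else True.

Lemma on_blocks_impl (P Q : nat -> nat -> nat -> Prop) sz p q ks :
  (forall p q k, P p q k -> Q p q k) -> on_blocks P sz p q ks ->
  on_blocks Q sz p q ks.
Proof. by move=> PQ; elim: ks p q => //= k ks IH p q [/PQ ? /IH]. Qed.

Lemma on_blocks_and (P Q : nat -> nat -> nat -> Prop) sz p q ks :
  on_blocks P sz p q ks -> on_blocks Q sz p q ks ->
  on_blocks (fun p q k => P p q k /\ Q p q k) sz p q ks.
Proof. by elim: ks p q => //= k ks IH p q [? /IH H] [? /H]. Qed.

Lemma on_blocks_range sz p q ks :
  on_blocks (fun p' q' k => p' + sz k <= p + sumn (map sz ks) /\
                            q' + k.*2.+1 <= q + sumn (map block_size ks)) sz p q ks.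
Proof.
elim: ks p q => //= k ks IH p q; rewrite /block_size; split; first by lia.
apply: on_blocks_impl (IH (p + sz k) (q + k.*2.+1)) => p' q' k'.
by rewrite /block_size; lia.
Qed.

Lemma eq_blockwise (T : Type) sz (F F' : nat -> nat -> nat -> seq T) p q ks :
  on_blocks (fun p q k => F p q k = F' p q k) sz p q ks ->
  blockwise sz F p q ks = blockwise sz F' p q ks.
Proof. by elim: ks p q => //= k ks IH p q [-> /IH ->]. Qed.

Lemma map_blockwise (T U : Type) (h : T -> U) sz F p q ks :
  map h (blockwise sz F p q ks) = blockwise sz (fun p q k => map h (F p q k)) p q ks.
Proof. by elim: ks p q => //= k ks IH p q; rewrite map_cat IH. Qed.

Lemma all_blockwise (T : Type) (a : pred T) sz F p q ks :
  on_blocks (fun p q k => all a (F p q k)) sz p q ks -> all a (blockwise sz F p q ks).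
Proof. by elim: ks p q => //= k ks IH p q [Fk /IH ?]; rewrite all_cat Fk. Qed.

Lemma size_blockwise (T : Type) sz' sz (F : nat -> nat -> nat -> seq T) p q ks :
  (forall p q k, size (F p q k) = sz' k) ->
  size (blockwise sz F p q ks) = sumn (map sz' ks).
Proof. by move=> E; elim: ks p q => //= k ks IH p q; rewrite size_cat E IH. Qed.

Lemma sumn_blocks_rec N k G :
  ~~ odd (size G) ->
  sumn (map block_size (blocks_rec N k G)) = k.*2.+1 + size G.
Proof.
have [m] := ubnP (size G); elim: m => // m IH in k G *.
case: G => [|A [|F G]] //=.
rewrite negbK => lt_m ev; case: ifP => _ /=; rewrite IH //; rewrite /block_size; lia.
Qed.

Lemma sumn_blocks N G : odd (size G) -> sumn (map block_size (blocks N G)) = size G.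
Proof. by case: G => //= A G odG; rewrite sumn_blocks_rec //; lia. Qed.

(** Here [pre] is what has been read so far and ends with the k arrows of the
    current block. *)
Lemma blocks_rec_arr N sz k p q pre G :
  size pre = q + k.*2.+1 ->
  (forall j, 0 < j <= k -> var_dim (pre ++ G) (arr q j) = N) ->
  on_blocks (fun _ q k => forall j, 0 < j <= k -> var_dim (pre ++ G) (arr q j) = N)
    sz p q (blocks_rec N k G).
Proof.
have [m] := ubnP (size G); elim: m => // m IH in k p q pre G *.
case: G => [|A [|F G]] //= lt_m Epre Hk.
have -> : pre ++ [:: A, F & G] = (pre ++ [:: A; F]) ++ G by rewrite -catA.
case: eqP => [tF | _].
  apply: IH; rewrite -?catA ?size_cat //=; [lia | lia |].
  move=> j /andP[j0]; rewrite leq_eqVlt => /predU1P[-> | lt_j].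
    rewrite /var_dim /var_ty /arr nth_cat Epre ifN; last by lia.
    by have -> : q + k.+1.*2 - (q + k.*2.+1) = 1 by lia.
  by apply: Hk; rewrite j0.
split; first by rewrite -catA.
split; first by case.
by apply: IH; rewrite ?size_cat //=; [lia | lia | case].
Qed.

(** A block is closed by the first variable in such a position that is not
    N-dimensional. *)
Lemma blocks_arr N sz p G :
  odd (size G) ->
  on_blocks (fun _ q k => forall j, 0 < j <= k -> var_dim G (arr q j) = N)
    sz p 0 (blocks N G).
Proof.
case: G => // A G _; apply: (@blocks_rec_arr N sz 0 p 0 [:: A] G) => //.
by case.
Qed.

Lemma obj_lt q k j : j <= k -> obj q j < q + k.*2.+1.
Proof. by rewrite /obj; lia. Qed.

Lemma arr_lt q k j : j <= k -> arr q j < q + k.*2.+1.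
Proof. by rewrite /arr; lia. Qed.

Lemma zidx_le l k j : j <= k -> zidx l k j <= k.
Proof. by rewrite /zidx; case: l; lia. Qed.

Lemma fidx_in l k j : 0 < j <= k -> 0 < fidx l k j <= k.
Proof. by rewrite /fidx; case: l; lia. Qed.

(** The families that describe a block commute with substitution only on the
    indices of that block: elsewhere they return default values. *)
Definition subst_fam (s : sub) (lo k : nat) (f f' : nat -> tm) : Prop :=
  forall j, lo <= j -> j <= k -> f' j = subst_tm s (f j).

Lemma subst_famS s lo k f f' : subst_fam s lo k.+1 f f' -> subst_fam s lo k f f'.
Proof. by move=> H j le_lo le_k; apply: H => //; apply: leqW. Qed.

Lemma groupSS T z z' a b k :
  group T z z' a b k.+2 =
  comp3 T (z k.+2) (z k.+1) (z' k.+1) (z' k.+2) (a k.+2)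
        (group T z z' a b k.+1) (b k.+2).
Proof. by []. Qed.

Lemma group_subst s T z y z' y' a a' b b' k :
  subst_fam s 0 k z y -> subst_fam s 0 k z' y' ->
  subst_fam s 1 k a a' -> subst_fam s 1 k b b' ->
  subst_tm s (group T z z' a b k) = group (subst_ty s T) y y' a' b' k.
Proof.
elim: k => [|[|k] IH] Hz Hz' Ha Hb.
- by rewrite /group id_tm_subst Hz.
- by rewrite /group comp_tm_subst !(Hz, Hz', Ha, Hb).
by rewrite !groupSS comp3_subst IH ?(Hz, Hz', Ha, Hb) //; apply: subst_famS.
Qed.

Lemma cancel_step_whisk_subst s T z y a a' b b' k r :
  subst_fam s 0 k.+1 z y -> subst_fam s 1 k.+1 a a' -> subst_fam s 1 k.+1 b b' ->
  subst_tm s (cancel_step_whisk T z a b k r) =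
  cancel_step_whisk (subst_ty s T) y a' b' k (subst_tm s r).
Proof.
move=> Hz Ha Hb; rewrite /cancel_step_whisk /whisk op_at_subst //=.
have Hz1 := subst_famS Hz.
rewrite (group_subst T Hz1 Hz1 (subst_famS Ha) (subst_famS Hb)).
by rewrite id_tm_subst !(Hz, Ha, Hb).
Qed.

Lemma cancel_step_unit_subst s T z y a a' b b' k :
  subst_fam s 0 k.+1 z y -> subst_fam s 1 k.+1 a a' -> subst_fam s 1 k.+1 b b' ->
  subst_tm s (cancel_step_unit T z a b k) = cancel_step_unit (subst_ty s T) y a' b' k.
Proof.
move=> Hz Ha Hb; rewrite /cancel_step_unit /unit3 op_at_subst //=.
by rewrite !(Hz, Ha, Hb).
Qed.

Lemma cancel_chainSS T z a b c k :
  cancel_chain T z a b c k.+2 =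
  comp3 (Arr T (z k.+2) (z k.+2))
    (group T z z a b k.+2)
    (comp3 T (z k.+2) (z k.+1) (z k.+1) (z k.+2)
       (a k.+2) (id_tm T (z k.+1)) (b k.+2))
    (comp_tm T (z k.+2) (z k.+1) (z k.+2) (a k.+2) (b k.+2))
    (id_tm T (z k.+2))
    (cancel_step_whisk T z a b k.+1 (cancel_chain T z a b c k.+1))
    (cancel_step_unit T z a b k.+1)
    (c k.+2).
Proof. by []. Qed.

Lemma cancel_chain_subst s T z y a a' b b' c c' k :
  subst_fam s 0 k z y -> subst_fam s 1 k a a' -> subst_fam s 1 k b b' ->
  subst_fam s 1 k c c' ->
  subst_tm s (cancel_chain T z a b c k) = cancel_chain (subst_ty s T) y a' b' c' k.
Proof.
elim: k => [|[|k] IH] Hz Ha Hb Hc.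
- by rewrite /cancel_chain id_tm_subst id_tm_subst Hz.
- by rewrite /= Hc.
rewrite !cancel_chainSS comp3_subst (group_subst T Hz Hz Ha Hb) comp3_subst.
rewrite comp_tm_subst !id_tm_subst (cancel_step_whisk_subst T _ Hz Ha Hb).
rewrite (cancel_step_unit_subst T Hz Ha Hb) IH; try exact: subst_famS.
by rewrite [subst_ty s (Arr _ _ _)]/= !(Hz, Ha, Hb, Hc).
Qed.

Lemma cancel_chain_invSS T z a b c i k :
  cancel_chain_inv T z a b c i k.+2 =
  Can (cancel_chain T z a b c k.+2)
    [:: Can (cancel_step_whisk T z a b k.+1 (cancel_chain T z a b c k.+1))
            [:: cancel_chain_inv T z a b c i k.+1];
        Can (cancel_step_unit T z a b k.+1) [::];
        i k.+2].
Proof. by []. Qed.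

Lemma subst_can s t es : subst_tm s (Can t es) = Can (subst_tm s t) (map (subst_tm s) es).
Proof. by []. Qed.

Lemma cancel_chain_inv_subst s T z y a a' b b' c c' i i' k :
  subst_fam s 0 k z y -> subst_fam s 1 k a a' -> subst_fam s 1 k b b' ->
  subst_fam s 1 k c c' -> subst_fam s 1 k i i' ->
  subst_tm s (cancel_chain_inv T z a b c i k) =
  cancel_chain_inv (subst_ty s T) y a' b' c' i' k.
Proof.
elim: k => [|[|k] IH] Hz Ha Hb Hc Hi.
- by rewrite /cancel_chain_inv subst_can (cancel_chain_subst T Hz Ha Hb Hc).
- by rewrite /= Hi.
have H1 := subst_famS Ha; have H2 := subst_famS Hb; have H3 := subst_famS Hc.
rewrite !cancel_chain_invSS subst_can (cancel_chain_subst T Hz Ha Hb Hc).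
rewrite !map_cons !subst_can /= (cancel_step_whisk_subst T _ Hz Ha Hb).
rewrite (cancel_step_unit_subst T Hz Ha Hb) (cancel_chain_subst T (subst_famS Hz) H1 H2 H3).
by rewrite (IH (subst_famS Hz) H1 H2 H3 (subst_famS Hi)) -Hi.
Qed.

(** The size and scoping facts that a well-typed [Can (Coh G (Arr B u v) s) es]
    provides: they keep the default values of the indexed lookups in its
    computation rules from ever being reached. *)
Definition can_data (G : ctx) (B : ty) (u v : tm) (s es : seq tm) : Prop :=
  [/\ odd (size G), all (scoped_ty (size G)) G, scoped_ty (size G) (Arr B u v),
      size s = size G & size es = count (fun A => tdim A == (tdim B).+1) G].

Lemma inv_at_lt N G i :
  i < size G -> var_dim G i = N ->
  count (fun A => tdim A == N) (take i G) < count (fun A => tdim A == N) G.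
Proof.
move=> lt_i dim_i; rewrite -[in X in _ < X](cat_take_drop i G) count_cat.
by rewrite -[X in X < _]addn0 ltn_add2l (drop_nth Star) //= -/(var_ty G i) -/(var_dim G i) dim_i eqxx.
Qed.

Lemma inv_at_subst N G s es i :
  i < size G -> var_dim G i = N -> size es = count (fun A => tdim A == N) G ->
  inv_at N G (map (subst_tm s) es) i = subst_tm s (inv_at N G es i).
Proof.
by move=> lt_i dim_i Ees; rewrite /inv_at (nth_map (Var 0)) // Ees inv_at_lt.
Qed.

Lemma op_perm_lt N G : odd (size G) -> all (fun i => i < size G) (op_perm N G).
Proof.
move=> odG; apply: all_blockwise.
apply: on_blocks_impl (on_blocks_range _ 0 0 (blocks N G)) => p q k [_].
rewrite add0n sumn_blocks // => le_q.
apply: all_chain => j ?; [have := @obj_lt q k (k - j) | have := @arr_lt q k (k.+1 - j)]; lia.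
Qed.

Lemma can_inv_subst sg l G B u v s es :
  can_data G B u v s es ->
  subst_tm sg (can_inv l G B u v s es) =
  can_inv l G B u v (comp_sub s sg) (comp_sub es sg).
Proof.
case=> odG _ _ Es Ees; rewrite /can_inv /op_coh /=; congr Coh.
rewrite [LHS]comp_subA; last first.
  rewrite size_map size_iota all_map; exact: op_perm_lt.
congr comp_sub; rewrite /inv_sub /comp_sub -map_comp; apply/eq_in_map => i.
rewrite mem_iota add0n => /andP[_ lt_i] /=; case: eqP => dim_i.
  by case: l; rewrite inv_at_subst.
by rewrite (nth_map (Var i)) // Es.
Qed.

(** In such a block no lookup in a substitution on G or in [es] returns its
    default value. *)
Definition good_block (N : nat) (G : ctx) (es : seq tm) (q k : nat) : Prop :=
  [/\ q + k.*2.+1 <= size G, size es = count (fun A => tdim A == N) G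
    & forall j, 0 < j <= k -> var_dim G (arr q j) = N].

Lemma good_blocks G B u v s es sz p :
  let N := (tdim B).+1 in
  can_data G B u v s es ->
  on_blocks (fun _ q k => good_block N G es q k) sz p 0 (blocks N G).
Proof.
move=> N [odG _ _ _ Ees].
apply: on_blocks_impl (on_blocks_and (on_blocks_range sz p 0 (blocks N G))
  (blocks_arr N sz p odG)) => p' q k [[_ le_q] dimq].
by split=> //; rewrite -(sumn_blocks N odG).
Qed.

Lemma blk_z_subst sg l s q k :
  q + k.*2.+1 <= size s ->
  subst_fam sg 0 k (blk_z l s q k) (blk_z l (comp_sub s sg) q k).
Proof.
move=> le_q j _ le_j; rewrite /blk_z (nth_map (Var 0)) //.
by have := obj_lt q (zidx_le l le_j); lia.
Qed.

Lemma blk_f_subst sg l s q k :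
  q + k.*2.+1 <= size s ->
  subst_fam sg 1 k (blk_f l s q k) (blk_f l (comp_sub s sg) q k).
Proof.
move=> le_q j j0 le_j; rewrite /blk_f (nth_map (Var 0)) //.
have /(fidx_in l)/andP[_ /(arr_lt q)] : 0 < j <= k by rewrite j0.
by lia.
Qed.

Lemma blk_e_subst sg l N G es q k :
  good_block N G es q k ->
  subst_fam sg 1 k (blk_e l N G es q k) (blk_e l N G (comp_sub es sg) q k).
Proof.
move=> [le_q Ees dimq] j j0 le_j.
have /(fidx_in l) Hf : 0 < j <= k by rewrite j0.
rewrite /blk_e inv_at_subst //; last exact: dimq.
by have /andP[_ /(arr_lt q)] := Hf; lia.
Qed.

Lemma subst_fam_map sg lo k f f' D :
  (forall t, subst_tm sg (D t) = D (subst_tm sg t)) ->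
  subst_fam sg lo k f f' -> subst_fam sg lo k (D \o f) (D \o f').
Proof. by move=> ED E j j0 jk; rewrite /= ED E. Qed.

Section BlockSubst.
Context (sg : sub) (l : bool) (N : nat) (G : ctx) (s es : seq tm) (q k : nat).
Context (good : good_block N G es q k) (Es : size s = size G).
Context (scG : all (scoped_ty (size G)) G).

Let ss := comp_sub s sg.
Let ees := comp_sub es sg.

Lemma blk_ty_subst : subst_ty sg (blk_ty G s q) = blk_ty G ss q.
Proof.
rewrite /blk_ty subst_ty_comp // Es /var_ty.
by case: (ltnP q (size G)) => lt_q; [apply: all_nthP | rewrite nth_default].
Qed.

Lemma blk_zE : subst_fam sg 0 k (blk_z l s q k) (blk_z l ss q k).
Proof. by apply: blk_z_subst; rewrite Es; case: good. Qed.

Lemma blk_aE : subst_fam sg 1 k (blk_a l N G s es q k) (blk_a l N G ss ees q k).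
Proof.
rewrite /blk_a; case: l; first exact: subst_fam_map (blk_e_subst sg true good).
by apply: blk_f_subst; rewrite Es; case: good.
Qed.

Lemma blk_bE : subst_fam sg 1 k (blk_b l N G s es q k) (blk_b l N G ss ees q k).
Proof.
rewrite /blk_b; case: l; last exact: subst_fam_map (blk_e_subst sg false good).
by apply: blk_f_subst; rewrite Es; case: good.
Qed.

Lemma blk_cE : subst_fam sg 1 k (blk_c l N G es q k) (blk_c l N G ees q k).
Proof. by rewrite /blk_c; case: l; apply: subst_fam_map (blk_e_subst sg _ good). Qed.

Lemma blk_icE : subst_fam sg 1 k (blk_ic l N G es q k) (blk_ic l N G ees q k).
Proof. by rewrite /blk_ic; case: l; apply: subst_fam_map (blk_e_subst sg _ good). Qed.

Lemma blk_group_subst :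
  subst_tm sg (blk_group l N G s es q k) = blk_group l N G ss ees q k.
Proof.
by rewrite /blk_group (group_subst _ blk_zE blk_zE blk_aE blk_bE) blk_ty_subst.
Qed.

Lemma blk_cancel_subst :
  subst_tm sg (blk_cancel l N G s es q k) = blk_cancel l N G ss ees q k.
Proof.
by rewrite /blk_cancel (cancel_chain_subst _ blk_zE blk_aE blk_bE blk_cE) blk_ty_subst.
Qed.

Lemma blk_cancel_inv_subst :
  subst_tm sg (blk_cancel_inv l N G s es q k) = blk_cancel_inv l N G ss ees q k.
Proof.
rewrite /blk_cancel_inv (cancel_chain_inv_subst _ blk_zE blk_aE blk_bE blk_cE blk_icE).
by rewrite blk_ty_subst.
Qed.

Lemma blk_dbl_subst :
  map (subst_tm sg) (blk_dbl l N G s es q k) = blk_dbl l N G ss ees q k.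
Proof.
rewrite /blk_dbl map_chain; apply: eq_chain => j jk /=; case: leqP => lt_j.
- by rewrite blk_zE //; lia.
- by rewrite blk_zE //; lia.
- by rewrite blk_aE //; lia.
- by rewrite blk_bE //; lia.
Qed.

Lemma blk_cell_subst :
  map (subst_tm sg) (blk_cell l N G s es q k) = blk_cell l N G ss ees q k.
Proof.
have Ez := @blk_zE k isT (leqnn k).
have Eg := blk_group_subst; have Ec := blk_cancel_subst; have ET := blk_ty_subst.
rewrite /blk_cell; case: (posnP k) => [k0 | k_gt0].
  by have := @blk_zE 0 isT isT; rewrite k0 => -> .
rewrite -(prednK k_gt0) in Ez Eg Ec *.
by rewrite !map_cons id_tm_subst ET Ez Eg Ec.
Qed.

End BlockSubst.

Section CanSubst.
Context (sg : sub) (l : bool) (G : ctx) (B : ty) (u v : tm) (s es : seq tm).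
Context (data : can_data G B u v s es).

Let N := (tdim B).+1.
Let ss := comp_sub s sg.
Let ees := comp_sub es sg.

Let Es : size s = size G. Proof. by case: data. Qed.
Let scG : all (scoped_ty (size G)) G. Proof. by case: data. Qed.

Lemma blockwise_subst sz (F F' : nat -> nat -> seq tm) p :
  (forall q k, good_block N G es q k -> map (subst_tm sg) (F q k) = F' q k) ->
  map (subst_tm sg) (blockwise sz (fun _ => F) p 0 (blocks N G)) =
  blockwise sz (fun _ => F') p 0 (blocks N G).
Proof.
move=> E; rewrite map_blockwise; apply: eq_blockwise.
by apply: on_blocks_impl (good_blocks sz p data) => p' q k /E.
Qed.

Lemma associator_subst :
  subst_tm sg (associator l G B u v s es) = associator l G B u v ss ees.
Proof.
rewrite /associator -/N [LHS]/=; congr Coh.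
by apply: blockwise_subst => q k good; apply: blk_dbl_subst.
Qed.

Lemma cells_subst :
  map (subst_tm sg) (blockwise cell_size (fun _ => blk_cell l N G s es) 0 0 (blocks N G)) =
  blockwise cell_size (fun _ => blk_cell l N G ss ees) 0 0 (blocks N G).
Proof. by apply: blockwise_subst => q k good; apply: blk_cell_subst. Qed.

Lemma cancellator_subst :
  subst_tm sg (cancellator l G B u v s es) = cancellator l G B u v ss ees.
Proof. by rewrite /cancellator -/N -cells_subst. Qed.

Lemma bd_sub_subst : map (subst_tm sg) (bd_sub l N G s) = bd_sub l N G ss.
Proof.
apply: blockwise_subst => q k good /=; congr [:: _].
by rewrite (blk_zE sg l good Es).
Qed.

Lemma unitor_subst : subst_tm sg (unitor l G B u v s) = unitor l G B u v ss.
Proof. by rewrite /unitor -/N -bd_sub_subst. Qed.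

Lemma cancellator_family_subst :
  map (subst_tm sg) (cancellator_family l G B s es) = cancellator_family l G B ss ees.
Proof.
apply: blockwise_subst => q k good.
have := blk_cancel_inv_subst sg l good Es scG; case: k good => //= k _ E.
by rewrite -E.
Qed.

(** [can_unit] writes the common boundary of the associator and the cancellator as
    a coherence over generic blocks, instantiated at the actual ones.  Substituting
    afterwards amounts to substituting in the actual blocks, because the generic
    arguments are scoped. *)
Lemma cancellator_src_subst :
  let X s es := blockwise cell_size (fun _ => blk_cell l N G s es) 0 0 (blocks N G) in
  let src X := if cancellator_ty l G B u v is Arr _ c d then subst_tm X c else Var 0 in
  subst_tm sg (src (X s es)) = src (X ss ees).
Proof.
rewrite /cancellator_ty /one_coh /=; congr Coh.
rewrite [LHS]comp_subA /comp_sub ?cells_subst //.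
rewrite (@size_blockwise _ cell_size); last by move=> p q [].
apply: all_blockwise.
apply: on_blocks_impl (on_blocks_range cell_size 0 0 (blocks N G)) => p q k [lt_p _].
by case: k lt_p => [|k] /=; rewrite /cell_size; lia.
Qed.

Lemma unitor_src_subst :
  let src X := if unitor_ty l G B u v is Arr _ c d then subst_tm X c else Var 0 in
  subst_tm sg (src (bd_sub l N G s)) = src (bd_sub l N G ss).
Proof.
rewrite /unitor_ty /one_coh -/N /=; congr Coh.
rewrite [LHS]comp_subA /comp_sub ?bd_sub_subst //.
have -> : size (bd_sub l N G s) = sumn (map bd_size (blocks N G)).
  exact: size_blockwise.
set m := sumn _; set s0 := collapse _ _ _.
have odG : odd (size G) by case: data.
have Es0 : size s0 = size G.
  rewrite -(sumn_blocks N odG); apply: size_blockwise => p q k.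
  by rewrite size_nseq.
have sc0 : all (scoped_tm m) s0.
  apply: all_blockwise.
  apply: on_blocks_impl (on_blocks_range bd_size 0 0 (blocks N G)) => p q k [lt_p _].
  by rewrite all_nseq /=; move: lt_p; rewrite /bd_size -/m; lia.
apply: all_blockwise.
apply: on_blocks_impl (on_blocks_range bd_size 0 0 (blocks N G)) => p q k [lt_p _].
have {lt_p} lt_p : p < m by move: lt_p; rewrite /bd_size -/m; lia.
case: k => [|k] /=; rewrite lt_p //= andbT.
apply: scoped_id_tm => //; apply: scoped_subst_ty => //; rewrite Es0 /var_ty.
by case: (ltnP q (size G)) => lt_q; [apply: all_nthP | rewrite nth_default].
Qed.

Lemma can_unit_subst :
  subst_tm sg (can_unit l G B u v s es) = can_unit l G B u v ss ees.
Proof.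
rewrite /can_unit -/N; case: ifP => // _.
have [_ _ /and3P[sB su sv] _ _] := data.
have sw : scoped_tm (size s) (if l then v else u) by rewrite Es; case: (l).
rewrite comp3_subst [subst_ty sg (Arr _ _ _)]/= id_tm_subst.
rewrite associator_subst cancellator_subst unitor_subst unitor_src_subst.
rewrite cancellator_src_subst.
have -> : subst_tm sg
    (if l then comp_tm (subst_ty s B) (subst_tm s v) (subst_tm s u) (subst_tm s v)
                 (can_inv l G B u v s es) (Coh G (Arr B u v) s)
     else comp_tm (subst_ty s B) (subst_tm s u) (subst_tm s v) (subst_tm s u)
                 (Coh G (Arr B u v) s) (can_inv l G B u v s es)) =
    (if l then comp_tm (subst_ty ss B) (subst_tm ss v) (subst_tm ss u) (subst_tm ss v)
                 (can_inv l G B u v ss ees) (Coh G (Arr B u v) ss)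
     else comp_tm (subst_ty ss B) (subst_tm ss u) (subst_tm ss v) (subst_tm ss u)
                 (Coh G (Arr B u v) ss) (can_inv l G B u v ss ees)).
  by case: (l); rewrite comp_tm_subst can_inv_subst // !subst_tm_comp ?subst_ty_comp ?Es.
by rewrite subst_ty_comp ?Es // !(subst_tm_comp _ sw).
Qed.

Lemma can_iunit_subst :
  subst_tm sg (can_iunit l G B u v s es) = can_iunit l G B u v ss ees.
Proof.
rewrite /can_iunit subst_can can_unit_subst; congr Can; case: ifP => // _.
rewrite !map_cons !subst_can associator_subst cancellator_subst unitor_subst.
by rewrite cancellator_family_subst.
Qed.

End CanSubst.

(** * The substitution lemma *)

Scheme ctx_ok_mut := Minimality for ctx_ok Sort Prop
with ty_ok_mut := Minimality for ty_ok Sort Prop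
with tm_ok_mut := Minimality for tm_ok Sort Prop
with sub_ok_mut := Minimality for sub_ok Sort Prop
with ty_eq_mut := Minimality for ty_eq Sort Prop
with tm_eq_mut := Minimality for tm_eq Sort Prop
with tms_eq_mut := Minimality for tms_eq Sort Prop.
Combined Scheme judgement_ind from
  ctx_ok_mut, ty_ok_mut, tm_ok_mut, sub_ok_mut, ty_eq_mut, tm_eq_mut, tms_eq_mut.

Lemma all_inv_at (a : pred tm) N G es :
  size es = count (fun A => tdim A == N) G ->
  (forall i, i < size G -> var_dim G i = N -> a (inv_at N G es i)) -> all a es.
Proof.
elim: G es => [|A G IH] es /=; first by move/size0nil=> ->.
rewrite /inv_at /var_dim /var_ty; case: eqP => [dimA | dimA] Ees H.
  case: es Ees H => //= e es [Ees] H.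
  have -> /= := H 0 isT dimA; apply: IH => // i lt_i dim_i.
  by have := H i.+1 lt_i dim_i; rewrite /= dimA eqxx.
apply: IH => // i lt_i dim_i.
by have := H i.+1 lt_i dim_i; rewrite /= (introF eqP dimA).
Qed.

Lemma size_disk n : size (disk n) = n.*2.+1.
Proof. by rewrite size_iter_susp_ctx addn1. Qed.

Lemma size_inv_ctx n : size (inv_ctx n) = n.*2.+2.
Proof. by rewrite size_rcons size_disk. Qed.

Lemma size_rec_ctx n T t : size (rec_ctx n T t) = n.+2.*2.+2.
Proof. by rewrite size_cat size_inv_ctx addn2. Qed.

Lemma disk_tyS n : disk_ty n.+1 = Arr (disk_ty n) (Var n.*2) (Var n.*2.+1).
Proof. by elim: n => // n IH; rewrite [LHS]iterS -/(disk_ty n.+1) {1}IH. Qed.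

Lemma tdim_disk n : tdim (disk_ty n) = n.
Proof. by elim: n => // n IH; rewrite disk_tyS /= IH. Qed.

Lemma scoped_disk_ty n : scoped_ty n.*2 (disk_ty n).
Proof. by have := @scoped_iter_susp_ty n 0 Star isT; rewrite addn0. Qed.

Lemma size_chi T t : size (chi T t) = (tdim T).*2.+1.
Proof. by rewrite size_rcons size_boundary. Qed.

Lemma size_chi_ilunit n : size (chi_ilunit n) = n.+2.*2.+2.
Proof. by rewrite size_rcons size_chi /= tdim_disk. Qed.

Lemma size_chi_irunit n : size (chi_irunit n) = n.+2.*2.+2.
Proof. by rewrite size_rcons size_chi /= tdim_disk. Qed.

Lemma scoped_chi_inv n T t e :
  scoped_ty n T -> scoped_tm n t -> scoped_tm n e -> all (scoped_tm n) (chi_inv T t e).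
Proof. by move=> sT st se; rewrite !all_rcons se st scoped_boundary. Qed.

Lemma scoped_chi_ilunit n : all (scoped_tm n.+2.*2) (chi_ilunit n).
Proof.
have sD : scoped_ty n.+2.*2 (disk_ty n).
  by apply: scoped_ty_leq (scoped_disk_ty n); lia.
apply: scoped_chi_inv => //=; try lia.
by rewrite sD scoped_comp_tm ?scoped_id_tm //=; lia.
Qed.

Lemma scoped_chi_irunit n : all (scoped_tm n.+2.*2) (chi_irunit n).
Proof.
have sD : scoped_ty n.+2.*2 (disk_ty n).
  by apply: scoped_ty_leq (scoped_disk_ty n); lia.
apply: scoped_chi_inv => //=; try lia.
by rewrite sD scoped_comp_tm ?scoped_id_tm //=; lia.
Qed.

Lemma scoped_id_sub n : all (scoped_tm n) (id_sub n).
Proof. by rewrite all_map; apply/allP => i; rewrite mem_iota. Qed.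

Lemma size_rec_unfold n r : size (rec_unfold n r) = n.+2.*2.+2.
Proof. by rewrite size_cat size_id_sub size_inv_ctx addn2. Qed.

Lemma scoped_rec_unfold n r :
  scoped_tm n.+2.*2 r -> all (scoped_tm n.+2.*2) (rec_unfold n r).
Proof.
move=> /scoped_susp_tm sr; rewrite all_cat size_inv_ctx scoped_id_sub /=.
by rewrite !scoped_subst_tm ?size_chi_ilunit ?size_chi_irunit
  ?scoped_chi_ilunit ?scoped_chi_irunit.
Qed.

Lemma scoped_lcancel n A u v t l :
  scoped_ty n (Arr A u v) -> scoped_tm n t -> scoped_tm n l ->
  scoped_ty n (lcancel_ty A u v t l).
Proof.
move=> /= /and3P[sA su sv] st sl.
by rewrite /= sA sv scoped_comp_tm ?scoped_id_tm //= sv sl su st.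
Qed.

Lemma scoped_rcancel n A u v t r :
  scoped_ty n (Arr A u v) -> scoped_tm n t -> scoped_tm n r ->
  scoped_ty n (rcancel_ty A u v t r).
Proof.
move=> /= /and3P[sA su sv] st sr.
by rewrite /= sA su scoped_comp_tm ?scoped_id_tm //= su st sv sr.
Qed.

Lemma judgement_scoped :
  (forall G, ctx_ok G -> all (scoped_ty (size G)) G) /\
  (forall G A, ty_ok G A -> ctx_ok G /\ scoped_ty (size G) A) /\
  (forall G t A, tm_ok G t A ->
     [/\ ctx_ok G, scoped_tm (size G) t & scoped_ty (size G) A]) /\
  (forall D s G, sub_ok D s G ->
     [/\ ctx_ok D, size s = size G & all (scoped_tm (size D)) s]) /\
  (forall G A B, ty_eq G A B -> True) /\
  (forall G t u, tm_eq G t u -> True) /\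
  (forall G s s', tms_eq G s s' -> True).
Proof.
apply: judgement_ind => //.
- move=> G A _ sG _ [_ sA]; rewrite size_rcons all_rcons (scoped_ty_leq _ sA) //=.
  by apply: sub_all sG => B; apply: scoped_ty_leq.
- by move=> G A u v _ _ [cG su sA] _ [_ sv _]; split=> //=; rewrite sA su sv.
- by move=> G A u v t _ [cG st sT]; split=> //=; rewrite -/(scoped_ty _ (Arr A u v)) sT.
- by move=> G t A B _ [cG st _] _ [_ sB].
- by move=> G i cG sG lt_i; split=> //; apply: all_nthP.
- move=> D G A s _ _ [_ sA] _ _ [cD Es ss]; split=> //.
  by apply: scoped_subst_ty => //; rewrite Es.
- move=> D G A s es _ [cD ss sA] Ees _ H; move: ss => /= ss.
  split=> //=; rewrite ss /= ?sA //.
  by apply: all_inv_at Ees _ => i lt_i dim_i; case: (H i lt_i dim_i).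
- move=> G A x y t tl tr tlu tru tilu tiru _ [cG st sT] _ [_ stl _] _ [_ str _].
  move=> _ [_ stlu _] _ [_ stru _] _ [_ stilu _] _ [_ stiru _].
  by split=> //; rewrite /= ?st ?stl ?str ?stlu ?stru ?stilu //; move: sT => /= ->.
- move=> G n A x y t tl tr tlu tru tilu tiru s E E' _ [_ st sT] _ _ _ _ _ _ _ _.
  move=> _ _ _ _ _ [cG Es ss]; split=> //=.
  apply/andP; split; last by apply: scoped_subst_tm; rewrite ?Es.
  by apply: (@scoped_subst_ty _ s (Arr A x y)); rewrite ?Es.
- move=> G A u v t e _ [cG st /= /and3P[sA su sv]] _ [_ se _].
  by split=> //=; rewrite sA su sv.
- move=> G A u v t e _ [cG st /= /and3P[sA su sv]] _ [_ se _].
  by split=> //=; rewrite sA su sv.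
- by move=> G A u v t e _ [cG st sT] _ [_ se _]; split; rewrite ?scoped_lcancel.
- by move=> G A u v t e _ [cG st sT] _ [_ se _]; split; rewrite ?scoped_rcancel.
- move=> G A u v t e _ [cG st sT] _ [_ se _]; split=> //.
  by apply/andP; split; first apply: scoped_lcancel.
- move=> G A u v t e _ [cG st sT] _ [_ se _]; split=> //.
  by apply/andP; split; first apply: scoped_rcancel.
- by move=> D s t G A _ [cD Es ss] _ _ _ [_ st _]; rewrite !size_rcons Es all_rcons st.
Qed.

Lemma ctx_scoped G : ctx_ok G -> all (scoped_ty (size G)) G.
Proof. by case: judgement_scoped => H _; apply: H. Qed.

Lemma ty_scoped G A : ty_ok G A -> scoped_ty (size G) A.
Proof. by case: judgement_scoped => _ [H _] /H[]. Qed.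

Lemma tm_scoped G t A : tm_ok G t A -> scoped_tm (size G) t.
Proof. by case: judgement_scoped => _ [_ [H _]] /H[]. Qed.

Lemma tm_ty_scoped G t A : tm_ok G t A -> scoped_ty (size G) A.
Proof. by case: judgement_scoped => _ [_ [H _]] /H[]. Qed.

Lemma sub_size D s G : sub_ok D s G -> size s = size G.
Proof. by case: judgement_scoped => _ [_ [_ [H _]]] /H[]. Qed.

Lemma ty_ctx G A : ty_ok G A -> ctx_ok G.
Proof. by case: judgement_scoped => _ [H _] /H[]. Qed.

Lemma tm_ctx G t A : tm_ok G t A -> ctx_ok G.
Proof. by case: judgement_scoped => _ [_ [H _]] /H[]. Qed.

Lemma sub_ctx D s G : sub_ok D s G -> ctx_ok D.
Proof. by case: judgement_scoped => _ [_ [_ [H _]]] /H[]. Qed.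

Lemma coh_inversion D G A s T :
  tm_ok D (Coh G A s) T -> [/\ is_ps G, ty_ok G A, full G A & sub_ok D s G].
Proof.
move E: (Coh G A s) => t ok_t; elim: ok_t E => //.
by move=> D' G' A' s' ps_G ok_A fullA ok_s [-> -> ->].
Qed.

Lemma can_inversion D G A s es T :
  tm_ok D (Can (Coh G A s) es) T ->
  [/\ is_ps G, ty_ok G A, full G A, sub_ok D s G
    & size es = count (fun B => tdim B == tdim A) G].
Proof.
move E: (Can _ es) => t ok_t; elim: ok_t E => //.
move=> D' G' A' s' es' /coh_inversion[ps_G ok_A fullA ok_s] _ Ees _ _.
by case=> -> -> -> ->.
Qed.

Lemma rec_inversion G t tl tr tlu tru tilu tiru s T :
  tm_ok G (Rec t tl tr tlu tru tilu tiru s) T ->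
  exists n : nat, [/\ size s = n.+2.*2,
    [&& scoped_tm n.+2.*2 t, scoped_tm n.+2.*2 tl, scoped_tm n.+2.*2 tr,
        scoped_tm n.+2.*2 tlu & scoped_tm n.+2.*2 tru],
    scoped_tm n.+2.*2.+2 tilu & scoped_tm n.+2.*2.+2 tiru].
Proof.
move E: (Rec _ _ _ _ _ _ _ s) => r ok_r; elim: ok_r E => //.
move=> G' n A x y t' tl' tr' tlu' tru' tilu' tiru' s' E E'.
move=> /tm_scoped st _ /tm_scoped stl _ /tm_scoped str _ /tm_scoped stlu _.
move=> /tm_scoped stru _ /tm_scoped stilu _ /tm_scoped stiru _ /sub_size Es.
case=> -> -> -> -> -> -> -> ->; exists n.
move: st stl str stlu stru stilu stiru Es.
by rewrite /E /E' size_inv_ctx size_rec_ctx => -> -> -> -> -> -> ->.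
Qed.

Lemma ps_odd G : is_ps G -> odd (size G).
Proof.
by case=> x; elim=> // {x}G x A _; rewrite size_cat oddD => ->.
Qed.

Lemma can_ok_data D G B u v s es T :
  tm_ok D (Can (Coh G (Arr B u v) s) es) T -> can_data G B u v s es.
Proof.
move=> /can_inversion[/ps_odd odG ok_A _ /sub_size Es Ees]; split=> //.
  exact: ctx_scoped (ty_ctx ok_A).
exact: ty_scoped ok_A.
Qed.

Lemma sub_ok_nth D s G i :
  sub_ok D s G -> i < size G ->
  tm_ok D (nth (Var i) s i) (subst_ty s (var_ty G i)).
Proof.
elim=> // {}D {}s t {}G A ok_s IH ok_A ok_t.
have Es := sub_size ok_s; rewrite size_rcons ltnS leq_eqVlt => lt_i.
have E B : scoped_ty (size G) B -> subst_ty (rcons s t) B = subst_ty s B.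
  by move=> sB; rewrite -cats1 subst_ty_cat ?Es.
rewrite /var_ty !nth_rcons Es; case/predU1P: lt_i => [-> | lt_i].
  by rewrite ltnn eqxx E // (ty_scoped ok_A).
rewrite lt_i E; first exact: IH.
by have /all_nthP := ctx_scoped (ty_ctx ok_A); apply.
Qed.

Lemma subst_inv s T t : subst_ty s (Inv T t) = Inv (subst_ty s T) (subst_tm s t).
Proof. by []. Qed.

(** By induction on derivations.  Only two families of rules are not stable at
    sight: the computation rules of [Can], whose right-hand sides are functions of
    the raw term, and those of [Rec], where two substitutions have to be composed. *)
Lemma substitution :
  (forall G, ctx_ok G -> True) /\
  (forall G A, ty_ok G A -> forall D s, sub_ok D s G -> ty_ok D (subst_ty s A)) /\
  (forall G t A, tm_ok G t A ->
     forall D s, sub_ok D s G -> tm_ok D (subst_tm s t) (subst_ty s A)) /\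
  (forall H d G, sub_ok H d G -> forall D s, sub_ok D s H -> sub_ok D (comp_sub d s) G) /\
  (forall G A B, ty_eq G A B ->
     forall D s, sub_ok D s G -> ty_eq D (subst_ty s A) (subst_ty s B)) /\
  (forall G t u, tm_eq G t u ->
     forall D s, sub_ok D s G -> tm_eq D (subst_tm s t) (subst_tm s u)) /\
  (forall G d d', tms_eq G d d' ->
     forall D s, sub_ok D s G -> tms_eq D (comp_sub d s) (comp_sub d' s)).
Proof.
apply: judgement_ind => //.
- by move=> G _ _ D s /sub_ctx cD; apply: ty_star.
- by move=> G A u v cA _ IHu _ IHv D s ok_s; apply: ty_arr; [case: A cA {IHu IHv} | |]; auto.
- by move=> G A u v t _ IH D s ok_s; apply: ty_inv; apply: IH.
- by move=> G t A B _ IHt _ IHB _ IHe D s ok_s; apply: ok_conv (IHt _ _ ok_s) _ _; auto.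
- by move=> G i cG _ lt_i D s ok_s; apply: sub_ok_nth.
- move=> H G A d ps_G ok_A _ fullA ok_d IHd D s ok_s.
  rewrite subst_ty_comp ?(sub_size ok_d) ?(ty_scoped ok_A) //.
  by apply: ok_coh => //; apply: IHd.
- move=> H G A d es ok_c IHc Ees _ IHes D s ok_s.
  have [_ ok_A _ ok_d] := coh_inversion ok_c; have Ed := sub_size ok_d.
  have sA := ty_scoped ok_A; rewrite /= -/subst_tm.
  have := IHc _ _ ok_s; rewrite /= subst_ty_comp ?Ed // => ok_c'.
  apply: ok_can => //; first by rewrite size_map.
  move=> i lt_i dim_i; rewrite inv_at_subst //; have /= := IHes i lt_i dim_i D s ok_s.
  rewrite (nth_map (Var i)) ?Ed // subst_ty_comp // Ed.
  by have /all_nthP := ctx_scoped (ty_ctx ok_A); apply.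
- move=> G A x y t tl tr tlu tru tilu tiru _ H1 _ H2 _ H3 _ H4 _ H5 _ H6 _ H7 D s ok_s.
  have := H7 _ _ ok_s; have := H6 _ _ ok_s; have := H5 _ _ ok_s; have := H4 _ _ ok_s.
  by rewrite !subst_inv lcancel_subst rcancel_subst; apply: ok_coind; auto.
- move=> H n A x y t tl tr tlu tru tilu tiru d E E' ok_t _ ok_tl _ ok_tr _.
  move=> ok_tlu _ ok_tru _ ok_tilu _ ok_tiru _ ok_d IHd D s ok_s.
  have Ed := sub_size ok_d.
  rewrite subst_inv subst_ty_comp ?Ed ?(tm_ty_scoped ok_t) //.
  rewrite subst_tm_comp ?Ed ?(tm_scoped ok_t) //.
  by apply: (ok_rec (n := n)) => //; apply: IHd.
- by move=> G A u v t e _ IHt _ IHe D s ok_s; apply: ok_linv (IHt _ _ ok_s) (IHe _ _ ok_s).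
- by move=> G A u v t e _ IHt _ IHe D s ok_s; apply: ok_rinv (IHt _ _ ok_s) (IHe _ _ ok_s).
- move=> G A u v t e _ IHt _ IHe D s ok_s; rewrite lcancel_subst.
  exact: ok_lunit (IHt _ _ ok_s) (IHe _ _ ok_s).
- move=> G A u v t e _ IHt _ IHe D s ok_s; rewrite rcancel_subst.
  exact: ok_runit (IHt _ _ ok_s) (IHe _ _ ok_s).
- move=> G A u v t e _ IHt _ IHe D s ok_s; rewrite subst_inv lcancel_subst.
  exact: ok_ilunit (IHt _ _ ok_s) (IHe _ _ ok_s).
- move=> G A u v t e _ IHt _ IHe D s ok_s; rewrite subst_inv rcancel_subst.
  exact: ok_irunit (IHt _ _ ok_s) (IHe _ _ ok_s).
- by move=> D _ _ D' s /sub_ctx; apply: sub_nil.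
- move=> H d t G A ok_d IHd ok_A _ _ IHt D s ok_s; rewrite /comp_sub map_rcons.
  have sA := ty_scoped ok_A; apply: (sub_rcons (IHd _ _ ok_s) ok_A).
  by rewrite -subst_ty_comp ?(sub_size ok_d) //; apply: IHt.
- by move=> *; apply: ty_eq_refl.
- by move=> G A B _ IH D s ok_s; apply: ty_eq_sym (IH _ _ ok_s).
- by move=> G A B C _ IH1 _ IH2 D s ok_s; apply: ty_eq_trans (IH1 _ _ ok_s) (IH2 _ _ ok_s).
- by move=> G A A' u u' v v' _ IH1 _ IH2 _ IH3 D s ok_s; apply: ty_eq_arr; auto.
- by move=> G T T' t t' _ IH1 _ IH2 D s ok_s; apply: ty_eq_inv; auto.
- by move=> *; apply: tm_eq_refl.
- by move=> G t u _ IH D s ok_s; apply: tm_eq_sym (IH _ _ ok_s).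
- by move=> G t u v _ IH1 _ IH2 D s ok_s; apply: tm_eq_trans (IH1 _ _ ok_s) (IH2 _ _ ok_s).
- by move=> H G A A' d d' eqA _ _ IH D s ok_s; apply: tm_eq_coh eqA (IH _ _ ok_s).
- by move=> G t t' es es' _ IH _ IHs D s ok_s; apply: tm_eq_can; [apply: IH | apply: IHs].
- by move=> G t t' tl tl' tr tr' tlu tlu' tru tru' tilu tilu' tiru tiru'
    _ H1 _ H2 _ H3 _ H4 _ H5 _ H6 _ H7 D s ok_s; apply: tm_eq_coind; auto.
- move=> G n T t t' tl tl' tr tr' tlu tlu' tru tru' tilu tilu' tiru tiru' d d' E E'.
  move=> ok_t _ e1 _ e2 _ e3 _ e4 _ e5 _ e6 _ e7 _ _ IH D s ok_s.
  by apply: (tm_eq_rec (n := n) ok_t) => //; apply: IH.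
- by move=> G e e' _ IH D s ok_s; apply: tm_eq_linv (IH _ _ ok_s).
- by move=> G e e' _ IH D s ok_s; apply: tm_eq_rinv (IH _ _ ok_s).
- by move=> G e e' _ IH D s ok_s; apply: tm_eq_lunit (IH _ _ ok_s).
- by move=> G e e' _ IH D s ok_s; apply: tm_eq_runit (IH _ _ ok_s).
- by move=> G e e' _ IH D s ok_s; apply: tm_eq_ilunit (IH _ _ ok_s).
- by move=> G e e' _ IH D s ok_s; apply: tm_eq_irunit (IH _ _ ok_s).
- by move=> G t tl tr tlu tru tilu tiru T e _ IH D s ok_s; apply: coind_linv (IH _ _ ok_s).
- by move=> G t tl tr tlu tru tilu tiru T e _ IH D s ok_s; apply: coind_rinv (IH _ _ ok_s).
- by move=> G t tl tr tlu tru tilu tiru T e _ IH D s ok_s; apply: coind_lunit (IH _ _ ok_s).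
- by move=> G t tl tr tlu tru tilu tiru T e _ IH D s ok_s; apply: coind_runit (IH _ _ ok_s).
- by move=> G t tl tr tlu tru tilu tiru T e _ IH D s ok_s; apply: coind_ilunit (IH _ _ ok_s).
- by move=> G t tl tr tlu tru tilu tiru T e _ IH D s ok_s; apply: coind_irunit (IH _ _ ok_s).
- move=> G A u v t e _ IHt _ IHe D s ok_s.
  exact: coind_eta (IHt _ _ ok_s) (IHe _ _ ok_s).
- move=> H G B u v d es T e ok_e IH D s ok_s.
  rewrite (can_inv_subst _ _ (can_ok_data ok_e)).
  exact: can_linv (IH _ _ ok_s).
- move=> H G B u v d es T e ok_e IH D s ok_s.
  rewrite (can_inv_subst _ _ (can_ok_data ok_e)).
  exact: can_rinv (IH _ _ ok_s).
- move=> H G B u v d es T e ok_e IH D s ok_s.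
  rewrite (can_unit_subst _ _ (can_ok_data ok_e)).
  exact: can_lunit (IH _ _ ok_s).
- move=> H G B u v d es T e ok_e IH D s ok_s.
  rewrite (can_unit_subst _ _ (can_ok_data ok_e)).
  exact: can_runit (IH _ _ ok_s).
- move=> H G B u v d es T e ok_e IH D s ok_s.
  rewrite (can_iunit_subst _ _ (can_ok_data ok_e)).
  exact: can_ilunit (IH _ _ ok_s).
- move=> H G B u v d es T e ok_e IH D s ok_s.
  rewrite (can_iunit_subst _ _ (can_ok_data ok_e)).
  exact: can_irunit (IH _ _ ok_s).
- move=> H t tl tr tlu tru tilu tiru d T e ok_e IH D s ok_s.
  have [n [Ed /and5P[_ stl _ _ _] _ _]] := rec_inversion ok_e.
  by rewrite subst_tm_comp ?Ed //; apply: rec_linv (IH _ _ ok_s).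
- move=> H t tl tr tlu tru tilu tiru d T e ok_e IH D s ok_s.
  have [n [Ed /and5P[_ _ str _ _] _ _]] := rec_inversion ok_e.
  by rewrite subst_tm_comp ?Ed //; apply: rec_rinv (IH _ _ ok_s).
- move=> H t tl tr tlu tru tilu tiru d T e ok_e IH D s ok_s.
  have [n [Ed /and5P[_ _ _ stlu _] _ _]] := rec_inversion ok_e.
  by rewrite subst_tm_comp ?Ed //; apply: rec_lunit (IH _ _ ok_s).
- move=> H t tl tr tlu tru tilu tiru d T e ok_e IH D s ok_s.
  have [n [Ed /and5P[_ _ _ _ stru] _ _]] := rec_inversion ok_e.
  by rewrite subst_tm_comp ?Ed //; apply: rec_runit (IH _ _ ok_s).
- move=> H n t tl tr tlu tru tilu tiru d T e r ok_e IH ok_d IHd D s ok_s.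
  have [m [Ed _ stilu _]] := rec_inversion ok_e.
  have Emn : m = n by have := sub_size ok_d; rewrite Ed size_inv_ctx; lia.
  subst m.
  rewrite subst_tm_comp ?size_comp_sub ?size_rec_unfold //.
  rewrite comp_subA; last first.
    rewrite Ed; apply: scoped_rec_unfold.
    by have := scoped_id_sub (size (inv_ctx n.+1)); rewrite {1}size_inv_ctx.
  exact: rec_ilunit (IH _ _ ok_s) (IHd _ _ ok_s).
- move=> H n t tl tr tlu tru tilu tiru d T e r ok_e IH ok_d IHd D s ok_s.
  have [m [Ed _ _ stiru]] := rec_inversion ok_e.
  have Emn : m = n by have := sub_size ok_d; rewrite Ed size_inv_ctx; lia.
  subst m.
  rewrite subst_tm_comp ?size_comp_sub ?size_rec_unfold //.
  rewrite comp_subA; last first.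
    rewrite Ed; apply: scoped_rec_unfold.
    by have := scoped_id_sub (size (inv_ctx n.+1)); rewrite {1}size_inv_ctx.
  exact: rec_irunit (IH _ _ ok_s) (IHd _ _ ok_s).
- by move=> *; apply: tms_eq_nil.
- move=> G t t' d d' _ IH _ IHd D s ok_s.
  by apply: tms_eq_cons; [apply: IH | apply: IHd].
Qed.

Lemma subst_ty_ok D s G A : sub_ok D s G -> ty_ok G A -> ty_ok D (subst_ty s A).
Proof. by move=> ok_s ok_A; case: substitution => _ [H _]; apply: H ok_s. Qed.

Lemma subst_tm_ok D s G t A :
  sub_ok D s G -> tm_ok G t A -> tm_ok D (subst_tm s t) (subst_ty s A).
Proof. by move=> ok_s ok_t; case: substitution => _ [_ [H _]]; apply: H ok_s. Qed.

Lemma id_sub_ok G H : ctx_ok (G ++ H) -> ctx_ok G -> sub_ok (G ++ H) (id_sub (size G)) G.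
Proof.
move=> cGH cG; elim: cG H cGH => [|{}G A cG IH ok_A] H cGH; first exact: sub_nil.
rewrite size_rcons /id_sub -addn1 iotaD map_cat cats1; apply: sub_rcons => //.
  by move: cGH; rewrite cat_rcons; apply: IH.
rewrite -/(id_sub _) subst_ty_id add0n.
have := @ok_var (rcons G A ++ H) (size G) cGH.
rewrite /var_ty cat_rcons nth_cat ltnn subnn; apply.
by rewrite size_cat /=; lia.
Qed.

Lemma tm_weaken G H t A : ctx_ok (G ++ H) -> tm_ok G t A -> tm_ok (G ++ H) t A.
Proof.
move=> cGH ok_t; rewrite -(subst_tm_id (size G) t) -(subst_ty_id (size G) A).
by apply: subst_tm_ok (ok_t); apply: id_sub_ok (tm_ctx ok_t).
Qed.

Lemma ty_weaken G H A : ctx_ok (G ++ H) -> ty_ok G A -> ty_ok (G ++ H) A.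
Proof.
move=> cGH ok_A; rewrite -(subst_ty_id (size G) A).
by apply: subst_ty_ok (ok_A); apply: id_sub_ok (ty_ctx ok_A).
Qed.

(** * Coherences and their suspensions *)

(** The fragment without conversion, invertibility types or their terms.  In the
    absence of computation rules suspension preserves derivability by a direct
    induction, and every coherence used below belongs to this fragment. *)
Inductive catt_ctx : ctx -> Prop :=
| catt_nil : catt_ctx [::]
| catt_rcons G A : catt_ctx G -> catt_ty G A -> catt_ctx (rcons G A)

with catt_ty : ctx -> ty -> Prop :=
| catt_star G : catt_ctx G -> catt_ty G Star
| catt_arr G A u v : catt_tm G u A -> catt_tm G v A -> catt_ty G (Arr A u v)

with catt_tm : ctx -> tm -> ty -> Prop :=
| catt_var G i : catt_ctx G -> i < size G -> catt_tm G (Var i) (var_ty G i)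
| catt_coh D G A s :
    is_ps G -> catt_ty G A -> full G A -> catt_sub D s G ->
    catt_tm D (Coh G A s) (subst_ty s A)

with catt_sub : ctx -> sub -> ctx -> Prop :=
| catt_sub_nil D : catt_ctx D -> catt_sub D [::] [::]
| catt_sub_rcons D s t G A :
    catt_sub D s G -> catt_ty G A -> catt_tm D t (subst_ty s A) ->
    catt_sub D (rcons s t) (rcons G A).

Scheme catt_ctx_mut := Minimality for catt_ctx Sort Prop
with catt_ty_mut := Minimality for catt_ty Sort Prop
with catt_tm_mut := Minimality for catt_tm Sort Prop
with catt_sub_mut := Minimality for catt_sub Sort Prop.
Combined Scheme catt_ind from catt_ctx_mut, catt_ty_mut, catt_tm_mut, catt_sub_mut.

Fixpoint inv_free (A : ty) : bool :=
  match A with Star => true | Arr A _ _ => inv_free A | Inv _ _ => false end.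

Lemma inv_free_cell A : inv_free A -> cell_ty A.
Proof. by case: A. Qed.

Lemma inv_free_subst s A : inv_free (subst_ty s A) = inv_free A.
Proof. by elim: A. Qed.

Lemma tdim_susp A : inv_free A -> tdim (susp_ty A) = (tdim A).+1.
Proof. by elim: A => //= A IH u v /IH ->. Qed.

Lemma inv_free_iter_susp n A : inv_free A -> inv_free (iter n susp_ty A).
Proof.
have inv_free_susp B : inv_free B -> inv_free (susp_ty B) by elim: B.
by move=> fA; elim: n => //= n; apply: inv_free_susp.
Qed.

Lemma tdim_iter_susp n A : inv_free A -> tdim (iter n susp_ty A) = n + tdim A.
Proof.
by move=> fA; elim: n => // n IH; rewrite iterS tdim_susp ?inv_free_iter_susp ?IH.
Qed.

Lemma catt_inv_free :
  (forall G, catt_ctx G -> all inv_free G) /\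
  (forall G A, catt_ty G A -> inv_free A) /\
  (forall G t A, catt_tm G t A -> inv_free A) /\
  (forall D s G, catt_sub D s G -> True).
Proof.
apply: catt_ind => //.
- by move=> G A _ fG _ fA; rewrite all_rcons fA.
- by move=> G i _ fG lt_i; apply: all_nthP.
- by move=> D G A s _ _ fA _ _ _; rewrite inv_free_subst.
Qed.

Lemma catt_ctx_inv_free G : catt_ctx G -> all inv_free G.
Proof. by case: catt_inv_free => H _; apply: H. Qed.

Lemma catt_ty_inv_free G A : catt_ty G A -> inv_free A.
Proof. by case: catt_inv_free => _ [H _]; apply: H. Qed.

Lemma catt_tm_inv_free G t A : catt_tm G t A -> inv_free A.
Proof. by case: catt_inv_free => _ [_ [H _]]; apply: H. Qed.

Lemma catt_embedding :
  (forall G, catt_ctx G -> ctx_ok G) /\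
  (forall G A, catt_ty G A -> ty_ok G A) /\
  (forall G t A, catt_tm G t A -> tm_ok G t A) /\
  (forall D s G, catt_sub D s G -> sub_ok D s G).
Proof.
apply: catt_ind => //.
- exact: ctx_nil.
- by move=> G A _ cG _; apply: ctx_rcons.
- by move=> G _; apply: ty_star.
- by move=> G A u v /catt_tm_inv_free/inv_free_cell cA ok_u _; apply: ty_arr.
- by move=> G i _; apply: ok_var.
- by move=> D G A s ps_G _ ok_A fullA _; apply: ok_coh.
- by move=> D _; apply: sub_nil.
- by move=> D s t G A _ ok_s _ ok_A _; apply: sub_rcons.
Qed.

Lemma catt_ctx_ok G : catt_ctx G -> ctx_ok G.
Proof. by case: catt_embedding => H _; apply: H. Qed.

Lemma catt_ty_ok G A : catt_ty G A -> ty_ok G A.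
Proof. by case: catt_embedding => _ [H _]; apply: H. Qed.

Lemma catt_tm_ok G t A : catt_tm G t A -> tm_ok G t A.
Proof. by case: catt_embedding => _ [_ [H _]]; apply: H. Qed.

Lemma catt_weakening :
  (forall G, catt_ctx G -> True) /\
  (forall G A, catt_ty G A -> forall H, catt_ctx (G ++ H) -> catt_ty (G ++ H) A) /\
  (forall G t A, catt_tm G t A -> forall H, catt_ctx (G ++ H) -> catt_tm (G ++ H) t A) /\
  (forall D s G, catt_sub D s G -> forall H, catt_ctx (D ++ H) -> catt_sub (D ++ H) s G).
Proof.
apply: catt_ind => //.
- by move=> G _ _ H; apply: catt_star.
- by move=> G A u v _ IHu _ IHv H cGH; apply: catt_arr; [apply: IHu | apply: IHv].
- move=> G i _ _ lt_i H cGH; have -> : var_ty G i = var_ty (G ++ H) i.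
    by rewrite /var_ty nth_cat lt_i.
  by apply: catt_var => //; rewrite size_cat ltn_addr.
- by move=> D G A s ps_G ok_A _ fullA _ IHs H cH; apply: catt_coh => //; apply: IHs.
- by move=> D _ _ H; apply: catt_sub_nil.
- move=> D s t G A _ IHs ok_A _ _ IHt H cH.
  by apply: catt_sub_rcons => //; [apply: IHs | apply: IHt].
Qed.

Lemma catt_ty_weaken G H A : catt_ctx (G ++ H) -> catt_ty G A -> catt_ty (G ++ H) A.
Proof. by move=> cGH ok_A; case: catt_weakening => _ [W _]; apply: W. Qed.

Lemma catt_id_sub G H :
  catt_ctx (G ++ H) -> catt_ctx G -> catt_sub (G ++ H) (id_sub (size G)) G.
Proof.
move=> cGH cG; elim: cG H cGH => [|{}G A cG IH ok_A] H cGH; first exact: catt_sub_nil.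
rewrite size_rcons /id_sub -addn1 iotaD map_cat cats1; apply: catt_sub_rcons => //.
  by move: cGH; rewrite cat_rcons; apply: IH.
rewrite -/(id_sub _) subst_ty_id add0n.
have := @catt_var (rcons G A ++ H) (size G) cGH.
rewrite /var_ty cat_rcons nth_cat ltnn subnn; apply.
by rewrite size_cat /=; lia.
Qed.

(** ** Pasting diagrams *)

Lemma catt_ctx_nth G i : catt_ctx G -> i < size G -> catt_ty G (var_ty G i).
Proof.
move=> cG; elim: cG i => // {}G A cG IH ok_A i; rewrite size_rcons ltnS => le_i.
rewrite /var_ty nth_rcons -cats1; apply: catt_ty_weaken.
  by rewrite cats1; apply: catt_rcons.
by case: ltngtP le_i => // lt_i _; apply: IH.
Qed.

Lemma catt_var_ty G i A : catt_ctx G -> i < size G -> var_ty G i = A -> catt_tm G (Var i) A.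
Proof. by move=> cG lt_i <-; apply: catt_var. Qed.

Lemma ps_at_ok G x A :
  ps_at G x A -> [/\ catt_ctx G, x < size G & var_ty G x = A].
Proof.
elim=> [|{}G f {}A {}x y _ [cG lt_f Ef]|{}G {}x {}A _ [cG lt_x Ex]].
- by split=> //; apply: (catt_rcons (G := [::])); do !constructor.
- have := catt_ctx_nth cG lt_f; rewrite Ef => ok_T.
  inversion ok_T as [|? ? ? ? ok_x ok_y]; subst.
  by inversion ok_y; subst.
have ok_A : catt_ty G A by rewrite -Ex; apply: catt_ctx_nth.
have cGA : catt_ctx (rcons G A) by apply: catt_rcons.
rewrite -cat_rcons cats1 !size_rcons /var_ty nth_rcons size_rcons ltnn eqxx; split=> //.
apply: catt_rcons => //; apply: catt_arr; apply: catt_var_ty; rewrite ?size_rcons //.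
- exact: leqW.
- by rewrite /var_ty nth_rcons lt_x.
- by rewrite /var_ty nth_rcons ltnn eqxx.
Qed.

Lemma ps_ctx G : is_ps G -> catt_ctx G.
Proof. by case=> x /ps_at_ok[]. Qed.

Lemma ps_grow G x A :
  ps_at G x A -> ps_at (G ++ [:: A; Arr A (Var x) (Var (size G))]) (size G) A.
Proof. by move/ps_extend; apply: ps_down. Qed.

(** ** Suspension *)

Lemma ps_susp G : is_ps G -> is_ps (susp_ctx G).
Proof.
have H x A : ps_at G x A -> ps_at (susp_ctx G) x.+2 (susp_ty A).
  elim=> [|{}G f {}A {}x y _ IH|{}G {}x {}A _ IH].
  - exact: (ps_extend ps_point).
  - exact: ps_down IH.
  by have := ps_extend IH; rewrite /susp_ctx map_cat /= size_map.
by case=> x /H ps_x; exists 1; apply: ps_down ps_x.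
Qed.

Lemma occurs_susp_tm i t : occurs_tm i.+2 (susp_tm t) = occurs_tm i t.
Proof.
have H s : every (fun t => occurs_tm i.+2 (susp_tm t) = occurs_tm i t) s ->
    has (occurs_tm i.+2) (map susp_tm s) = has (occurs_tm i) s.
  by elim: s => //= t' s IH [-> /IH ->].
elim/tm_nested_ind: t => //=.
- by move=> t es -> /H ->.
- by move=> t tl tr tlu tru tilu tiru -> -> -> -> -> -> ->.
Qed.

Lemma occurs_susp_ty i A : occurs_ty i.+2 (susp_ty A) = occurs_ty i A.
Proof. by elim: A => //= [A -> u v | T -> t]; rewrite !occurs_susp_tm. Qed.

Lemma occurs_susp_pole i A : i < 2 -> occurs_ty i (susp_ty A).
Proof.
move=> lt_i; elim: A => //= [|A -> //|T -> //].
by case: i lt_i => [|[|]].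
Qed.

Lemma source_susp G i : source_var (susp_ctx G) i.+2 = source_var G i.
Proof.
rewrite /source_var /= has_map; congr (~~ _); apply: eq_has => -[|A u []|] //=.
Qed.

Lemma target_susp G i : target_var (susp_ctx G) i.+2 = target_var G i.
Proof.
rewrite /target_var /= has_map; congr (~~ _); apply: eq_has => -[|A [] v|] //=.
Qed.

Lemma ctx_dim_susp G :
  all inv_free G -> 0 < size G -> ctx_dim (susp_ctx G) = (ctx_dim G).+1.
Proof.
case: G => // A G; rewrite /ctx_dim /= !max0n => + _.
elim: G A => [|B G IH] A /= /andP[fA fG]; first by rewrite tdim_susp // !maxn0.
by rewrite (IH _ fG) tdim_susp // maxnSS.
Qed.

(** Both conditions of fullness survive, because every suspended type mentions
    the two new points. *)
Lemma full_susp G T :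
  catt_ctx G -> catt_ty G T -> full G T -> full (susp_ctx G) (susp_ty T).
Proof.
move=> cG; case: T => // A u v ok_T fullT.
have fG := catt_ctx_inv_free cG; have fA : inv_free A := catt_ty_inv_free ok_T.
have pole i t : i < 2 -> uses i t (susp_ty A).
  by move=> lt_i; rewrite /uses occurs_susp_pole ?orbT.
have Euses i t : uses i.+2 (susp_tm t) (susp_ty A) = uses i t A.
  by rewrite /uses occurs_susp_tm occurs_susp_ty.
have iota2 (p q : pred nat) n : (forall i, i < n -> q i -> p i.+2) ->
    p 0 -> p 1 -> all q (iota 0 n) -> all p (iota 0 n.+2).
  move=> qp p0 p1 /allP Hq; rewrite /= p0 p1 /= (iotaDl 2 0) all_map.
  by apply/allP => i i_n; apply: qp (Hq _ i_n); move: i_n; rewrite mem_iota.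
have ES : size (susp_ctx G) = (size G).+2 by rewrite /= size_map.
move: fullT; rewrite /full [susp_ty (Arr _ _ _)]/= ES; case/orP=> [all_used|].
  apply/orP; left; apply: iota2 all_used; rewrite ?pole // => i _.
  by rewrite !Euses.
case/and3P=> [/eqP dimA src tgt]; apply/orP; right.
have G_gt0 : 0 < size G by case: (G) dimA.
have Edim i : i < size G ->
    (var_dim (susp_ctx G) i.+2 < (ctx_dim G).+1) = (var_dim G i < ctx_dim G).
  move=> lt_i; rewrite /var_dim /var_ty /= (nth_map Star) // tdim_susp ?ltnS //.
  exact: all_nthP.
rewrite tdim_susp // ctx_dim_susp // dimA eqxx /=; apply/andP; split.
  apply: iota2 src; rewrite ?pole ?implybT // => i lt_i.
  by rewrite source_susp Edim // Euses.
apply: iota2 tgt; rewrite ?pole ?implybT // => i lt_i.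
by rewrite target_susp Edim // Euses.
Qed.

Lemma catt_suspension :
  (forall G, catt_ctx G -> catt_ctx (susp_ctx G)) /\
  (forall G A, catt_ty G A -> catt_ty (susp_ctx G) (susp_ty A)) /\
  (forall G t A, catt_tm G t A -> catt_tm (susp_ctx G) (susp_tm t) (susp_ty A)) /\
  (forall D s G, catt_sub D s G -> catt_sub (susp_ctx D) (susp_sub s) (susp_ctx G)).
Proof.
have two_points : catt_ctx [:: Star; Star].
  apply: (catt_rcons (G := [:: Star])); last apply: catt_star;
    by apply: (catt_rcons (G := [::])); do !constructor.
apply: catt_ind => //.
- by move=> G A _ cG _ ok_A; rewrite /susp_ctx map_rcons -!rcons_cons; apply: catt_rcons.
- by move=> G _ cG; apply: catt_arr; apply: catt_var_ty.
- by move=> G A u v _ ok_u _ ok_v; apply: catt_arr.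
- move=> G i _ cG lt_i; apply: catt_var_ty => //=; first by rewrite size_map.
  by rewrite /var_ty /= (nth_map Star).
- move=> D G A s ps_G ok_A okS_A fullA _ ok_s.
  rewrite susp_subst_ty; apply: catt_coh => //; first exact: ps_susp.
  exact: full_susp (ps_ctx ps_G) ok_A fullA.
- move=> D _ cD; apply: (@catt_sub_rcons _ [:: Var 0] (Var 1) [:: Star]).
  + apply: (@catt_sub_rcons _ [::] (Var 0) [::]); [exact: catt_sub_nil | |].
      by do !constructor.
    exact: catt_var_ty.
  + by apply: catt_star; apply: (catt_rcons (G := [::])); do !constructor.
  + exact: catt_var_ty.
- move=> D s t G A _ ok_s _ ok_A _ ok_t.
  rewrite /susp_ctx /susp_sub !map_rcons -!rcons_cons; apply: catt_sub_rcons => //.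
  by rewrite -susp_subst_ty.
Qed.

Lemma catt_iter_ctx n G : catt_ctx G -> catt_ctx (iter n susp_ctx G).
Proof. by case: catt_suspension => S _ cG; elim: n => //= n; apply: S. Qed.

Lemma catt_iter_ty n G A :
  catt_ty G A -> catt_ty (iter n susp_ctx G) (iter n susp_ty A).
Proof. by case: catt_suspension => _ [S _] ok_A; elim: n => //= n; apply: S. Qed.

Lemma catt_iter_tm n G t A :
  catt_tm G t A -> catt_tm (iter n susp_ctx G) (iter n susp_tm t) (iter n susp_ty A).
Proof. by case: catt_suspension => _ [_ [S _]] ok_t; elim: n => //= n; apply: S. Qed.

(** * Operations over a type *)

(** [A] and the types of all its iterated sources and targets are valid.  This is
    what is needed to substitute the boundary of [A], and it follows from
    validity of [A] only through the substitution lemma: see [presupposition]. *)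
Fixpoint tower_ok (G : ctx) (A : ty) : Prop :=
  match A with
  | Star => ctx_ok G
  | Arr B u v => [/\ cell_ty B, tower_ok G B, tm_ok G u B & tm_ok G v B]
  | Inv _ _ => True
  end.

Lemma tower_inv_free G A : cell_ty A -> tower_ok G A -> inv_free A.
Proof. by elim: A => //= A IH u v _ [cA /(IH cA)]. Qed.

Lemma tower_subst D s G A : sub_ok D s G -> tower_ok G A -> tower_ok D (subst_ty s A).
Proof.
move=> ok_s; elim: A => //= [_ | A IH u v [cA /IH ok_A ok_u ok_v]].
  exact: sub_ctx ok_s.
split=> //; [by case: A cA {IH ok_A ok_u ok_v} | exact: subst_tm_ok ok_u |].
exact: subst_tm_ok ok_v.
Qed.

Definition extends (G G' : ctx) : Prop :=
  ctx_ok G' /\ forall t A, tm_ok G t A -> tm_ok G' t A.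

Lemma extends_refl G : ctx_ok G -> extends G G.
Proof. by []. Qed.

Lemma extends_cat G H : ctx_ok (G ++ H) -> extends G (G ++ H).
Proof. by move=> cGH; split=> // t A; apply: tm_weaken. Qed.

Lemma tower_extends G G' A : extends G G' -> tower_ok G A -> tower_ok G' A.
Proof.
move=> [cG' ext]; elim: A => //= A IH u v [cA /IH ok_A ok_u ok_v].
by split=> //; apply: ext.
Qed.

(** The boundary of [disk n]. *)
Definition sphere (n : nat) : ctx := iter n susp_ctx [::].

Lemma size_sphere n : size (sphere n) = n.*2.
Proof. by rewrite size_iter_susp_ctx addn0. Qed.

Lemma sphereS n : sphere n.+1 = sphere n ++ [:: disk_ty n; disk_ty n].
Proof.
elim: n => // n IH; rewrite [LHS]iterS -/(sphere n.+1) {1}IH.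
by rewrite /susp_ctx map_cat.
Qed.

Lemma diskE n : disk n = rcons (sphere n) (disk_ty n).
Proof. by rewrite /disk iter_susp_ctx cats1. Qed.

Lemma sphere_tdim n : all (fun A => tdim A < n) (sphere n).
Proof.
elim: n => // n IH; rewrite sphereS all_cat /= tdim_disk ltnSn !andbT.
by apply: sub_all IH => A /leqW.
Qed.

Lemma catt_sphere n : catt_ctx (sphere n).
Proof. exact/catt_iter_ctx/catt_nil. Qed.

Lemma catt_disk_ty n : catt_ty (sphere n) (disk_ty n).
Proof. exact/catt_iter_ty/catt_star/catt_nil. Qed.

Lemma disk_ty_boundary A s : inv_free A -> subst_ty (boundary A ++ s) (disk_ty (tdim A)) = A.
Proof.
elim: A s => // A IH u v s fA; rewrite [tdim _]/= disk_tyS [boundary _]/= -catA.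
rewrite -[LHS]/(Arr (subst_ty _ (disk_ty (tdim A))) (nth _ _ _) (nth _ _ _)).
have /= -> := IH [:: u, v & s] fA.
by rewrite !nth_cat size_boundary ltnn ltnNge leqnSn subnn subSnn.
Qed.

Lemma boundary_ok G A :
  cell_ty A -> tower_ok G A -> sub_ok G (boundary A) (sphere (tdim A)).
Proof.
elim: A => [_ cG | A IH u v _ [cA ok_A ok_u ok_v] | //]; first exact: sub_nil.
have fA := tower_inv_free cA ok_A.
rewrite [tdim _]/= sphereS [boundary _]/= -!cat_rcons !cats0.
have ok_D := catt_disk_ty (tdim A).
have cD : catt_ctx (rcons (sphere (tdim A)) (disk_ty (tdim A))).
  exact: catt_rcons (catt_sphere _) ok_D.
apply: sub_rcons; [apply: sub_rcons; first exact: IH | |].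
- exact: catt_ty_ok.
- by rewrite -[boundary A]cats0 disk_ty_boundary.
- by rewrite -cats1; apply/catt_ty_ok/catt_ty_weaken; rewrite ?cats1.
- by rewrite -cats1 disk_ty_boundary.
Qed.

(** The counterpart of [op_at] for types. *)
Definition op_ty (T0 A : ty) (args : sub) : ty :=
  subst_ty (boundary A ++ args) (iter (tdim A) susp_ty T0).

Definition args_ok (G : ctx) (A : ty) (args : sub) (G0 : ctx) : Prop :=
  size args = size G0 /\
  forall i, i < size G0 -> tm_ok G (nth (Var 0) args i) (op_ty (var_ty G0 i) A args).

Lemma op_ty_star A args : inv_free A -> op_ty Star A args = A.
Proof. exact: disk_ty_boundary. Qed.

Lemma op_ty_arr B u v A args :
  op_ty (Arr B u v) A args = Arr (op_ty B A args) (op_at u A args) (op_at v A args).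
Proof. by rewrite /op_ty iter_susp_arr. Qed.

Lemma op_at_var i A args : i < size args -> op_at (Var i) A args = nth (Var 0) args i.
Proof.
move=> lt_i; rewrite /op_at iter_susp_var /= nth_cat size_boundary.
rewrite ltnNge leq_addr addKn; exact: set_nth_default.
Qed.

Lemma comp_id_sub s s' : comp_sub (id_sub (size s)) (s ++ s') = s.
Proof.
rewrite /comp_sub -map_comp -[RHS](mkseq_nth (Var 0)).
apply/eq_in_map => i; rewrite mem_iota => /andP[_ lt_i] /=.
by rewrite nth_cat lt_i; apply: set_nth_default.
Qed.

Lemma op_at_op t0 args0 A args :
  scoped_tm (size args0) t0 ->
  op_at (op_at t0 Star args0) A args =
  op_at t0 A [seq op_at u A args | u <- args0].
Proof.
move=> st0; rewrite {2}/op_at /= /op_at iter_susp_subst_tm iter_susp_sub.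
rewrite subst_tm_comp; last first.
  by rewrite size_cat size_id_sub size_map; apply: scoped_iter_susp_tm.
congr subst_tm; rewrite /comp_sub map_cat -map_comp -size_boundary.
by congr (_ ++ _); apply: comp_id_sub.
Qed.

Lemma op_sub_ok G A args G0 :
  cell_ty A -> tower_ok G A -> catt_ctx G0 -> args_ok G A args G0 ->
  sub_ok G (boundary A ++ args) (iter (tdim A) susp_ctx G0).
Proof.
move=> cA tA cG0; elim: cG0 args => {G0} [|G0 B cG0 IH ok_B] args [].
  by move=> /size0nil -> _; rewrite cats0; apply: boundary_ok.
case/lastP: args => [|args t]; rewrite !size_rcons // => -[Eargs] Hargs.
rewrite iter_susp_ctx map_rcons -!rcons_cat -iter_susp_ctx.
have sG0 := ctx_scoped (catt_ctx_ok cG0).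
have Eop C : scoped_ty (size G0) C -> op_ty C A (rcons args t) = op_ty C A args.
  move=> sC; rewrite /op_ty -cats1 catA subst_ty_cat //.
  by rewrite size_cat size_boundary Eargs; apply: scoped_iter_susp_ty.
apply: sub_rcons.
- apply: IH; split=> // i lt_i; have := Hargs i (leqW lt_i).
  rewrite /var_ty !nth_rcons Eargs lt_i Eop //; exact: all_nthP.
- exact/catt_ty_ok/catt_iter_ty.
have := Hargs (size G0) (ltnSn _).
by rewrite /var_ty !nth_rcons Eargs ltnn eqxx Eop // (ty_scoped (catt_ty_ok ok_B)).
Qed.

Lemma op_ok G A args G0 t0 T0 :
  cell_ty A -> tower_ok G A -> catt_tm G0 t0 T0 -> catt_ctx G0 -> args_ok G A args G0 ->
  tm_ok G (op_at t0 A args) (op_ty T0 A args).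
Proof.
move=> cA tA ok_t0 cG0 /(op_sub_ok cA tA cG0) ok_args.
exact: subst_tm_ok ok_args (catt_tm_ok (catt_iter_tm _ ok_t0)).
Qed.

Lemma catt_coh_id G0 T0 :
  is_ps G0 -> catt_ty G0 T0 -> full G0 T0 ->
  catt_tm G0 (Coh G0 T0 (id_sub (size G0))) T0.
Proof.
move=> ps_G0 ok_T0 full_T0; rewrite -{2}(subst_ty_id (size G0) T0).
apply: catt_coh => //; have := @catt_id_sub G0 [::]; rewrite cats0.
by apply; apply: ps_ctx.
Qed.

Lemma op_at_coh G0 T0 A args :
  size args = size G0 ->
  op_at (Coh G0 T0 (id_sub (size G0))) A args =
  Coh (iter (tdim A) susp_ctx G0) (iter (tdim A) susp_ty T0) (boundary A ++ args).
Proof.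
move=> Eargs; rewrite /op_at iter_susp_coh /=; congr Coh.
rewrite iter_susp_sub map_cat -size_boundary; congr (_ ++ _).
  exact: comp_id_sub.
rewrite -!map_comp -[RHS](mkseq_nth (Var 0)) Eargs.
apply/eq_in_map => i; rewrite mem_iota => /andP[_ lt_i].
by rewrite /= -/(op_at (Var i) A args) op_at_var ?Eargs.
Qed.

Lemma count_iter_susp n d G0 :
  all inv_free G0 ->
  count (fun B => tdim B == n + d) (sphere n ++ map (iter n susp_ty) G0) =
  count (fun B => tdim B == d) G0.
Proof.
move=> fG0; rewrite count_cat.
have -> : count (fun B => tdim B == n + d) (sphere n) = 0.
  apply/eqP; rewrite -leqn0 leqNgt -has_count -all_predC.
  by apply: sub_all (sphere_tdim n) => B /=; lia.
rewrite add0n count_map; elim: G0 fG0 => //= B G0 IH /andP[fB /IH ->].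
by rewrite tdim_iter_susp // eqn_add2l.
Qed.

(** The boundary of [A] never reaches the dimension of the coherence, so its
    top-dimensional arguments after suspension are those of before. *)
Lemma op_can_ok G A args G0 T0 es :
  cell_ty A -> tower_ok G A -> is_ps G0 -> catt_ty G0 T0 -> full G0 T0 ->
  args_ok G A args G0 -> size es = count (fun B => tdim B == tdim T0) G0 ->
  (forall i, i < size G0 -> var_dim G0 i = tdim T0 ->
     tm_ok G (inv_at (tdim T0) G0 es i)
             (Inv (op_ty (var_ty G0 i) A args) (nth (Var 0) args i))) ->
  let t := op_at (Coh G0 T0 (id_sub (size G0))) A args in
  tm_ok G (Can t es) (Inv (op_ty T0 A args) t).
Proof.
move=> cA tA ps_G0 ok_T0 full_T0 args_G0 Ees Hes t.
have cG0 := ps_ctx ps_G0; have [Eargs Hargs] := args_G0.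
have := op_ok cA tA (catt_coh_id ps_G0 ok_T0 full_T0) cG0 args_G0; rewrite /t /op_ty op_at_coh // => ok_t.
have fG0 := catt_ctx_inv_free cG0.
have Edim := tdim_iter_susp (tdim A) (catt_ty_inv_free ok_T0).
apply: ok_can => //; first by rewrite Edim iter_susp_ctx count_iter_susp.
rewrite Edim => i; rewrite size_iter_susp_ctx iter_susp_ctx -/(sphere _) => lt_i.
have [lt_iA | le_Ai] := ltnP i (tdim A).*2.
  rewrite /var_dim /var_ty nth_cat size_sphere lt_iA => dim_i.
  have : tdim (nth Star (sphere (tdim A)) i) < tdim A.
    by apply: (all_nthP _ (sphere_tdim _)); rewrite size_sphere.
  by rewrite dim_i; lia.
have [j Ei] : exists j, i = (tdim A).*2 + j by exists (i - (tdim A).*2); lia.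
subst i => {le_Ai}; move: lt_i; rewrite ltn_add2l => lt_j.
have nth_cat2 (T : Type) (x0 : T) (s s' : seq T) :
    size s = (tdim A).*2 -> nth x0 (s ++ s') ((tdim A).*2 + j) = nth x0 s' j.
  by move=> Es; rewrite nth_cat Es ltnNge leq_addr addKn.
rewrite /var_dim /var_ty nth_cat2 ?size_sphere // (nth_map Star) //.
rewrite tdim_iter_susp; last exact: all_nthP.
move=> /addnI dim_j; have := Hes j lt_j dim_j.
rewrite /inv_at take_cat size_sphere ltnNge leq_addr addKn -map_take /=.
rewrite count_iter_susp; last first.
  by have := fG0; rewrite -{1}(cat_take_drop j G0) all_cat => /andP[].
by rewrite nth_cat2 ?size_boundary // (set_nth_default (Var 0)) ?Eargs.
Qed.

(** * Identities, composites and presupposition *)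

Lemma catt_sub_nth D s G0 :
  catt_ctx D -> catt_ctx G0 -> size s = size G0 ->
  (forall i, i < size G0 -> catt_tm D (nth (Var 0) s i) (subst_ty s (var_ty G0 i))) ->
  catt_sub D s G0.
Proof.
move=> cD cG0; elim: cG0 s => {G0} [|G0 B cG0 IH ok_B] s.
  by move=> /size0nil -> _; apply: catt_sub_nil.
case/lastP: s => [|s t]; rewrite !size_rcons // => -[Es] Hs.
have Esub C : scoped_ty (size G0) C -> subst_ty (rcons s t) C = subst_ty s C.
  by move=> sC; rewrite -cats1 subst_ty_cat ?Es.
apply: catt_sub_rcons => //.
  apply: IH => // i lt_i; have := Hs i (leqW lt_i).
  rewrite /var_ty !nth_rcons Es lt_i Esub //.
  exact: all_nthP (ctx_scoped (catt_ctx_ok cG0)) _ _.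
have := Hs (size G0) (ltnSn _).
by rewrite /var_ty !nth_rcons Es ltnn eqxx Esub // (ty_scoped (catt_ty_ok ok_B)).
Qed.

Lemma ps_ctx2 : is_ps ctx2.
Proof. by exists 3; apply: (ps_grow (ps_grow ps_point)). Qed.

Lemma catt_hom G i j :
  catt_ctx G -> i < size G -> j < size G -> var_ty G i = Star -> var_ty G j = Star ->
  catt_ty G (hom i j).
Proof. by move=> cG lt_i lt_j Ei Ej; apply: catt_arr; apply: catt_var_ty. Qed.

Lemma ps_star : is_ps [:: Star].
Proof. by exists 0; apply: ps_point. Qed.

Lemma catt_comp G x y z f g :
  catt_ctx G -> catt_tm G x Star -> catt_tm G y Star -> catt_tm G z Star ->
  catt_tm G f (Arr Star x y) -> catt_tm G g (Arr Star y z) ->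
  catt_tm G (comp_tm Star x y z f g) (Arr Star x z).
Proof.
move=> cG ok_x ok_y ok_z ok_f ok_g.
apply: (@catt_coh _ ctx2 (hom 0 3) [:: x; y; f; z; g]) => //; first exact: ps_ctx2.
  by apply: catt_hom => //; apply: ps_ctx ps_ctx2.
by apply: catt_sub_nth => //; [apply: ps_ctx ps_ctx2 | do 5?case].
Qed.

Lemma catt_id G x :
  catt_ctx G -> catt_tm G x Star -> catt_tm G (id_tm Star x) (Arr Star x x).
Proof.
move=> cG ok_x.
apply: (@catt_coh _ [:: Star] (hom 0 0) [:: x]) => //; first exact: ps_star.
  by apply: catt_hom => //; apply: ps_ctx ps_star.
by apply: catt_sub_nth => //; [apply: ps_ctx ps_star | case].
Qed.

Lemma op_ty_hom i j A args :
  inv_free A -> i < size args -> j < size args ->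
  op_ty (hom i j) A args = Arr A (nth (Var 0) args i) (nth (Var 0) args j).
Proof. by move=> fA lt_i lt_j; rewrite op_ty_arr op_ty_star // !op_at_var. Qed.

Lemma comp_args_ok G A x y z f g :
  cell_ty A -> tower_ok G A -> tm_ok G x A -> tm_ok G y A -> tm_ok G z A ->
  tm_ok G f (Arr A x y) -> tm_ok G g (Arr A y z) ->
  args_ok G A [:: x; y; f; z; g] ctx2.
Proof.
move=> cA tA ok_x ok_y ok_z ok_f ok_g; have fA := tower_inv_free cA tA.
by split=> //; do 5?[case=> //] => _; rewrite /= ?op_ty_hom ?op_ty_star.
Qed.

Lemma comp_ok_tower G A x y z f g :
  cell_ty A -> tower_ok G A -> tm_ok G x A -> tm_ok G y A -> tm_ok G z A ->
  tm_ok G f (Arr A x y) -> tm_ok G g (Arr A y z) ->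
  tm_ok G (comp_tm A x y z f g) (Arr A x z).
Proof.
move=> cA tA ok_x ok_y ok_z ok_f ok_g; have fA := tower_inv_free cA tA.
have c2 := ps_ctx ps_ctx2.
have := op_ok cA tA (catt_coh_id ps_ctx2 (catt_hom c2 _ _ _ _) _) c2
  (comp_args_ok cA tA ok_x ok_y ok_z ok_f ok_g).
by move=> /(_ 0 3 isT isT erefl erefl isT); rewrite op_ty_hom.
Qed.

Lemma id_ok_tower G A x :
  cell_ty A -> tower_ok G A -> tm_ok G x A -> tm_ok G (id_tm A x) (Arr A x x).
Proof.
move=> cA tA ok_x; have fA := tower_inv_free cA tA; have c1 := ps_ctx ps_star.
have args_x : args_ok G A [:: x] [:: Star] by split=> // -[] //=; rewrite op_ty_star.
have := op_ok cA tA (catt_coh_id ps_star (catt_hom c1 _ _ _ _) _) c1 args_x.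
by move=> /(_ 0 0 isT isT erefl erefl isT); rewrite op_ty_hom.
Qed.

Lemma tower_lcancel G A u v t l :
  tower_ok G (Arr A u v) -> tm_ok G t (Arr A u v) -> tm_ok G l (Arr A v u) ->
  tower_ok G (lcancel_ty A u v t l).
Proof.
move=> [cA tA ok_u ok_v] ok_t ok_l; split=> //.
  exact: comp_ok_tower.
exact: id_ok_tower.
Qed.

Lemma tower_rcancel G A u v t r :
  tower_ok G (Arr A u v) -> tm_ok G t (Arr A u v) -> tm_ok G r (Arr A v u) ->
  tower_ok G (rcancel_ty A u v t r).
Proof.
move=> [cA tA ok_u ok_v] ok_t ok_r; split=> //.
  exact: comp_ok_tower.
exact: id_ok_tower.
Qed.

(** The types of the destructors are built from the type of a premise, so the
    induction never has to invert a conversion; a coherence has the type of its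
    defining pasting diagram, substituted. *)
Lemma judgement_tower :
  (forall G, ctx_ok G -> forall i, i < size G -> tower_ok G (var_ty G i)) /\
  (forall G A, ty_ok G A -> tower_ok G A) /\
  (forall G t A, tm_ok G t A -> tower_ok G A) /\
  (forall D s G, sub_ok D s G -> True) /\
  (forall G A B, ty_eq G A B -> True) /\
  (forall G t u, tm_eq G t u -> True) /\
  (forall G s s', tms_eq G s s' -> True).
Proof.
apply: judgement_ind => //.
- move=> G A cG IH ok_A tA i; rewrite size_rcons ltnS => le_i.
  have ext : extends G (rcons G A).
    by rewrite -cats1; apply: extends_cat; rewrite cats1; apply: ctx_rcons.
  rewrite /var_ty nth_rcons; case: ltngtP le_i => // [lt_i _ | Ei _].
    exact: tower_extends ext (IH _ lt_i).
  exact: tower_extends ext tA.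
- by move=> G i _ IH /IH.
- by move=> D G A s _ _ tA _ ok_s _; apply: tower_subst ok_s tA.
- by move=> G A u v t e _ [cA tA ok_u ok_v] _ _.
- by move=> G A u v t e _ [cA tA ok_u ok_v] _ _.
- move=> G A u v t e ok_t tT ok_e _; apply: tower_lcancel => //; exact: ok_linv ok_t ok_e.
- move=> G A u v t e ok_t tT ok_e _; apply: tower_rcancel => //; exact: ok_rinv ok_t ok_e.
Qed.

Lemma presupposition G t A : tm_ok G t A -> tower_ok G A.
Proof. by case: judgement_tower => _ [_ [H _]]; apply: H. Qed.

Lemma arrow_ok G f A x y :
  tm_ok G f (Arr A x y) -> [/\ cell_ty A, tower_ok G A, tm_ok G x A & tm_ok G y A].
Proof. exact: presupposition. Qed.

Lemma comp_ok G A x y z f g :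
  tm_ok G f (Arr A x y) -> tm_ok G g (Arr A y z) ->
  tm_ok G (comp_tm A x y z f g) (Arr A x z).
Proof.
move=> ok_f ok_g; have [cA tA ok_x ok_y] := arrow_ok ok_f.
by have [_ _ _ ok_z] := arrow_ok ok_g; apply: comp_ok_tower.
Qed.

(** * Invertible 2-cells *)

(** [f] and [g], over [A], are related in [G] up to a cell that is invertible in
    the extension [G'] of [G].  The two contexts differ in the construction of a
    recursor, whose cells must not use its recursive hypotheses while their
    invertibility terms may. *)
Definition sim (G G' : ctx) (A : ty) (x y f g : tm) : Prop :=
  exists c, tm_ok G c (Arr (Arr A x y) f g) /\ invertible G' (Arr A x y) f g c.

Lemma args_extends G G' A args G0 :
  extends G G' -> args_ok G A args G0 -> args_ok G' A args G0.
Proof. by move=> [_ ext] [Eargs Hargs]; split=> // i /Hargs /ext. Qed.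

(** The coherence from u to v has dimension 2 before suspension, so [Can] asks
    only for the invertibility of its 2-dimensional arguments. *)
Lemma sim_op G G' A args G0 i j u v es :
  let T0 := Arr (hom i j) u v in
  extends G G' -> cell_ty A -> tower_ok G A ->
  is_ps G0 -> catt_tm G0 u (hom i j) -> catt_tm G0 v (hom i j) -> full G0 T0 ->
  args_ok G A args G0 -> i < size G0 -> j < size G0 ->
  size es = count (fun B => tdim B == 2) G0 ->
  (forall k, k < size G0 -> var_dim G0 k = 2 ->
     tm_ok G' (inv_at 2 G0 es k)
              (Inv (op_ty (var_ty G0 k) A args) (nth (Var 0) args k))) ->
  sim G G' A (nth (Var 0) args i) (nth (Var 0) args j) (op_at u A args) (op_at v A args).
Proof.
move=> T0 ext cA tA ps_G0 ok_u ok_v full_T0 ok_args lt_i lt_j Ees Hes.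
have [Eargs _] := ok_args; have fA := tower_inv_free cA tA.
have ok_T0 : catt_ty G0 T0 by apply: catt_arr.
have ET : op_ty T0 A args = Arr (Arr A (nth (Var 0) args i) (nth (Var 0) args j))
                                (op_at u A args) (op_at v A args).
  by rewrite op_ty_arr op_ty_hom ?Eargs.
exists (op_at (Coh G0 T0 (id_sub (size G0))) A args); rewrite /invertible -ET; split.
  exact: op_ok cA tA (catt_coh_id ps_G0 ok_T0 full_T0) (ps_ctx ps_G0) ok_args.
exists (Can (op_at (Coh G0 T0 (id_sub (size G0))) A args) es).
by apply: op_can_ok => //; [apply: tower_extends ext tA | apply: args_extends ext ok_args].
Qed.

Lemma op_at_comp x y z f g A args :
  op_at (comp_tm Star x y z f g) A args =
  comp_tm A (op_at x A args) (op_at y A args) (op_at z A args)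
            (op_at f A args) (op_at g A args).
Proof. exact: op_at_op. Qed.

Lemma op_at_id x A args : op_at (id_tm Star x) A args = id_tm A (op_at x A args).
Proof. exact: op_at_op. Qed.

Definition ctx1 : ctx := [:: Star; Star; hom 0 1].

Lemma ps_ctx1 : is_ps ctx1.
Proof. by exists 1; apply: ps_grow ps_point. Qed.

Lemma ps_ctx3 : is_ps ctx3.
Proof. by exists 5; apply: (ps_grow (ps_grow (ps_grow ps_point))). Qed.

(* (x y f z g g' al) *)
Definition ctx_whiskl : ctx :=
  [:: Star; Star; hom 0 1; Star; hom 1 3; hom 1 3; Arr (hom 1 3) (Var 4) (Var 5)].

(* (x y f f' al z g) *)
Definition ctx_whiskr : ctx :=
  [:: Star; Star; hom 0 1; hom 0 1; Arr (hom 0 1) (Var 2) (Var 3); Star; hom 1 5].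

Lemma ps_ctx_whiskl : is_ps ctx_whiskl.
Proof. by exists 3; apply: ps_down (ps_grow (ps_extend (ps_grow ps_point))). Qed.

Lemma ps_ctx_whiskr : is_ps ctx_whiskr.
Proof. by exists 5; apply: (ps_grow (ps_down (ps_grow (ps_extend ps_point)))). Qed.

Section Sim.
Context (G G' : ctx) (ext : extends G G').

(** A composite of invertible cells is a coherence both of whose top-dimensional
    arguments are invertible. *)
Lemma sim_trans A x y f g h :
  sim G G' A x y f g -> sim G G' A x y g h -> sim G G' A x y f h.
Proof.
move=> [c [ok_c [e ok_e]]] [d [ok_d [e' ok_e']]].
exists (comp_tm (Arr A x y) f g h c d); split; first exact: comp_ok ok_c ok_d.
have [cA tA ok_f ok_g] := arrow_ok ok_c; have [_ _ _ ok_h] := arrow_ok ok_d.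
have fA := tower_inv_free cA tA.
exists (Can (comp_tm (Arr A x y) f g h c d) [:: e; e']).
have ok_args := comp_args_ok cA tA ok_f ok_g ok_h ok_c ok_d.
have c2 := ps_ctx ps_ctx2.
rewrite -[Arr (Arr A x y) f h](op_ty_hom (i := 0) (j := 3) (args := [:: f; g; c; h; d])) //.
apply: (@op_can_ok G' (Arr A x y) [:: f; g; c; h; d] ctx2 (hom 0 3)) => //.
- exact: tower_extends ext tA.
- exact: ps_ctx2.
- exact: catt_hom.
- exact: args_extends ext ok_args.
by do 5?[case=> //] => _ _; rewrite op_ty_hom.
Qed.

Lemma sim_assoc_both A x y z w f g h :
  tm_ok G f (Arr A x y) -> tm_ok G g (Arr A y z) -> tm_ok G h (Arr A z w) ->
  let l := comp_tm A x z w (comp_tm A x y z f g) h in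
  let r := comp_tm A x y w f (comp_tm A y z w g h) in
  sim G G' A x w l r /\ sim G G' A x w r l.
Proof.
move=> ok_f ok_g ok_h; have [cA tA ok_x ok_y] := arrow_ok ok_f.
have [_ _ ok_z ok_w] := arrow_ok ok_h; have fA := tower_inv_free cA tA.
have c3 := ps_ctx ps_ctx3.
have ok_args : args_ok G A [:: x; y; f; z; g; w; h] ctx3.
  by split=> //; do 7?[case=> //] => _; rewrite /= ?op_ty_hom ?op_ty_star.
set l0 := comp_tm Star (Var 0) (Var 3) (Var 5)
            (comp_tm Star (Var 0) (Var 1) (Var 3) (Var 2) (Var 4)) (Var 6).
set r0 := comp_tm Star (Var 0) (Var 1) (Var 5) (Var 2)
            (comp_tm Star (Var 1) (Var 3) (Var 5) (Var 4) (Var 6)).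
have ok_l : catt_tm ctx3 l0 (hom 0 5).
  by do 2?[apply: catt_comp => //]; apply: catt_var_ty.
have ok_r : catt_tm ctx3 r0 (hom 0 5).
  by do 2?[apply: catt_comp => //]; apply: catt_var_ty.
have no_cell k : k < size ctx3 -> var_dim ctx3 k = 2 -> False by do 7?[case: k => // k].
have := @sim_op G G' A _ ctx3 0 5 l0 r0 [::] ext cA tA ps_ctx3 ok_l ok_r erefl ok_args.
have := @sim_op G G' A _ ctx3 0 5 r0 l0 [::] ext cA tA ps_ctx3 ok_r ok_l erefl ok_args.
rewrite /l0 /r0 !op_at_comp !op_at_var // => Hr Hl.
by split; [apply: Hl | apply: Hr] => // k lt_k /(no_cell k lt_k).
Qed.

Lemma sim_unitl_both A x y f :
  tm_ok G f (Arr A x y) ->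
  sim G G' A x y f (comp_tm A x x y (id_tm A x) f) /\
  sim G G' A x y (comp_tm A x x y (id_tm A x) f) f.
Proof.
move=> ok_f; have [cA tA ok_x ok_y] := arrow_ok ok_f; have fA := tower_inv_free cA tA.
have c1 := ps_ctx ps_ctx1.
have ok_args : args_ok G A [:: x; y; f] ctx1.
  by split=> //; do 3?[case=> //] => _; rewrite /= ?op_ty_hom ?op_ty_star.
set u0 := comp_tm Star (Var 0) (Var 0) (Var 1) (id_tm Star (Var 0)) (Var 2).
have ok_u : catt_tm ctx1 u0 (hom 0 1).
  by apply: catt_comp => //; try (apply: catt_id => //); apply: catt_var_ty.
have ok_2 : catt_tm ctx1 (Var 2) (hom 0 1) by apply: catt_var_ty.
have no_cell k : k < size ctx1 -> var_dim ctx1 k = 2 -> False by do 3?[case: k => // k].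
have := @sim_op G G' A _ ctx1 0 1 (Var 2) u0 [::] ext cA tA ps_ctx1 ok_2 ok_u erefl ok_args.
have := @sim_op G G' A _ ctx1 0 1 u0 (Var 2) [::] ext cA tA ps_ctx1 ok_u ok_2 erefl ok_args.
rewrite /u0 !op_at_comp op_at_id !op_at_var // => Hr Hl.
by split; [apply: Hl | apply: Hr] => // k lt_k /(no_cell k lt_k).
Qed.

Lemma sim_unitr A x y f :
  tm_ok G f (Arr A x y) -> sim G G' A x y f (comp_tm A x y y f (id_tm A y)).
Proof.
move=> ok_f; have [cA tA ok_x ok_y] := arrow_ok ok_f; have fA := tower_inv_free cA tA.
have c1 := ps_ctx ps_ctx1.
have ok_args : args_ok G A [:: x; y; f] ctx1.
  by split=> //; do 3?[case=> //] => _; rewrite /= ?op_ty_hom ?op_ty_star.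
set u0 := comp_tm Star (Var 0) (Var 1) (Var 1) (Var 2) (id_tm Star (Var 1)).
have ok_u : catt_tm ctx1 u0 (hom 0 1).
  by apply: catt_comp => //; try (apply: catt_id => //); apply: catt_var_ty.
have ok_2 : catt_tm ctx1 (Var 2) (hom 0 1) by apply: catt_var_ty.
have := @sim_op G G' A _ ctx1 0 1 (Var 2) u0 [::] ext cA tA ps_ctx1 ok_2 ok_u erefl ok_args.
rewrite /u0 !op_at_comp op_at_id !op_at_var //; apply=> //.
by do 3?[case=> //].
Qed.

Lemma sim_whiskl A x y z f g g' :
  tm_ok G f (Arr A x y) -> sim G G' A y z g g' ->
  sim G G' A x z (comp_tm A x y z f g) (comp_tm A x y z f g').
Proof.
move=> ok_f [al [ok_al [e ok_e]]]; have [cA tA ok_x ok_y] := arrow_ok ok_f.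
have [_ _ ok_g ok_g'] := arrow_ok ok_al; have [_ _ _ ok_z] := arrow_ok ok_g.
have fA := tower_inv_free cA tA; have cL := ps_ctx ps_ctx_whiskl.
set args := [:: x; y; f; z; g; g'; al].
have Eal : op_ty (Arr (hom 1 3) (Var 4) (Var 5)) A args = Arr (Arr A y z) g g'.
  by rewrite op_ty_arr op_ty_hom ?op_at_var.
have ok_args : args_ok G A args ctx_whiskl.
  by split=> //; do 7?[case=> //] => _; rewrite /= ?op_ty_hom ?op_ty_star ?Eal.
set u0 := comp_tm Star (Var 0) (Var 1) (Var 3) (Var 2) (Var 4).
set v0 := comp_tm Star (Var 0) (Var 1) (Var 3) (Var 2) (Var 5).
have ok_u : catt_tm ctx_whiskl u0 (hom 0 3).
  by apply: catt_comp => //; apply: catt_var_ty.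
have ok_v : catt_tm ctx_whiskl v0 (hom 0 3).
  by apply: catt_comp => //; apply: catt_var_ty.
have := @sim_op G G' A _ ctx_whiskl 0 3 u0 v0 [:: e] ext cA tA ps_ctx_whiskl
  ok_u ok_v erefl ok_args.
rewrite /u0 /v0 !op_at_comp !op_at_var //; apply=> //.
by do 7?[case=> //] => _ _; rewrite Eal.
Qed.

Lemma sim_whiskr A x y z f f' g :
  sim G G' A x y f f' -> tm_ok G g (Arr A y z) ->
  sim G G' A x z (comp_tm A x y z f g) (comp_tm A x y z f' g).
Proof.
move=> [al [ok_al [e ok_e]]] ok_g; have [cA tA ok_y ok_z] := arrow_ok ok_g.
have [_ _ ok_f ok_f'] := arrow_ok ok_al; have [_ _ ok_x _] := arrow_ok ok_f.
have fA := tower_inv_free cA tA; have cR := ps_ctx ps_ctx_whiskr.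
set args := [:: x; y; f; f'; al; z; g].
have Eal : op_ty (Arr (hom 0 1) (Var 2) (Var 3)) A args = Arr (Arr A x y) f f'.
  by rewrite op_ty_arr op_ty_hom ?op_at_var.
have ok_args : args_ok G A args ctx_whiskr.
  by split=> //; do 7?[case=> //] => _; rewrite /= ?op_ty_hom ?op_ty_star ?Eal.
set u0 := comp_tm Star (Var 0) (Var 1) (Var 5) (Var 2) (Var 6).
set v0 := comp_tm Star (Var 0) (Var 1) (Var 5) (Var 3) (Var 6).
have ok_u : catt_tm ctx_whiskr u0 (hom 0 5).
  by apply: catt_comp => //; apply: catt_var_ty.
have ok_v : catt_tm ctx_whiskr v0 (hom 0 5).
  by apply: catt_comp => //; apply: catt_var_ty.
have := @sim_op G G' A _ ctx_whiskr 0 5 u0 v0 [:: e] ext cA tA ps_ctx_whiskr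
  ok_u ok_v erefl ok_args.
rewrite /u0 /v0 !op_at_comp !op_at_var //; apply=> //.
by do 7?[case=> //] => _ _; rewrite Eal.
Qed.

Lemma sim_assoc A x y z w f g h :
  tm_ok G f (Arr A x y) -> tm_ok G g (Arr A y z) -> tm_ok G h (Arr A z w) ->
  sim G G' A x w (comp_tm A x z w (comp_tm A x y z f g) h)
                 (comp_tm A x y w f (comp_tm A y z w g h)).
Proof. by move=> ok_f ok_g ok_h; have [] := sim_assoc_both ok_f ok_g ok_h. Qed.

Lemma sim_assocV A x y z w f g h :
  tm_ok G f (Arr A x y) -> tm_ok G g (Arr A y z) -> tm_ok G h (Arr A z w) ->
  sim G G' A x w (comp_tm A x y w f (comp_tm A y z w g h))
                 (comp_tm A x z w (comp_tm A x y z f g) h).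
Proof. by move=> ok_f ok_g ok_h; have [] := sim_assoc_both ok_f ok_g ok_h. Qed.

Lemma sim_unitl A x y f :
  tm_ok G f (Arr A x y) -> sim G G' A x y f (comp_tm A x x y (id_tm A x) f).
Proof. by case/sim_unitl_both. Qed.

Lemma sim_unitlV A x y f :
  tm_ok G f (Arr A x y) -> sim G G' A x y (comp_tm A x x y (id_tm A x) f) f.
Proof. by case/sim_unitl_both. Qed.

(** g k ~ (g k) id ~ (g k) (g r) ~ g (k (g r)) ~ g ((k g) r) ~ g (id r) ~ g r ~ id.
    The cell from id to g r is a separate hypothesis: [sim] is not yet known to be
    symmetric, and this lemma is what its symmetry is deduced from. *)
Lemma left_inverse_is_right A y z g k r :
  tm_ok G g (Arr A y z) -> tm_ok G k (Arr A z y) -> tm_ok G r (Arr A z y) ->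
  sim G G' A z z (comp_tm A z y z k g) (id_tm A z) ->
  sim G G' A y y (comp_tm A y z y g r) (id_tm A y) ->
  sim G G' A y y (id_tm A y) (comp_tm A y z y g r) ->
  sim G G' A y y (comp_tm A y z y g k) (id_tm A y).
Proof.
move=> ok_g ok_k ok_r kg gr grV.
have ok_gk := comp_ok ok_g ok_k; have ok_gr := comp_ok ok_g ok_r.
apply: sim_trans (sim_unitr ok_gk) _.
apply: sim_trans (sim_whiskl ok_gk grV) _.
apply: sim_trans (sim_assoc ok_g ok_k ok_gr) _.
apply: sim_trans (sim_whiskl ok_g (sim_assocV ok_k ok_g ok_r)) _.
apply: sim_trans (sim_whiskl ok_g (sim_whiskr kg ok_r)) _.
exact: sim_trans (sim_whiskl ok_g (sim_unitlV ok_r)) gr.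
Qed.

(** The mirror image of [left_inverse_is_right]:
    r g ~ id (r g) ~ (k g) (r g) ~ k (g (r g)) ~ k ((g r) g) ~ k (id g) ~ k g ~ id. *)
Lemma right_inverse_is_left A y z g k r :
  tm_ok G g (Arr A y z) -> tm_ok G k (Arr A z y) -> tm_ok G r (Arr A z y) ->
  sim G G' A y y (comp_tm A y z y g r) (id_tm A y) ->
  sim G G' A z z (comp_tm A z y z k g) (id_tm A z) ->
  sim G G' A z z (id_tm A z) (comp_tm A z y z k g) ->
  sim G G' A z z (comp_tm A z y z r g) (id_tm A z).
Proof.
move=> ok_g ok_k ok_r gr kg kgV.
have ok_rg := comp_ok ok_r ok_g; have ok_kg := comp_ok ok_k ok_g.
apply: sim_trans (sim_unitl ok_rg) _.
apply: sim_trans (sim_whiskr kgV ok_rg) _.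
apply: sim_trans (sim_assoc ok_k ok_g ok_rg) _.
apply: sim_trans (sim_whiskl ok_k (sim_assocV ok_g ok_r ok_g)) _.
apply: sim_trans (sim_whiskl ok_k (sim_whiskr gr ok_g)) _.
exact: sim_trans (sim_whiskl ok_k (sim_unitlV ok_g)) kg.
Qed.

End Sim.

(** * Inverses are invertible *)

Lemma chi_inv_nth A u v t e i :
  i < 4 ->
  nth (Var ((tdim A).*2 + i)) (chi_inv (Arr A u v) t e) ((tdim A).*2 + i) =
  nth (Var 0) [:: u; v; t; e] i.
Proof.
move=> lt_i; rewrite /chi_inv /chi -!cats1 /= -!catA /= nth_cat size_boundary.
by rewrite ltnNge leq_addr addKn; apply: set_nth_default.
Qed.

Lemma disk_ty_chi_inv A u v t e :
  inv_free A -> subst_ty (chi_inv (Arr A u v) t e) (disk_ty (tdim A)) = A.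
Proof.
by move=> fA; rewrite /chi_inv /chi -!cats1 /= -!catA disk_ty_boundary.
Qed.

(** The recursive hypotheses of a recursor and its conclusion arise from the same
    generic statement by substituting some chi_e; this reads all of them off. *)
Lemma inverse_chi_inv A u v t e (n := tdim A) :
  inv_free A ->
  subst_ty (chi_inv (Arr A u v) t e)
    (Inv (Arr (disk_ty n) (Var n.*2.+1) (Var n.*2)) (Linv (Var n.*2.+3))) =
  Inv (Arr A v u) (Linv e).
Proof.
move=> fA.
have E i : i < 4 -> subst_tm (chi_inv (Arr A u v) t e) (Var (n.*2 + i)) =
                    nth (Var 0) [:: u; v; t; e] i by exact: chi_inv_nth.
rewrite -[n.*2]addn0 -!addnS -[LHS]/(Inv (Arr (subst_ty _ _) (subst_tm _ (Var _))
  (subst_tm _ (Var _))) (Linv (subst_tm _ (Var _)))).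
by rewrite !E // disk_ty_chi_inv.
Qed.

Section InvCtx.
Context (n : nat).
Let E := inv_ctx n.+1.
Let D := disk_ty n.
Let u := Var n.*2.
Let v := Var n.*2.+1.
Let d := Var n.*2.+2.
Let e := Var n.*2.+3.

Lemma inv_ctxE :
  E = rcons (rcons (sphere n.+1) (disk_ty n.+1)) (Inv (disk_ty n.+1) d).
Proof. by rewrite /E /inv_ctx diskE. Qed.

Lemma inv_ctx_ok : ctx_ok E.
Proof.
have cD : catt_ctx (disk n.+1).
  by apply: catt_iter_ctx; apply: (catt_rcons (G := [::])); do !constructor.
apply: ctx_rcons; first exact: catt_ctx_ok.
rewrite disk_tyS; apply: ty_inv; rewrite -disk_tyS; apply: catt_tm_ok.
apply: catt_var_ty => //; first by rewrite size_disk.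
by rewrite /var_ty diskE nth_rcons size_sphere ltnn eqxx.
Qed.

Lemma inv_ctx_cell : tm_ok E d (Arr D u v).
Proof.
have <- : var_ty E n.*2.+2 = Arr D u v; last first.
  by apply: ok_var inv_ctx_ok _; rewrite size_inv_ctx.
rewrite -disk_tyS /var_ty inv_ctxE !nth_rcons size_rcons size_sphere.
by rewrite doubleS leqnn ltnn eqxx.
Qed.

Lemma inv_ctx_inv : tm_ok E e (Inv (Arr D u v) d).
Proof.
have <- : var_ty E n.*2.+3 = Inv (Arr D u v) d; last first.
  by apply: ok_var inv_ctx_ok _; rewrite size_inv_ctx.
rewrite -disk_tyS /var_ty inv_ctxE nth_rcons size_rcons size_sphere.
by rewrite doubleS ltnn eqxx.
Qed.

Let ok_d := inv_ctx_cell.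
Let ok_e := inv_ctx_inv.
Let T := Arr D v u.

Let X := Inv (Arr (Arr D v v) (id_tm D v) (comp_tm D v u v (Linv e) d)) (Linv (Ilunit e)).
Let Y := Inv (Arr (Arr D u u) (id_tm D u) (comp_tm D u v u d (Rinv e))) (Linv (Irunit e)).

(** For the recursor on linv(e) the recursive hypotheses X and Y say that
    the inverses linv(ilunit(e)) and linv(irunit(e)) of the cancellators are
    themselves invertible. *)
Lemma rec_ctx_inverse : rec_ctx n T (Linv e) = E ++ [:: X; Y].
Proof.
have fD : inv_free D by apply: catt_ty_inv_free (catt_disk_ty n).
have tD : tdim D = n by exact: tdim_disk.
have susp_inv : Inv (susp_ty T) (susp_tm (Linv e)) =
    Inv (Arr (disk_ty n.+1) (Var n.+1.*2.+1) (Var n.+1.*2)) (Linv (Var n.+1.*2.+3)).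
  by [].
rewrite /rec_ctx susp_inv /chi_ilunit /chi_irunit -/D; congr (_ ++ [:: _; _]).
  have := @inverse_chi_inv (Arr D v v) (comp_tm D v u v (Linv e) d) (id_tm D v) (Lunit e) (Ilunit e) fD.
  by rewrite /= tD.
have := @inverse_chi_inv (Arr D u u) (comp_tm D u v u d (Rinv e)) (id_tm D u) (Runit e) (Irunit e) fD.
by rewrite /= tD.
Qed.

Let E' := E ++ [:: X; Y].

Lemma rec_ctx_inverse_ok : ctx_ok E'.
Proof.
have ok_X : ty_ok E X.
  by apply: ty_inv; apply: ok_linv (ok_lunit ok_d ok_e) (ok_ilunit ok_d ok_e).
have cX : ctx_ok (E ++ [:: X]).
  rewrite cats1.
  by apply: ctx_rcons => //; apply: inv_ctx_ok.
rewrite /E' -cat_rcons cats1 -[rcons E X]cats1; apply: ctx_rcons => //.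
apply: ty_weaken => //; apply: ty_inv.
exact: ok_linv (ok_runit ok_d ok_e) (ok_irunit ok_d ok_e).
Qed.

(** t is a right inverse of linv(e) by lunit(e), and a left inverse by
    [left_inverse_is_right].  The cell from id to t * rinv(e) that this requires is
    linv(irunit(e)): it exists in E, and its invertibility in E' is the
    hypothesis Y. *)
Lemma generic_inverse :
  exists r, forall G s, sub_ok G s E -> tm_ok G (r s) (subst_ty s (Inv T (Linv e))).
Proof.
have cE' := rec_ctx_inverse_ok.
have ext : extends E E' by apply: extends_cat.
have [_ weak] := ext.
have ok_l := ok_linv ok_d ok_e; have ok_r := ok_rinv ok_d ok_e.
have ok_lu := ok_lunit ok_d ok_e; have ok_ru := ok_runit ok_d ok_e.
have ok_ilu := ok_ilunit ok_d ok_e; have ok_iru := ok_irunit ok_d ok_e.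
have lu_sim : sim E E' D v v (comp_tm D v u v (Linv e) d) (id_tm D v).
  by exists (Lunit e); split=> //; exists (Ilunit e); apply: weak.
have ru_sim : sim E E' D u u (comp_tm D u v u d (Rinv e)) (id_tm D u).
  by exists (Runit e); split=> //; exists (Irunit e); apply: weak.
have ruV_sim : sim E E' D u u (id_tm D u) (comp_tm D u v u d (Rinv e)).
  exists (Linv (Irunit e)); split; first exact: ok_linv ok_ru ok_iru.
  exists (Var (size E).+1).
  have EY : var_ty E' (size E).+1 = Y by rewrite /var_ty nth_cat ltnNge leqnSn subSnn.
  have lt_Y : (size E).+1 < size E' by rewrite size_cat addn2.
  by have := ok_var cE' lt_Y; rewrite EY.
have [c [ok_c [i ok_i]]] := left_inverse_is_right ext ok_d ok_l ok_r lu_sim ru_sim ruV_sim.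
exists (Rec (Linv e) d d c (Lunit e) i (Ilunit e)) => G s ok_s.
apply: (@ok_rec G n) => //; rewrite rec_ctx_inverse //.
exact: weak ok_ilu.
Qed.
End InvCtx.

Lemma linv_invertible G A x y t e :
  tm_ok G t (Arr A x y) -> tm_ok G e (Inv (Arr A x y) t) ->
  invertible G A y x (Linv e).
Proof.
move=> ok_t ok_e; have [cA tA ok_x ok_y] := arrow_ok ok_t.
have fA := tower_inv_free cA tA.
have [r ok_r] := generic_inverse (tdim A).
exists (r (chi_inv (Arr A x y) t e)); rewrite -(inverse_chi_inv x y t e fA).
apply: ok_r; rewrite inv_ctxE /chi_inv /chi.
have ok_D := catt_disk_ty (tdim A).+1.
have cD : catt_ctx (rcons (sphere (tdim A).+1) (disk_ty (tdim A).+1)).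
  exact: catt_rcons (catt_sphere _) ok_D.
have ED s : subst_ty (boundary (Arr A x y) ++ s) (disk_ty (tdim A).+1) = Arr A x y.
  exact: (@disk_ty_boundary (Arr A x y)).
have ok_s : sub_ok G (rcons (boundary (Arr A x y)) t)
                     (rcons (sphere (tdim A).+1) (disk_ty (tdim A).+1)).
  apply: sub_rcons; first exact: (@boundary_ok G (Arr A x y)).
    exact: catt_ty_ok.
  by rewrite -[boundary _]cats0 ED.
apply: sub_rcons => //.
  rewrite disk_tyS; apply: ty_inv; rewrite -disk_tyS; apply: catt_tm_ok.
  apply: catt_var_ty => //; first by rewrite size_rcons size_sphere.
  by rewrite /var_ty nth_rcons size_sphere ltnn eqxx.
rewrite subst_inv -cats1 ED.
have -> : subst_tm (boundary (Arr A x y) ++ [:: t]) (Var (tdim A).*2.+2) = t => //.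
by rewrite -[LHS]/(nth _ _ _) nth_cat size_boundary ltnn subnn.
Qed.

(** * The 2-of-6 property *)

Lemma sim_of_inverse G A x y t e :
  tm_ok G t (Arr A x y) -> tm_ok G e (Inv (Arr A x y) t) ->
  sim G G A y y (comp_tm A y x y (Linv e) t) (id_tm A y) /\
  sim G G A x x (comp_tm A x y x t (Rinv e)) (id_tm A x).
Proof.
move=> ok_t ok_e; split.
  exists (Lunit e); split; first exact: ok_lunit ok_t ok_e.
  by exists (Ilunit e); apply: ok_ilunit ok_t ok_e.
exists (Runit e); split; first exact: ok_runit ok_t ok_e.
by exists (Irunit e); apply: ok_irunit ok_t ok_e.
Qed.

(** Here the two contexts have to agree: the inverse of a cell is built from its
    invertibility term. *)
Lemma sim_sym G A x y f g : sim G G A x y f g -> sim G G A x y g f.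
Proof.
move=> [c [ok_c [e ok_e]]]; exists (Linv e); split; first exact: ok_linv ok_c ok_e.
exact: linv_invertible ok_c ok_e.
Qed.

Lemma invertible_of_sim G A x y t l r :
  tm_ok G t (Arr A x y) -> tm_ok G l (Arr A y x) -> tm_ok G r (Arr A y x) ->
  sim G G A y y (comp_tm A y x y l t) (id_tm A y) ->
  sim G G A x x (comp_tm A x y x t r) (id_tm A x) ->
  invertible G A x y t.
Proof.
move=> ok_t ok_l ok_r [lu [ok_lu [ilu ok_ilu]]] [ru [ok_ru [iru ok_iru]]].
by exists (Coind t l r lu ru ilu iru); apply: ok_coind.
Qed.

Theorem proposition5p5 (G : ctx) (A : ty) (x y z w f g h : tm) :
  ctx_ok G -> ty_ok G A -> cell_ty A ->
  tm_ok G x A -> tm_ok G y A -> tm_ok G z A -> tm_ok G w A ->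
  tm_ok G f (Arr A x y) -> tm_ok G g (Arr A y z) -> tm_ok G h (Arr A z w) ->
  invertible G A x z (comp_tm A x y z f g) ->
  invertible G A y w (comp_tm A y z w g h) ->
  [/\ invertible G A x y f, invertible G A y z g & invertible G A z w h].
Proof.
move=> cG _ _ _ _ _ _ ok_f ok_g ok_h [a ok_a] [b ok_b].
have ext := extends_refl cG.
have ok_fg := comp_ok ok_f ok_g; have ok_gh := comp_ok ok_g ok_h.
have [la ra] := sim_of_inverse ok_fg ok_a; have [lb rb] := sim_of_inverse ok_gh ok_b.
have ok_la := ok_linv ok_fg ok_a; have ok_ra := ok_rinv ok_fg ok_a.
have ok_lb := ok_linv ok_gh ok_b; have ok_rb := ok_rinv ok_gh ok_b.
set k := comp_tm A z x y (Linv a) f; set r := comp_tm A z w y h (Rinv b).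
have ok_k : tm_ok G k (Arr A z y) := comp_ok ok_la ok_f.
have ok_r : tm_ok G r (Arr A z y) := comp_ok ok_h ok_rb.
have kg : sim G G A z z (comp_tm A z y z k g) (id_tm A z).
  exact: (sim_trans ext (sim_assoc ext ok_la ok_f ok_g) la).
have gr : sim G G A y y (comp_tm A y z y g r) (id_tm A y).
  exact: (sim_trans ext (sim_assocV ext ok_g ok_h ok_rb) rb).
have gk := left_inverse_is_right ext ok_g ok_k ok_r kg gr (sim_sym gr).
have rg := right_inverse_is_left ext ok_g ok_k ok_r gr kg (sim_sym kg).
split.
- apply: (invertible_of_sim ok_f (comp_ok ok_g ok_la) (comp_ok ok_g ok_ra)).
    exact: (sim_trans ext (sim_assoc ext ok_g ok_la ok_f) gk).
  exact: (sim_trans ext (sim_assocV ext ok_f ok_g ok_ra) ra).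
- exact: invertible_of_sim ok_g ok_k ok_r kg gr.
- apply: (invertible_of_sim ok_h (comp_ok ok_lb ok_g) (comp_ok ok_rb ok_g)).
    exact: (sim_trans ext (sim_assoc ext ok_lb ok_g ok_h) lb).
  exact: (sim_trans ext (sim_assocV ext ok_h ok_rb ok_g) rg).
Qed.
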